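(* Let $X$ be an infinite-dimensional complex Banach space, $T\in L(X)$ and $1\le i\le 9$. The following conditions are equivalent: (i) there exists $(M,N)\in Red(T)$ such that $T_M\in \mathbf{R}_i$ and $T_N$ is meromorphic (that is, $T\in \mathbf{GD}(\mathcal M)\mathbf{R}_i$); (ii) $T$ admits a generalized Kato-meromorphic decomposition and $0\notin \mathrm{int}\,\sigma_{\mathbf{R}_i}(T)$; (iii) $T$ admits a generalized Kato-meromorphic decomposition and $0\notin \mathrm{acc}\,\sigma_{\mathbf{BR}_i}(T)$; (iv) $T$ admits a generalized Kato-meromorphic decomposition and $0\notin \mathrm{int}\,\sigma_{\mathbf{BR}_i}(T)$.
   Context: $L(X)$ is the algebra of bounded linear operators on $X$; $N(T)$, $R(T)$ are kernel and range; $\mathrm{int}\,K$ and $\mathrm{acc}\,K$ are the sets of interior and accumulation points of $K\subset\mathbb C$; $\mathbb N_0$ denotes the non-negative integers. $(M,N)\in Red(T)$ means that $M,N$ are closed $T$-invariant subspaces with $X=M\oplus N$; $T_M$, $T_N$ are the restrictions of $T$ to $M$, $N$ viewed as operators on $M$, $N$. All operator classes below are defined in the same way for operators on any Banach space (in particular on $M$, $N$). An operator $T$ is Kato if $R(T)$ is closed and $N(T)\subset R(T^n)$ for every $n\in\mathbb N$. An operator is meromorphic if every non-zero point of its spectrum is a pole of its resolvent. $T$ admits a generalized Kato-meromorphic decomposition if there is $(M,N)\in Red(T)$ with $T_M$ Kato and $T_N$ meromorphic. Classes $\mathbf R_i$: $\mathbf R_1$ = bounded below operators; $\mathbf R_2$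 = surjective operators; $\mathbf R_3$ = invertible operators; $\mathbf R_4$ = upper semi-Fredholm operators (finite-dimensional kernel, closed range); $\mathbf R_5$ = lower semi-Fredholm operators (range of finite codimension); $\mathbf R_6$ = Fredholm operators; $\mathbf R_7$ = upper semi-Weyl operators (upper semi-Fredholm with index $\le 0$); $\mathbf R_8$ = lower semi-Weyl operators (lower semi-Fredholm with index $\ge 0$); $\mathbf R_9$ = Weyl operators (Fredholm of index $0$). The index is $\dim N(T)-\mathrm{codim}\,R(T)$. $T\in\mathbf{BR}_i$ means that there is $n\in\mathbb N_0$ such that $R(T^n)$ is closed and the restriction $T_n:R(T^n)\to R(T^n)$ of $T$ belongs to $\mathbf R_i$ (as an operator on the Banach space $R(T^n)$). It is known that $\mathbf{BR}_1$ (resp. $\mathbf{BR}_2$, $\mathbf{BR}_3$) is the class of left Drazin invertible (resp. right Drazin invertible, Drazin invertible) operators. $\sigma_{\mathbf R_i}(T)=\{\lambda\in\mathbb C: T-\lambda I\notin\mathbf R_i\}$ and $\sigma_{\mathbf{BR}_i}(T)=\{\lambda\in\mathbb C: T-\lambda I\notin\mathbf{BR}_i\}$. *)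

(* Defs.v *)
From HB Require Import structures.
From mathcomp Require Import all_boot all_order all_algebra.
From mathcomp Require Import all_classical all_reals all_analysis.
From mathcomp Require Import complex.

Set Implicit Arguments.
Unset Strict Implicit.
Unset Printing Implicit Defensive.

Import Order.TTheory GRing.Theory Num.Theory.
Import numFieldNormedType.Exports.

Local Open Scope classical_set_scope.
Local Open Scope ring_scope.

(** The complex field is [R[i]]; as a topological space it is written [R[i]^o].

    An operator on a closed subspace [U] of [X] (itself a Banach space for the
    inherited norm) is represented by a function [f : X -> X] mapping [U] into
    [U], of which only the values on [U] matter.  Every notion below takes the
    pair [U], [f]: the restriction [T_M] is [M], [T]; the restriction of [T] to
    [R(T^n)] is [iter n T @` setT], [T]; and [T] itself is [setT], [T]. *)

Section OperatorsOnSubspaces.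
Context {R : realType} {X : completeNormedModType R[i]}.
Implicit Types (U V M N : set X) (f S T : X -> X) (l z : R[i]).

Definition closed_subspace U : Prop := closed U /\ submod_closed [in U].

Definition invariant_on U f : Prop := forall x, U x -> U (f x).

Definition op_ker U f : set X := [set x | U x /\ f x = 0].

Definition op_ran U f : set X := f @` U.

Definition subscal f l : X -> X := fun x => f x - l *: x.

Definition bounded_operator U f : Prop :=
  [/\ invariant_on U f,
      forall (a : R[i]) x y, U x -> U y -> f (a *: x + y) = a *: f x + f y
    & exists c : R[i], forall x, U x -> `|f x| <= c * `|x|].

(** [b] is a family in [U] whose classes form a basis of [U / V]. *)
Definition quotient_basis U V (n : nat) (b : 'I_n -> X) : Prop :=
  (forall i, U (b i)) /\
  forall x, U x -> exists! c : 'rV[R[i]]_n, V (x - \sum_i c 0 i *: b i).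

(** The dimension of [U / V], equal to [+oo] when [U / V] has no finite basis
    (the infimum of the empty set). *)
Definition quotient_dim U V : \bar R :=
  ereal_inf [set (n%:R%:E : \bar R) | n in
    [set n : nat | exists b : 'I_n -> X, quotient_basis U V b]].

Definition space_dim U : \bar R := quotient_dim U [set 0].

Definition nullity U f : \bar R := space_dim (op_ker U f).

Definition defect U f : \bar R := quotient_dim U (op_ran U f).

(** Only used when [nullity U f] or [defect U f] is finite. *)
Definition op_index U f : \bar R := (nullity U f - defect U f)%E.

Definition bounded_below U f : Prop :=
  exists2 c : R[i], 0 < c & forall x, U x -> c * `|x| <= `|f x|.

Definition surjective_on U f : Prop := op_ran U f = U.

Definition op_inverse U f S : Prop :=
  bounded_operator U S /\ forall x, U x -> S (f x) = x /\ f (S x) = x.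

Definition invertible U f : Prop := exists S, op_inverse U f S.

Definition upper_semi_Fredholm U f : Prop :=
  (nullity U f < +oo)%E /\ closed (op_ran U f).

Definition lower_semi_Fredholm U f : Prop := (defect U f < +oo)%E.

Definition Fredholm U f : Prop :=
  upper_semi_Fredholm U f /\ lower_semi_Fredholm U f.

Definition upper_semi_Weyl U f : Prop :=
  upper_semi_Fredholm U f /\ (op_index U f <= 0)%E.

Definition lower_semi_Weyl U f : Prop :=
  lower_semi_Fredholm U f /\ (0 <= op_index U f)%E.

Definition Weyl U f : Prop := Fredholm U f /\ op_index U f = 0%E.

Definition classR (i : nat) U f : Prop :=
  match i with
  | 1%N => bounded_below U f
  | 2%N => surjective_on U f
  | 3%N => invertible U f
  | 4%N => upper_semi_Fredholm U f
  | 5%N => lower_semi_Fredholm U f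
  | 6%N => Fredholm U f
  | 7%N => upper_semi_Weyl U f
  | 8%N => lower_semi_Weyl U f
  | 9%N => Weyl U f
  | _ => False
  end.

Definition classBR (i : nat) U f : Prop :=
  exists n : nat, closed (op_ran U (iter n f)) /\ classR i (op_ran U (iter n f)) f.

Definition sigmaR (i : nat) U f : set R[i]^o :=
  [set l : R[i]^o | ~ classR i U (subscal f l)].

Definition sigmaBR (i : nat) U f : set R[i]^o :=
  [set l : R[i]^o | ~ classBR i U (subscal f l)].

Definition spectrum U f : set R[i]^o :=
  [set l : R[i]^o | ~ invertible U (subscal f l)].

Definition Kato U f : Prop :=
  closed (op_ran U f) /\ forall n : nat, op_ker U f `<=` op_ran U (iter n f).

(** [l] is a pole of order [p] of the resolvent [z |-> (f - z)^-1] of [f] (the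
    opposite convention [(z - f)^-1] only changes the sign of the
    coefficients): on a punctured disc around [l] the resolvent exists and is
    the sum, in operator norm, of the Laurent series
    [\sum_k (z - l) ^ (k - p) A_k], with [p > 0] and [A_0 != 0]. *)
Definition resolvent_pole_of_order U f l (p : nat) : Prop :=
  (0 < p)%N /\
  exists A : nat -> X -> X,
  [/\ forall k, bounded_operator U (A k),
      exists2 x, U x & A 0%N x != 0
    & exists2 r : R[i], 0 < r &
      forall z, 0 < `|z - l| < r ->
      exists2 S, op_inverse U (subscal f z) S &
      forall e : R[i], 0 < e -> exists m : nat, forall n, (m <= n)%N ->
      forall x, U x ->
      `|\sum_(k < n) (z - l) ^ (k%:Z - p%:Z) *: A k x - S x| <= e * `|x|].

Definition resolvent_pole U f l : Prop :=
  exists p : nat, resolvent_pole_of_order U f l p.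

Definition meromorphic U f : Prop :=
  forall l, spectrum U f l -> l != 0 -> resolvent_pole U f l.

(** [(M, N)] belongs to [Red(T)]. *)
Definition Red T M N : Prop :=
  [/\ closed_subspace M /\ closed_subspace N,
      invariant_on M T /\ invariant_on N T,
      [set u + v | u in M & v in N] = [set: X]
    & M `&` N = [set 0]].

Definition GK_meromorphic_decomposition T : Prop :=
  exists M N, [/\ Red T M N, Kato M T & meromorphic N T].

Definition GDM_class (i : nat) T : Prop :=
  exists M N, [/\ Red T M N, classR i M T & meromorphic N T].

End OperatorsOnSubspaces.

(* Main.v *)
Require Import Defs.
From HB Require Import structures.
From mathcomp Require Import all_boot all_order all_algebra.
From mathcomp Require Import all_classical all_reals all_analysis.
From mathcomp Require Import complex.
From mathcomp Require Import ring lra.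
Import Order.TTheory GRing.Theory Num.Theory.
Import numFieldNormedType.Exports.
Local Open Scope classical_set_scope.
Local Open Scope ring_scope.
Local Open Scope complex_scope.

Set Implicit Arguments.
Unset Strict Implicit.
Unset Printing Implicit Defensive.

(** A Kato operator [S] maps its hyperrange [E] onto itself, its kernel lies in
    [E], and it is bounded below modulo [E].  These properties persist for
    [S - mu] when [mu] is small, and then nullity and defect are locally
    constant along the segment from [S] to [S - mu], hence constant; moreover
    restricting a Kato operator to [R(S^n)] changes neither of them.

    If [T_M] belongs to [R_i] it is semi-Fredholm, so finitely many nilpotent
    Jordan blocks split off from it and leave a Kato operator; the blocks are
    absorbed by [T_N], which stays meromorphic, so [T_M] may be taken Kato.  For
    small [l <> 0], [T_N - l] is invertible or has a pole of some order [p], and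
    in both cases [T - l] has on [R((T - l)^p)] the nullity and defect of [T_M].
    Resolvent points of [T_N] being dense, this excludes [0] from the interior
    and from the accumulation points.

    Conversely, let [T - l] be in [BR_i] through [R((T - l)^n)] with [l] small.
    On the part of this range inside [N] the operator is semi-Fredholm and has
    arbitrarily small resolvent points, so its nullity and defect are finite and
    equal; cancelling them leaves those of [T_M]. *)

(** Once the range is closed, each of the nine classes is a condition on the pair (nullity, defect).
    This pair is transported rather than the index, which does not see injectivity or surjectivity.
    At a pole of order [p] the operator [T_N - l] becomes bijective only on [R((T_N - l)^p)], while
    the Kato part keeps both numbers under such a restriction; this is how the classes [BR_i] enter.
    In the converse [n] is unknown and the part in [N] need not be bijective. Having resolvent
    points arbitrarily close, it is the sum of a Kato operator with both numbers [0] and a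
    finite-dimensional nilpotent one, for which the two numbers agree. The main obstacle is the
    stability of Kato operators when nullity or defect is infinite: for each [m] the property of
    having dimension at least [m] is locally constant, but the radius depends on [m]. A segment on
    which every operator is Kato yields one radius for all [m]. Neither quotient spaces nor adjoint
    operators occur: near-best approximants stand for the quotient norm, and preimages of controlled
    norm stand for closedness of ranges. *)

Section LinearExpressions.
Context (K : comNzRingType) (V : lmodType K).

(** Vector identities are proved by reflection: both sides become a [lexp], and it suffices to
    compare the coefficients of every atom, which leaves goals in the scalar ring. *)
Inductive lexp := LAtom of nat | LZero | LAdd of lexp & lexp | LOpp of lexp | LScale of K & lexp.

Fixpoint leval (s : seq V) e : V :=
  match e with
  | LAtom n => s`_n
  | LZero => 0
  | LAdd e1 e2 => leval s e1 + leval s e2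
  | LOpp e => - leval s e
  | LScale a e => a *: leval s e
  end.

Fixpoint lcoef (n : nat) e : K :=
  match e with
  | LAtom m => if m == n then 1 else 0
  | LZero => 0
  | LAdd e1 e2 => lcoef n e1 + lcoef n e2
  | LOpp e => - lcoef n e
  | LScale a e => a * lcoef n e
  end.

Lemma levalE s e : leval s e = \sum_(i < size s) lcoef i e *: s`_i.
Proof.
elim: e => /= [n||e1 -> e2 ->|e ->|a e ->].
- have [sn|ns] := leqP (size s) n.
    rewrite nth_default // big1 // => i _.
    by rewrite gtn_eqF ?scale0r // (leq_trans (ltn_ord i)).
  rewrite (bigD1 (Ordinal ns)) //= eqxx scale1r big1 ?addr0 // => i ni.
  by rewrite ifN ?scale0r // eq_sym.
- by rewrite big1 // => i _; rewrite scale0r.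
- by rewrite -big_split; apply: eq_bigr => i _; rewrite scalerDl.
- by rewrite -sumrN; apply: eq_bigr => i _; rewrite scaleNr.
- by rewrite scaler_sumr; apply: eq_bigr => i _; rewrite scalerA.
Qed.

(** A conjunction in [Prop] instead of a boolean test: the coefficients agree only up to [ring] or
    [field], not by computation. *)
Fixpoint lcheck (n : nat) e1 e2 : Prop :=
  if n is n'.+1 then lcoef n' e1 = lcoef n' e2 /\ lcheck n' e1 e2 else True.

Lemma lcheckP s e1 e2 : lcheck (size s) e1 e2 -> leval s e1 = leval s e2.
Proof.
move=> h; rewrite !levalE.
have {}h i : (i < size s)%N -> lcoef i e1 = lcoef i e2.
  move: h; elim: (size s) => //= n ih [h1 /ih h2]; rewrite ltnS leq_eqVlt => /orP[/eqP -> //|].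
  exact: h2.
by apply: eq_bigr => i _; rewrite h.
Qed.

End LinearExpressions.

(* Atoms are compared up to conversion: canonical structures produce copies of
   the same vector that differ syntactically. *)
Ltac lmem x s :=
  lazymatch s with
  | nil => constr:(false)
  | cons x _ => constr:(true)
  | cons ?y ?s' =>
      match s with
      | _ => let _ := match s with _ => unify x y end in constr:(true)
      | _ => lmem x s'
      end
  end.

Ltac lindex x s :=
  lazymatch s with
  | cons x _ => constr:(O)
  | cons ?y ?s' =>
      match s with
      | _ => let _ := match s with _ => unify x y end in constr:(O)
      | _ => let n := lindex x s' in constr:(S n)
      end
  end.

Ltac latoms t s :=
  lazymatch t with
  | GRing.add ?a ?b => let s1 := latoms a s in latoms b s1
  | GRing.opp ?a => latoms a s
  | GRing.scale _ ?a => latoms a s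
  | GRing.zero => s
  | _ => let b := lmem t s in
         lazymatch b with true => s | false => constr:(cons t s) end
  end.

Ltac lreify K t s :=
  lazymatch t with
  | GRing.add ?a ?b =>
      let e1 := lreify K a s in let e2 := lreify K b s in constr:(@LAdd K e1 e2)
  | GRing.opp ?a => let e := lreify K a s in constr:(@LOpp K e)
  | GRing.scale ?c ?a => let e := lreify K a s in constr:(@LScale K c e)
  | GRing.zero => constr:(@LZero K)
  | _ => let n := lindex t s in constr:(@LAtom K n)
  end.

Ltac module_with K V tac :=
  lazymatch goal with
  | |- @eq ?A ?l ?r =>
    let s := latoms l (@nil A) in
    let s := latoms r s in
    let e1 := lreify K l s in
    let e2 := lreify K r s in
    change (@leval K V s e1 = @leval K V s e2);
    apply: lcheckP; cbn [lcheck lcoef size eqtype.eq_op]; repeat split; simpl; tac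
  end.

Ltac vec_with tac :=
  match goal with
  | X : CompleteNormedModule.type ?K |- _ => module_with (K : comNzRingType) X tac
  end.

Ltac vec := vec_with ltac:(ring).

(** * Real-valued norms and closed subspaces *)

Section RealNorm.
Context {R : realType}.

(** Norms take values in [R[i]], whose order is only partial; [rn] reads them in [R], where linear
    arithmetic applies. *)
Definition rn {V : normedZmodType R[i]} (x : V) : R := complex.Re `|x|.

Lemma rnE {V : normedZmodType R[i]} (x : V) : `|x| = (rn x)%:C.
Proof. by rewrite /rn RRe_real// normr_real. Qed.

Lemma rn_ge0 {V : normedZmodType R[i]} (x : V) : 0 <= rn x.
Proof. by rewrite -lecR -rnE normr_ge0. Qed.

Lemma rn0 {V : normedZmodType R[i]} : rn (0 : V) = 0.
Proof. by rewrite /rn normr0. Qed.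

Lemma rn_eq0 {V : normedZmodType R[i]} (x : V) : (rn x == 0) = (x == 0).
Proof. by rewrite -(inj_eq (@complexI R)) -rnE normr_eq0. Qed.

Lemma rn_gt0 {V : normedZmodType R[i]} (x : V) : (0 < rn x) = (x != 0).
Proof. by rewrite lt_def rn_ge0 andbT rn_eq0. Qed.

Lemma rnN {V : normedZmodType R[i]} (x : V) : rn (- x) = rn x.
Proof. by rewrite /rn normrN. Qed.

Lemma rnBC {V : normedZmodType R[i]} (x y : V) : rn (x - y) = rn (y - x).
Proof. by rewrite -rnN opprB. Qed.

Lemma rnD {V : normedZmodType R[i]} (x y : V) : rn (x + y) <= rn x + rn y.
Proof. by rewrite -lecR rmorphD /= -!rnE ler_normD. Qed.

Lemma rnB {V : normedZmodType R[i]} (x y : V) : rn (x - y) <= rn x + rn y.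
Proof. by rewrite -(rnN y) rnD. Qed.

Lemma rn_le (V : normedZmodType R[i]) (x y z : V) : x = y + z -> rn x <= rn y + rn z.
Proof. by move=> ->; exact: rnD. Qed.

Lemma rnZ {V : normedModType R[i]} (a : R[i]) (x : V) : rn (a *: x) = rn a * rn x.
Proof. by apply: (@complexI R); rewrite -rnE normrZ rmorphM /= -!rnE. Qed.

Lemma rnM (a b : R[i]) : rn (a * b) = rn a * rn b.
Proof. by apply: (@complexI R); rewrite -rnE normrM rmorphM /= -!rnE. Qed.

Lemma rnX (a : R[i]) n : rn (a ^+ n) = rn a ^+ n.
Proof. by apply: (@complexI R); rewrite -rnE normrX rmorphXn /= -!rnE. Qed.

Lemma rnV (a : R[i]) : rn a^-1 = (rn a)^-1.
Proof. by apply: (@complexI R); rewrite -rnE normfV fmorphV /= -!rnE. Qed.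

Lemma rnC (a : R) : rn (a%:C) = `|a|.
Proof. by rewrite /rn normc_def /= expr0n addr0 sqrtr_sqr. Qed.

Lemma rn_sum {V : normedZmodType R[i]} (I : Type) (r : seq I) (P : pred I) (F : I -> V) :
  rn (\sum_(i <- r | P i) F i) <= \sum_(i <- r | P i) rn (F i).
Proof.
elim/big_ind2: _ => [|x1 x2 y1 y2 h1 h2|//]; first by rewrite rn0.
exact: le_trans (rnD _ _) (lerD h1 h2).
Qed.

Lemma ltC0 (e : R[i]) : 0 < e -> e = (complex.Re e)%:C /\ 0 < complex.Re e.
Proof.
by rewrite ltcE /= => /andP[/eqP i0 e0]; split => //; apply/eqP; rewrite eq_complex /= -i0 !eqxx.
Qed.

End RealNorm.

Section Closed.
Context {R : realType} {X : completeNormedModType R[i]}.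
Implicit Types (U V M N : set X) (x y z : X).

Lemma closed_rn U : closed U <->
  forall x, (forall e : R, 0 < e -> exists2 u, U u & rn (x - u) < e) -> U x.
Proof.
split=> [cU x h|h].
  apply: cU => B /nbhs_ballP[e /= e0 xeB].
  have [eE re0] := ltC0 e0.
  have [u Uu xu] := h _ re0; exists u; split=> //. apply: xeB.
  by rewrite -ball_normE /= [e](ltC0 e0).1 rnE ltcR.
apply/closure_id/seteqP; split=> [|x clx]; first exact: subset_closure.
apply: h => e e0.
have e0' : 0 < e%:C by rewrite ltcR.
have [u [Uu]] := clx _ (nbhsx_ballx x _ e0').
by rewrite -ball_normE /= rnE ltcR => xu; exists u.
Qed.

Lemma complete_rn (u : nat -> X) :
  (forall e : R, 0 < e -> exists m, forall n, (m <= n)%N -> rn (u n - u m) < e) ->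
  exists x, forall e : R, 0 < e -> exists m, forall n, (m <= n)%N -> rn (u n - x) < e.
Proof.
move=> h.
have : cauchy (u @ \oo).
  apply/cauchyP => e e0; have [_ re0] := ltC0 e0.
  have [m hm] := h _ re0; exists (u m); exists m => // n /= mn.
  by rewrite -ball_normE /= [e](ltC0 e0).1 distrC rnE ltcR hm.
move/cauchy_cvg => /cvg_ex[x /cvgrPdist_lt hx]; exists x => e e0.
have e0' : 0 < e%:C by rewrite ltcR.
have [m _ hm] := hx _ e0'; exists m => n mn.
by have := hm n mn; rewrite /= rnE ltcR rnBC.
Qed.

Definition linsub U := U 0 /\ forall (a : R[i]) x y, U x -> U y -> U (a *: x + y).

Lemma closed_linsubP U : closed_subspace U <-> closed U /\ linsub U.
Proof.
split=> [[cU [U0 UD]]|[cU [U0 UD]]]; split=> //; split.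
- by move: U0; rewrite inE.
- by move=> a x y Ux Uy; have := UD a x y; rewrite !inE; exact.
- by rewrite inE.
- by move=> a x y; rewrite !inE; exact: UD.
Qed.

Lemma linsub0 U : linsub U -> U 0. Proof. by case. Qed.

Lemma linsubZ U a x : linsub U -> U x -> U (a *: x).
Proof. by case=> U0 h Ux; rewrite -[_ *: _]addr0; exact: h. Qed.

Lemma linsubD U x y : linsub U -> U x -> U y -> U (x + y).
Proof. by case=> U0 h Ux Uy; rewrite -[x]scale1r; exact: h. Qed.

Lemma linsubN U x : linsub U -> U x -> U (- x).
Proof. by move=> sU Ux; rewrite -scaleN1r; exact: linsubZ. Qed.

Lemma linsubB U x y : linsub U -> U x -> U y -> U (x - y).
Proof. by move=> sU Ux Uy; apply: linsubD => //; exact: linsubN. Qed.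

Lemma linsub_sum U (I : Type) (r : seq I) (P : pred I) (F : I -> X) : linsub U ->
  (forall i, P i -> U (F i)) -> U (\sum_(i <- r | P i) F i).
Proof.
move=> sU h; elim/big_ind: _ => //; first exact: linsub0.
by move=> x y; exact: linsubD.
Qed.

Lemma closed_subspace_linsub U : closed_subspace U -> linsub U.
Proof. by case/closed_linsubP. Qed.

Lemma closed_subspace_lim U x : closed_subspace U ->
  (forall e : R, 0 < e -> exists2 u, U u & rn (x - u) < e) -> U x.
Proof. by case=> /closed_rn h _; exact: h. Qed.

Lemma linsubT : linsub [set: X]. Proof. by split. Qed.

Lemma closed_subspaceT : closed_subspace [set: X].
Proof. by apply/closed_linsubP; split; [exact: closedT | exact: linsubT]. Qed.

Lemma linsub_set0 : linsub [set (0 : X)].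
Proof. by split=> // a x y /= -> ->; rewrite scaler0 addr0. Qed.

Lemma closed_subspace_set0 : closed_subspace [set (0 : X)].
Proof.
apply/closed_linsubP; split; last exact: linsub_set0.
apply/closed_rn => x h; apply/eqP; rewrite /= -rn_eq0; apply/contraT => xn0.
have x0 : 0 < rn x by rewrite rn_gt0 -rn_eq0.
by have [u /= ->] := h _ x0; rewrite subr0 ltxx.
Qed.

Lemma closed_subspaceI U V : closed_subspace U -> closed_subspace V -> closed_subspace (U `&` V).
Proof.
move=> /closed_linsubP[cU [U0 sU]] /closed_linsubP[cV [V0 sV]]; apply/closed_linsubP; split.
  exact: closedI.
by split=> // a x y [] ? ? [] ? ?; split; [exact: sU | exact: sV].
Qed.

(* An approximate minimiser of the distance to [V]; the factor [2] absorbs the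
   fact that the infimum need not be attained, and when it is [0] then [x] is in [V]. *)
Lemma near_best V x : closed_subspace V ->
  exists2 v, V v & forall w, V w -> rn (x - v) <= 2 * rn (x - w).
Proof.
move=> cV; have sV := closed_subspace_linsub cV.
pose A := [set rn (x - w) | w in V].
have A0 : A !=set0 by exists (rn (x - 0)), 0 => //; exact: linsub0.
have lA : has_lbound A by exists 0 => _ [w _ <-]; exact: rn_ge0.
have hA : has_inf A by split.
have infA w : V w -> inf A <= rn (x - w) by move=> Vw; apply: ge_inf => //; exists w.
have i0 : 0 <= inf A by apply: lb_le_inf => // _ [w _ <-]; exact: rn_ge0.
have [iA0|iA] := eqVneq (inf A) 0.
  exists x; last by move=> w _; rewrite subrr rn0 mulr_ge0 ?rn_ge0.
  apply: (closed_subspace_lim cV) => e e0.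
  have [_ [w Vw <-]] := inf_adherent e0 hA.
  by rewrite iA0 add0r; exists w.
have ip : 0 < inf A by rewrite lt_def iA.
have [_ [w Vw <-] h] := inf_adherent ip hA.
exists w => // w' /infA; move: h; lra.
Qed.

End Closed.

(** * The open mapping theorem *)

Section OpenMapping.
Context {R : realType}.

Lemma half_pow_small (K e : R) : 0 < e -> exists m : nat, K / 2 ^+ m < e.
Proof.
move=> e0; pose m := Num.bound (`|K| / e); exists m.
have h : `|K| / e < m%:R by apply: archi_boundP; rewrite divr_ge0 // ltW.
have h2 : (m%:R : R) <= 2 ^+ m by rewrite -natrX ler_nat ltnW // ltn_expl.
rewrite ltr_pdivrMr ?exprn_gt0 //.
apply: le_lt_trans (ler_norm K) _; move: h; rewrite ltr_pdivrMr // => h.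
by apply: lt_le_trans h _; rewrite mulrC ler_wpM2l // ltW.
Qed.

Lemma le0_half_pow (a K : R) : (forall n : nat, a <= K / 2 ^+ n) -> a <= 0.
Proof.
move=> h; rewrite leNgt; apply/negP => a0.
by have [m /(le_lt_trans (h m))] := half_pow_small K a0; rewrite ltxx.
Qed.

Lemma half_seq_le (r : nat -> R) : (forall n, r n.+1 <= r n / 2) ->
  forall n k, r (n + k)%N <= r n / 2 ^+ k.
Proof.
move=> h n; elim=> [|k ih]; first by rewrite addn0 expr0 divr1.
rewrite addnS (le_trans (h _)) // exprS invfM mulrA mulrAC; move: ih; lra.
Qed.

Context {X : completeNormedModType R[i]}.

Lemma geom_cvg (u : nat -> X) (r : nat -> R) :
  (forall n, rn (u n.+1 - u n) <= r n) -> (forall n, r n.+1 <= r n / 2) ->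
  exists x, forall n, rn (x - u n) <= 2 * r n.
Proof.
move=> hu hr.
have r0 n : 0 <= r n by rewrite (le_trans (rn_ge0 _) (hu n)).
(* The subtracted term makes the induction close: a step costs at most [r (n + k)], and halving [r]
   frees at least that much. *)
have step n k : rn (u (n + k)%N - u n) <= 2 * r n - 2 * r (n + k)%N.
  elim: k => [|k ih]; first by rewrite addn0 !subrr rn0.
  rewrite addnS.
  have := @rn_le _ _ (u (n + k).+1 - u n) (u (n + k).+1 - u (n + k)%N) (u (n + k)%N - u n).
  rewrite addrA subrK => /(_ erefl).
  have := hu (n + k)%N; have := hr (n + k)%N; move: ih; lra.
have [x hx] : exists x, forall e : R, 0 < e -> exists m, forall n, (m <= n)%N -> rn (u n - x) < e.
  apply: complete_rn => e e0.
  have [m hm] := half_pow_small (2 * r 0%N) e0; exists m => n mn.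
  have := step m (n - m)%N; rewrite subnKC // => h1.
  have := half_seq_le hr 0 m; rewrite add0n; have := r0 n; move: hm h1; lra.
exists x => n; apply/ler_addgt0Pr => e e0.
have [m hm] := hx _ e0.
have := hm (n + m)%N (leq_addl _ _).
have := step n m; have := r0 (n + m)%N.
have := @rn_le _ _ (x - u n) (x - u (n + m)%N) (u (n + m)%N - u n).
rewrite addrA subrK rnBC => /(_ erefl); rewrite (rnBC x (u (n + m)%N)); lra.
Qed.

Definition bounded_op (f : X -> X) := exists2 c : R, 0 <= c & forall x, rn (f x) <= c * rn x.

(** The range of [(x, v) |-> f x + v] on the product of [U] and [V]. It is used with [V] zero, with
    [V] a finite-dimensional complement of the range, and with [f] the identity, where it is a sum
    of two subspaces. *)
Definition sum_range (f : X -> X) (U V : set X) : set X :=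
  [set y | exists x v, [/\ U x, V v & y = f x + v]].

(** Successive approximation: the residual is halved at each step, so the corrections form a
    convergent series. [Y] is left free in order to be the range, its closure, or the hyperrange of
    a Kato operator. *)
Lemma approx_preimage (f : {linear X -> X}) U V (Y : set X) (C : R) :
  bounded_op f -> closed_subspace U -> closed_subspace V -> 0 <= C ->
  (forall y, Y y -> exists x v, [/\ U x, V v, rn x <= C * rn y & rn v <= C * rn y] /\
     Y (y - (f x + v)) /\ rn (y - (f x + v)) <= rn y / 2) ->
  forall y, Y y -> exists x v, [/\ U x, V v, y = f x + v, rn x <= 2 * C * rn y & rn v <= 2 * C * rn y].
Proof.
move=> [c c0 fc] cU cV C0 h y Yy.
have sU := closed_subspace_linsub cU; have sV := closed_subspace_linsub cV.
have [g hg] : exists g : X -> X * X, forall y, Y y -> [/\ U (g y).1, V (g y).2,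
    rn (g y).1 <= C * rn y & rn (g y).2 <= C * rn y] /\
     Y (y - (f (g y).1 + (g y).2)) /\ rn (y - (f (g y).1 + (g y).2)) <= rn y / 2.
  suff /choice[g hg] : forall y, exists gy : X * X, Y y -> [/\ U gy.1, V gy.2,
    rn gy.1 <= C * rn y & rn gy.2 <= C * rn y] /\
     Y (y - (f gy.1 + gy.2)) /\ rn (y - (f gy.1 + gy.2)) <= rn y / 2 by exists g.
  move=> z.
  have [Yz|nYz] := pselect (Y z); last by exists (0, 0).
  by have [x [v hxv]] := h _ Yz; exists (x, v).
pose r n := iter n (fun z => z - (f (g z).1 + (g z).2)) y.
have Yr n : Y (r n) by elim: n => // n ih; exact: (hg _ ih).2.1.
have rS n : r n.+1 = r n - (f (g (r n)).1 + (g (r n)).2) by [].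
have rr n : rn (r n.+1) <= rn (r n) / 2 by exact: (hg _ (Yr n)).2.2.
pose xs n := \sum_(k < n) (g (r k)).1.
pose vs n := \sum_(k < n) (g (r k)).2.
have Er n : y - (f (xs n) + vs n) = r n.
  elim: n => [|n ih]; first by rewrite /xs /vs !big_ord0 raddf0 addr0 subr0.
  by rewrite rS -{1}ih /xs /vs !big_ord_recr /= (linearD f); vec.
have Cr n : C * rn (r n.+1) <= (C * rn (r n)) / 2 by rewrite -mulrA ler_wpM2l.
have [x hx] : exists x, forall n, rn (x - xs n) <= 2 * (C * rn (r n)).
  apply: geom_cvg => // n; rewrite /xs big_ord_recr /= (_ : _ - _ = (g (r n)).1); last by vec.
  by have [[_ _ ]] := hg _ (Yr n).
have [v hv] : exists v, forall n, rn (v - vs n) <= 2 * (C * rn (r n)).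
  apply: geom_cvg => // n; rewrite /vs big_ord_recr /= (_ : _ - _ = (g (r n)).2); last by vec.
  by have [[_ _ ]] := hg _ (Yr n).
have small e : 0 < e -> exists m, 2 * (C * rn (r m)) < e.
  move=> e0; have [m hm] := half_pow_small (2 * (C * rn y)) e0; exists m.
  have := half_seq_le (r := fun n => C * rn (r n)) Cr 0 m; rewrite add0n /=.
  move: hm; rewrite -mulrA; lra.
exists x, v; split.
- apply: (closed_subspace_lim cU) => e /small[m hm]; exists (xs m).
    by apply: linsub_sum => // i _; have [[]] := hg _ (Yr i).
  exact: le_lt_trans (hx m) hm.
- apply: (closed_subspace_lim cV) => e /small[m hm]; exists (vs m).
    by apply: linsub_sum => // i _; have [[]] := hg _ (Yr i).
  exact: le_lt_trans (hv m) hm.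
- apply/eqP; rewrite -subr_eq0 -rn_eq0 eq_le rn_ge0 andbT.
  apply: (@le0_half_pow _ (rn y + c * (2 * (C * rn y)) + 2 * (C * rn y))) => n.
  have -> : y - (f x + v) = r n - (f (x - xs n) + (v - vs n)).
    by rewrite -Er !(linearB f); vec.
  have h1 := rnB (r n) (f (x - xs n) + (v - vs n)).
  have h2 := rnD (f (x - xs n)) (v - vs n).
  have h3 := fc (x - xs n).
  have h4 := ler_wpM2l c0 (hx n).
  have h5 := hv n.
  have h6 := half_seq_le (r := fun n => rn (r n)) rr 0 n; rewrite add0n /= in h6.
  have h7 := ler_wpM2l C0 h6.
  have h8 := ler_wpM2l c0 h7.
  move: h1 h2 h3 h4 h5 h6 h7 h8; rewrite !mulrDl !mulrA; lra.
- by have := hx 0%N; rewrite /xs big_ord0 subr0 mulrA.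
- by have := hv 0%N; rewrite /vs big_ord0 subr0 mulrA.
Qed.

(** Baire category: if no [A k] were dense in a ball of [Y], one could choose shrinking balls, stage
    [k] keeping away from [A k], whose common point would escape the cover. *)
Lemma baire_dense (Y : set X) (A : nat -> set X) : closed_subspace Y ->
  (forall y, Y y -> exists k, A k y) ->
  exists k y0 (r : R), [/\ Y y0, 0 < r & forall y, Y y -> rn (y - y0) < r ->
    forall e : R, 0 < e -> exists2 a, A k a & rn (y - a) < e].
Proof.
move=> cY cov; apply: contrapT => nex.
(* Halving the radii makes the centres converge to a limit within [2 * q.2] of [q.1]; the distance
   [4 * q.2] then keeps the limit outside [A k]. *)
have step (k : nat) (p : X * R) : exists q : X * R, Y p.1 -> 0 < p.2 ->
    [/\ Y q.1, 0 < q.2, q.2 <= p.2 / 2, rn (q.1 - p.1) <= p.2 &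
     forall a, A k a -> 4 * q.2 <= rn (q.1 - a)].
  have [[Yp p0]|] := pselect (Y p.1 /\ 0 < p.2); last first.
    by move=> nP; exists p => Yp p0; exfalso; apply: nP.
  have [q hq] : exists q : X * R, [/\ Y q.1, 0 < q.2, rn (q.1 - p.1) < p.2 &
     forall a, A k a -> q.2 <= rn (q.1 - a)].
    apply: contrapT => nq; apply: nex; exists k, p.1, p.2; split=> // y Yy yp e e0.
    apply: contrapT => na; apply: nq; exists (y, e); split=> // a Aa.
    by rewrite leNgt; apply/negP => ya; apply: na; exists a.
  case: hq => Yq q0 qp hq.
  exists (q.1, Num.min (p.2 / 2) (q.2 / 4)) => _ _ /=; split=> //.
  - by rewrite lt_min !divr_gt0.
  - by rewrite ge_min lexx.
  - exact: ltW.
  move=> a /hq qa; have : Num.min (p.2 / 2) (q.2 / 4) <= q.2 / 4 by rewrite ge_min lexx orbT.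
  move: qa; lra.
have {step} [g hg] := choice (fun kp : nat * (X * R) => step kp.1 kp.2).
pose s := fix s n := if n is n'.+1 then g (n', s n') else ((0 : X), (1 : R)).
have sS n : s n.+1 = g (n, s n) by [].
have hs n : Y (s n).1 /\ 0 < (s n).2.
  elim: n => [|n [ih1 ih2]]; first by split=> //=; apply: linsub0; exact: closed_subspace_linsub.
  by rewrite sS; have [] := hg (n, s n) ih1 ih2.
have hs' n := hg (n, s n) (hs n).1 (hs n).2.
have [x hx] : exists x, forall n, rn (x - (s n).1) <= 2 * (s n).2.
  apply: (geom_cvg (u := fun n => (s n).1) (r := fun n => (s n).2)) => n.
    by have [] := hs' n.
  by have [] := hs' n.
have Yx : Y x.
  apply: (closed_subspace_lim cY) => e e0.
  have [m hm] := half_pow_small 2 e0.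
  exists (s m).1; first by case: (hs m).
  apply: le_lt_trans (hx m) _.
  have h n : (s n.+1).2 <= (s n).2 / 2 by have [] := hs' n.
  have := half_seq_le (r := fun n => (s n).2) h 0 m; rewrite add0n /= => h'.
  by apply: le_lt_trans hm; rewrite ler_pM2l //; move: h'; rewrite mul1r.
have [k Akx] := cov _ Yx.
have [_ sk0 _ _ /(_ _ Akx)] := hs' k.
have := hx k.+1; rewrite sS; have := sk0; rewrite /= rnBC; lra.
Qed.

(** Baire gives a ball where the images of vectors of norm at most [k] are dense; differences of two
    such images approximate a multiple of any [z], which is the halving step of
    [approx_preimage]. *)
Lemma open_mapping (f : {linear X -> X}) U V :
  bounded_op f -> closed_subspace U -> closed_subspace V -> closed_subspace (sum_range f U V) ->
  exists2 C : R, 0 < C & forall y, sum_range f U V y ->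
    exists x v, [/\ U x, V v, y = f x + v, rn x <= C * rn y & rn v <= C * rn y].
Proof.
move=> bf cU cV cY; have sU := closed_subspace_linsub cU; have sV := closed_subspace_linsub cV.
have sY := closed_subspace_linsub cY.
pose A (k : nat) := [set y | exists x v, [/\ U x, V v, y = f x + v, rn x <= k%:R & rn v <= k%:R]].
have [|k [y0 [r [Yy0 r0 hr]]]] := baire_dense (A := A) cY.
  move=> _ [x [v [Ux Vv ->]]].
  exists (Num.bound (rn x + rn v)), x, v.
  have := archi_boundP (addr_ge0 (rn_ge0 x) (rn_ge0 v)).
  by have := rn_ge0 x; have := rn_ge0 v; split=> //; lra.
pose C := 4 * k%:R / r.
have C0 : 0 <= C by rewrite divr_ge0 ?mulr_ge0 // ltW.
exists (2 * C + 1); first by move: C0; lra.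
move=> y Yy.
have [z Yz|x [v [Ux Vv yE xC vC]]] := @approx_preimage f U V (sum_range f U V) C bf cU cV C0 _ y Yy; last first.
  exists x, v; split=> //; have := rn_ge0 y; move: xC vC; rewrite mulrDl mul1r; lra.
have [->|z0] := eqVneq z 0.
  exists 0, 0; rewrite (linear0 f) addr0 subr0 rn0 !mulr0 mul0r lexx.
  by do !split=> //; exact: linsub0.
have nz : 0 < rn z by rewrite rn_gt0.
pose s := r / (2 * rn z).
have s0 : 0 < s by rewrite divr_gt0 // mulr_gt0.
have sE : s * rn z = r / 2 by rewrite /s; field; rewrite gt_eqF.
have sC : rn s%:C = s by rewrite rnC gtr0_norm.
have sC0 : s%:C != 0 by rewrite -rn_eq0 sC gt_eqF.
have y1 : rn (y0 + s%:C *: z - y0) < r.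
  rewrite (_ : _ - _ = s%:C *: z); last by vec.
  by rewrite rnZ sC sE; lra.
have Yy1 : sum_range f U V (y0 + s%:C *: z) by apply: linsubD => //; exact: linsubZ.
have r8 : 0 < r / 8 by rewrite divr_gt0.
have [_ [x1 [v1 [Ux1 Vv1 -> x1k v1k]]] h1] := hr _ Yy1 y1 _ r8.
have y0r : rn (y0 - y0) < r by rewrite subrr rn0.
have [_ [x2 [v2 [Ux2 Vv2 -> x2k v2k]]] h2] := hr _ Yy0 y0r _ r8.
exists (s%:C^-1 *: (x1 - x2)), (s%:C^-1 *: (v1 - v2)).
have Ck : C * rn z = s^-1 * (2 * k%:R).
  by rewrite /C /s; field; rewrite !gt_eqF.
have sV' : 0 < s^-1 by rewrite invr_gt0.
have Ux : U (s%:C^-1 *: (x1 - x2)) by apply: linsubZ => //; exact: linsubB.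
have Vv : V (s%:C^-1 *: (v1 - v2)) by apply: linsubZ => //; exact: linsubB.
split; first split=> //.
- by rewrite rnZ rnV sC Ck ler_pM2l //; have := rnB x1 x2; move: x1k x2k; lra.
- by rewrite rnZ rnV sC Ck ler_pM2l //; have := rnB v1 v2; move: v1k v2k; lra.
split; first by apply: linsubB => //; exists (s%:C^-1 *: (x1 - x2)), (s%:C^-1 *: (v1 - v2)).
have -> : z - (f (s%:C^-1 *: (x1 - x2)) + s%:C^-1 *: (v1 - v2)) =
    s%:C^-1 *: ((y0 + s%:C *: z - (f x1 + v1)) - (y0 - (f x2 + v2))).
  by rewrite !(linearZ_LR f) !(linearB f) /=; vec_with ltac:(by field).
rewrite rnZ rnV sC mulrC ler_pdivrMr //.
have := rnB (y0 + s%:C *: z - (f x1 + v1)) (y0 - (f x2 + v2)).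
rewrite (_ : rn z / 2 * s = r / 4); last by move: sE; lra.
by move: h1 h2; lra.
Qed.

End OpenMapping.

(** * Finite-dimensional extensions of closed subspaces *)

Section FiniteSpan.
Context {R : realType}.

Lemma geom_cvgR (u r : nat -> R) :
  (forall n, `|u n.+1 - u n| <= r n) -> (forall n, r n.+1 <= r n / 2) ->
  exists x, forall n, `|x - u n| <= 2 * r n.
Proof.
move=> hu hr.
(* The intervals from [a n] to [b n] are nested; the limit is the supremum of their left ends. *)
pose a n := u n - 2 * r n; pose b n := u n + 2 * r n.
have a_incr : {homo a : n m / (n <= m)%N >-> n <= m}.
  apply/nondecreasing_seqP => n; rewrite /a.
  by have := hu n; have := hr n; rewrite ler_norml => h /andP[]; lra.
have b_decr n k : b (n + k)%N <= b n.
  elim: k => [|k]; first by rewrite addn0.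
  rewrite addnS; apply: le_trans; rewrite /b.
  by have := hu (n + k)%N; have := hr (n + k)%N; rewrite ler_norml => h /andP[]; lra.
have ab n m : a n <= b m.
  apply: le_trans (a_incr _ _ (leq_addr m n)) _.
  apply: le_trans (_ : _ <= b (m + n)%N) (b_decr m n); rewrite addnC /a /b.
  by have := le_trans (normr_ge0 _) (hu (m + n)%N); lra.
have sA : has_sup (range a).
  by split; [exists (a 0%N), 0%N | exists (b 0%N) => _ [n _ <-]].
exists (sup (range a)) => n; rewrite ler_norml.
have h1 : a n <= sup (range a) by apply: ub_le_sup; [case: sA | exists n].
have h2 : sup (range a) <= b n by apply: ge_sup; [case: sA | move=> _ [m _ <-]].
by move: h1 h2; rewrite /a /b; lra.
Qed.

Lemma Re_le_rn (z : R[i]) : `|complex.Re z| <= rn z.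
Proof.
rewrite /rn normc_def /= -sqrtr_sqr ler_wsqrtr // lerDl; exact: sqr_ge0.
Qed.

Lemma Im_le_rn (z : R[i]) : `|complex.Im z| <= rn z.
Proof.
rewrite /rn normc_def /= -sqrtr_sqr ler_wsqrtr // lerDr; exact: sqr_ge0.
Qed.

Lemma rn_le_ReIm (z : R[i]) : rn z <= `|complex.Re z| + `|complex.Im z|.
Proof.
rewrite {1}[z]complexE; apply: le_trans (rnD _ _) _; rewrite rnM !rnC.
by rewrite /rn normc_def /= expr0n add0r expr1n sqrtr1 mul1r.
Qed.

Lemma geom_cvgC (u : nat -> R[i]) (r : nat -> R) :
  (forall n, rn (u n.+1 - u n) <= r n) -> (forall n, r n.+1 <= r n / 2) ->
  exists x, forall n, rn (x - u n) <= 4 * r n.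
Proof.
move=> hu hr.
have [a ha] : exists a, forall n, `|a - complex.Re (u n)| <= 2 * r n.
  apply: geom_cvgR hr => n; apply: le_trans (hu n).
  by rewrite -(raddfB (@complex.Re R)) Re_le_rn.
have [b hb] : exists b, forall n, `|b - complex.Im (u n)| <= 2 * r n.
  apply: geom_cvgR hr => n; apply: le_trans (hu n).
  by rewrite -(raddfB (@complex.Im R)) Im_le_rn.
exists (a +i* b) => n; apply: le_trans (rn_le_ReIm _) _.
rewrite !raddfB /=; move: (ha n) (hb n); lra.
Qed.

Context {X : completeNormedModType R[i]}.

(** For [a] nonzero, [a *: b + v] is [a] times a difference [b - w] with [w] in [V], and
    [rn (b - w)] is at least half the near-best distance from [b] to [V]. *)
Lemma line_bound (V : set X) b : closed_subspace V -> ~ V b ->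
  exists2 K : R, 0 <= K & forall a v, V v -> rn a <= K * rn (a *: b + v).
Proof.
move=> cV nVb; have sV := closed_subspace_linsub cV.
have [v0 Vv0 h] := near_best b cV.
have d0 : 0 < rn (b - v0).
  by rewrite rn_gt0 subr_eq0; apply: contra_not_neq nVb => ->.
exists (2 / rn (b - v0)); first by rewrite divr_ge0 // ltW.
move=> a v Vv; have [->|a0] := eqVneq a 0.
  by rewrite rn0 mulr_ge0 ?rn_ge0 // divr_ge0 // ltW.
have -> : a *: b + v = a *: (b - - (a^-1 *: v)) by vec_with ltac:(by field).
have := h (- (a^-1 *: v)) (linsubN sV (linsubZ _ sV Vv)); set w := b - _ => hw.
rewrite rnZ mulrCA ler_peMr ?rn_ge0 // mulrAC ler_pdivlMr // mul1r //.
Qed.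

(** By [line_bound], the coefficients of [b] converge along a geometrically fast approximation of
    [x]; subtracting the limit leaves a limit of points of [V]. *)
Lemma closed_add_line (V : set X) b : closed_subspace V ->
  closed_subspace [set x | exists a, V (x - a *: b)].
Proof.
move=> cV; have sV := closed_subspace_linsub cV; apply/closed_linsubP; split; last first.
  split; first by exists 0; rewrite scale0r subr0; exact: linsub0.
  move=> a x y [c Vx] [d Vy]; exists (a * c + d).
  have -> : a *: x + y - (a * c + d) *: b = a *: (x - c *: b) + (y - d *: b) by vec.
  by apply: sV.2.
have [Vb|nVb] := pselect (V b).
  suff -> : [set x | exists a, V (x - a *: b)] = V by case: cV.
  apply/seteqP; split=> x; last by exists 0; rewrite scale0r subr0.
  by move=> [a Vx]; rewrite -(subrK (a *: b) x); apply: linsubD => //; exact: linsubZ.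
have [K K0 hK] := line_bound cV nVb.
apply/closed_rn => x hx.
have e0 n : (0 : R) < 2^-1 ^+ n by rewrite exprn_gt0 // invr_gt0.
have /choice[a ha] : forall n, exists a, V (a.2 - a.1 *: b) /\ rn (x - a.2) < 2^-1 ^+ n.
  by move=> n; have [w [a Vw] xw] := hx _ (e0 n); exists (a, w).
have [l hl] : exists l, forall n, rn (l - (a n).1) <= 4 * (2 * K * 2^-1 ^+ n).
  apply: geom_cvgC => n; last by rewrite exprSr mulrA.
  have := hK ((a n.+1).1 - (a n).1) (((a n.+1).2 - (a n.+1).1 *: b) - ((a n).2 - (a n).1 *: b)).
  have -> : ((a n.+1).1 - (a n).1) *: b + (((a n.+1).2 - (a n.+1).1 *: b) - ((a n).2 - (a n).1 *: b))
     = (x - (a n).2) - (x - (a n.+1).2) by vec.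
  move=> /(_ (linsubB sV (ha _).1 (ha _).1)) /le_trans; apply.
  rewrite -mulrA mulrCA; apply: ler_wpM2l => //; apply: le_trans (rnB _ _) _.
  have := (ha n).2; have := (ha n.+1).2; rewrite exprS; have := e0 n; lra.
exists l; apply: (closed_subspace_lim cV) => e ee.
pose D := 1 + 8 * K * rn b.
have [m hm] := half_pow_small D ee.
exists ((a m).2 - (a m).1 *: b); first exact: (ha m).1.
apply: le_lt_trans hm.
have -> : x - l *: b - ((a m).2 - (a m).1 *: b) = (x - (a m).2) - (l - (a m).1) *: b by vec.
apply: le_trans (rnB _ _) _; rewrite rnZ -exprVn /D mulrDl mul1r.
have := ler_wpM2r (rn_ge0 b) (hl m); have := (ha m).2; lra.
Qed.

Definition plus_span (V : set X) n (b : 'I_n -> X) : set X :=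
  [set x | exists c : 'I_n -> R[i], V (x - \sum_i c i *: b i)].

Definition indep_mod (V : set X) n (b : 'I_n -> X) :=
  forall c : 'I_n -> R[i], V (\sum_i c i *: b i) -> forall i, c i = 0.

Lemma ord_recr_fun n (c : 'I_n -> R[i]) (a : R[i]) :
  exists d : 'I_n.+1 -> R[i], (forall i, d (widen_ord (leqnSn n) i) = c i) /\ d ord_max = a.
Proof.
exists (fun i => if unlift ord_max i is Some j then c j else a); split; last by rewrite unlift_none.
move=> i; have -> : widen_ord (leqnSn n) i = lift ord_max i by apply/val_inj; rewrite /= /bump leqNgt ltn_ord.
by rewrite liftK.
Qed.

Lemma plus_spanS V n (b : 'I_n.+1 -> X) :
  plus_span V b = [set x | exists a, plus_span V (fun i => b (widen_ord (leqnSn n) i)) (x - a *: b ord_max)].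
Proof.
apply/seteqP; split=> x.
  move=> [c h]; exists (c ord_max), (fun i => c (widen_ord (leqnSn n) i)).
  suff <- : x - \sum_(i < n.+1) c i *: b i = x - c ord_max *: b ord_max -
      \sum_(i < n) c (widen_ord (leqnSn n) i) *: b (widen_ord (leqnSn n) i) by [].
  by rewrite big_ord_recr /=; vec.
move=> [a [c h]]; have [d [dc da]] := ord_recr_fun c a; exists d.
rewrite big_ord_recr /= da; under eq_bigr do rewrite dc.
by move: h; set s := \sum_(i < n) _; rewrite (_ : x - _ - s = x - (s + a *: b ord_max)) //; vec.
Qed.

Lemma closed_plus_span V n (b : 'I_n -> X) : closed_subspace V -> closed_subspace (plus_span V b).
Proof.
move=> cV; elim: n b => [|n ih] b.
  suff -> : plus_span V b = V by [].
  apply/seteqP; split=> x; first by move=> [c]; rewrite big_ord0 subr0.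
  by move=> Vx; exists (fun=> 0); rewrite big_ord0 subr0.
by rewrite plus_spanS; apply: closed_add_line.
Qed.

(** Induction on [n]: [line_bound] over the closed space generated by [V] and the other vectors
    controls the last coefficient, and its term is then moved to the other side. *)
Lemma indep_bound V n (b : 'I_n -> X) : closed_subspace V -> indep_mod V b ->
  exists2 K : R, 0 <= K & forall c v, V v -> forall i, rn (c i) <= K * rn (\sum_i c i *: b i + v).
Proof.
move=> cV; have sV := closed_subspace_linsub cV.
elim: n b => [|n ih] b ib; first by exists 0 => // c v _ [].
pose b' i := b (widen_ord (leqnSn n) i).
have ib' : indep_mod V b'.
  move=> c Vc i; have [d [dc da]] := ord_recr_fun c 0.
  rewrite -dc; apply: ib; rewrite big_ord_recr /= da scale0r addr0.
  by under eq_bigr do rewrite dc.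
have [K1 K10 hK1] := ih _ ib'.
have nb : ~ plus_span V b' (b ord_max).
  move=> [c h]; have [d [dc da]] := ord_recr_fun c (-1).
  have /eqP : (-1 : R[i]) = 0.
    rewrite -da; apply: ib; rewrite big_ord_recr /= da scaleN1r.
    under eq_bigr do rewrite dc.
    by rewrite -opprB; exact: linsubN.
  by rewrite oppr_eq0 oner_eq0.
have [K2 K20 hK2] := line_bound (closed_plus_span b' cV) nb.
pose K := K2 + K1 * (1 + K2 * rn (b ord_max)).
have K0 : 0 <= K.
  by rewrite addr_ge0 // mulr_ge0 // addr_ge0 // mulr_ge0 // rn_ge0.
exists K => // c v Vv.
set w := \sum_i c i *: b i + v.
have wE : w = (\sum_i c (widen_ord (leqnSn n) i) *: b' i + v) + c ord_max *: b ord_max.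
  by rewrite /w big_ord_recr /= addrAC.
have cm : rn (c ord_max) <= K2 * rn w.
  rewrite wE addrC; apply: hK2.
  by exists (fun i => c (widen_ord (leqnSn n) i)); rewrite addrAC subrr add0r.
have cj j : rn (c (widen_ord (leqnSn n) j)) <= K1 * (1 + K2 * rn (b ord_max)) * rn w.
  apply: le_trans (hK1 (fun i => c (widen_ord (leqnSn n) i)) v Vv j) _.
  rewrite -mulrA; apply: ler_wpM2l => //.
  have -> : \sum_i c (widen_ord (leqnSn n) i) *: b' i + v = w - c ord_max *: b ord_max.
    by rewrite wE addrK.
  apply: le_trans (rnB _ _) _; rewrite rnZ.
  by have := ler_wpM2r (rn_ge0 (b ord_max)) cm; lra.
move=> i; have [j ->|->] := unliftP ord_max i.
  have -> : lift ord_max j = widen_ord (leqnSn n) j by apply/val_inj; rewrite /= /bump leqNgt ltn_ord.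
  apply: le_trans (cj j) _; rewrite ler_wpM2r ?rn_ge0 // /K.
  by move: K20; lra.
apply: le_trans cm _; rewrite ler_wpM2r ?rn_ge0 // /K.
by rewrite lerDl mulr_ge0 // addr_ge0 // mulr_ge0 // rn_ge0.
Qed.

End FiniteSpan.

(** * Separating functionals *)

Section HahnBanach.
Context {R : realType} {X : completeNormedModType R[i]}.
Implicit Types (p q : X -> R) (x y : X).

(** Homogeneity is stated as one inequality, the form that infima satisfy directly; applied to
    [t^-1] it gives the other one. *)
Definition sublinear q := (forall x y, q (x + y) <= q x + q y) /\
  forall (t : R) x, 0 < t -> q (t%:C *: x) <= t * q x.

Lemma sublinearZ q (t : R) x : sublinear q -> 0 < t -> q (t%:C *: x) = t * q x.
Proof.
move=> [_ h] t0; apply/eqP; rewrite eq_le h //=.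
have := h t^-1 (t%:C *: x); rewrite invr_gt0 => /(_ t0).
rewrite scalerA -rmorphM /= mulVf ?gt_eqF // scale1r => h'.
by rewrite -ler_pdivlMl.
Qed.

Lemma sublinear0 q : sublinear q -> q 0 = 0.
Proof.
move=> sq; have := @sublinearZ q 2 0 sq (ltr0n _ 2); rewrite scaler0; lra.
Qed.

Lemma sublinearN q x : sublinear q -> - q (- x) <= q x.
Proof.
by move=> sq; have := sq.1 x (- x); rewrite subrr sublinear0 //; lra.
Qed.

(** Zorn's lemma for the reversed pointwise order. The bound of a chain is its pointwise infimum,
    finite because [- p (- x)] bounds every member from below. *)
Lemma minimal_sublinear p : sublinear p -> exists q, [/\ sublinear q, forall x, q x <= p x &
  forall q', sublinear q' -> (forall x, q' x <= q x) -> forall x, q x <= q' x].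
Proof.
move=> sp.
pose T := {q : X -> R | sublinear q /\ forall x, q x <= p x}.
pose leT (s t : T) := `[< forall x, sval t x <= sval s x >].
have t0 : T by exists p.
have [||A tA|t ht] := @ZL_preorder T t0 leT.
- by move=> t; apply/asboolP.
- move=> r s t /asboolP h1 /asboolP h2; apply/asboolP => x.
  exact: le_trans (h2 x) (h1 x).
- have [A0|/set0P[t1 At1]] := eqVneq A set0; first by exists t0 => s; rewrite A0.
  pose B x := [set sval t x | t in A].
  have Blb x : lbound (B x) (- p (- x)).
    move=> _ [t At <-]; have [st tp] := svalP t.
    by apply: le_trans (sublinearN x st); rewrite lerN2.
  have hB x : has_inf (B x) by split; [exists (sval t1 x), t1 | exists (- p (- x))].
  pose q x := inf (B x).
  have qle t x : A t -> q x <= sval t x by move=> At; apply: ge_inf; [case: (hB x) | exists t].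
  have sq : sublinear q.
    split=> [x y|s x s0]; apply/ler_addgt0Pr => e e0.
      have e2 : 0 < e / 2 by rewrite divr_gt0.
      have [_ [u Au <-] hu] := inf_adherent e2 (hB x).
      have [_ [v Av <-] hv] := inf_adherent e2 (hB y).
      move: hu hv; rewrite -/(q x) -/(q y).
      (* The smaller of the two near-minimisers serves both [x] and [y], so its own subadditivity
         can be used. *)
      have [/asboolP uv|/asboolP vu] := tA _ _ Au Av.
        have := (svalP v).1.1 x y; have := uv x; have := qle v (x + y) Av; lra.
      have := (svalP u).1.1 x y; have := vu y; have := qle u (x + y) Au; lra.
    have e2 : 0 < e / s by rewrite divr_gt0.
    have [_ [u Au <-] hu] := inf_adherent e2 (hB x).
    apply: le_trans (qle u _ Au) _; rewrite (sublinearZ _ (svalP u).1 s0) -/(q x).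
    have := ler_wpM2l (ltW s0) (ltW hu); rewrite (mulrDr s _ (e / s)) [s * (e / s)]mulrC divfK ?gt_eqF // -/(q x).
  have qp : sublinear q /\ forall x, q x <= p x.
    by split=> // x; apply: le_trans (qle _ _ At1) ((svalP t1).2 x).
  by exists (exist _ q qp) => s As; apply/asboolP => x; exact: qle.
have [st tp] := svalP t.
exists (sval t); split=> // q' sq' q't x.
have q'p : sublinear q' /\ forall x, q' x <= p x.
  by split=> // z; exact: le_trans (q't z) (tp z).
have /ht/asboolP/(_ x) : leT t (exist _ q' q'p) by apply/asboolP => z; exact: q't.
by [].
Qed.

(* The one-sided directional perturbation of [q]; it lies below [q], and
   minimality of [q] therefore forces additivity. *)
Lemma sublinear_shift q y : sublinear q -> exists q', [/\ sublinear q', forall x, q' x <= q x &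
  forall x, q' x <= q (x + y) - q y].
Proof.
move=> sq; pose B x := [set q (x + t%:C *: y) - t * q y | t in [set t : R | 0 < t]].
have Blb x : lbound (B x) (- q (- x)).
  move=> _ [t /= t0 <-]; rewrite -(sublinearZ y sq t0).
  have := sq.1 (- x) (x + t%:C *: y); rewrite addKr; lra.
have hB x : has_inf (B x).
  by split; [exists (q (x + 1%:C *: y) - 1 * q y), 1 => /= | exists (- q (- x))].
have Ble x (t : R) : 0 < t -> inf (B x) <= q (x + t%:C *: y) - t * q y.
  by move=> t0; apply: ge_inf; [case: (hB x) | exists t].
exists (fun x => inf (B x)); split.
- split=> [x z|s x s0]; apply/ler_addgt0Pr => e e0.
    have e2 : 0 < e / 2 by rewrite divr_gt0.
    have [_ [t /= t0 <-] ht] := inf_adherent e2 (hB x).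
    have [_ [u /= u0 <-] hu] := inf_adherent e2 (hB z).
    have := Ble (x + z) (t + u) (addr_gt0 t0 u0).
    have := sq.1 (x + t%:C *: y) (z + u%:C *: y).
    rewrite (_ : x + t%:C *: y + (z + u%:C *: y) = x + z + (t + u)%:C *: y); last first.
      by rewrite rmorphD /=; vec.
    by move: ht hu; rewrite mulrDl; lra.
  have e2 : 0 < e / s by rewrite divr_gt0.
  have [_ [t /= t0 <-] ht] := inf_adherent e2 (hB x).
  apply: le_trans (Ble _ (s * t) (mulr_gt0 s0 t0)) _.
  rewrite rmorphM /= -scalerA -scalerDr (sublinearZ _ sq s0) -mulrA -mulrBr.
  by have := ler_wpM2l (ltW s0) (ltW ht); rewrite (mulrDr s _ (e / s)) [s * (e / s)]mulrC divfK ?gt_eqF.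
- move=> x; apply: le_trans (Ble x 1 ltr01) _.
  by have := sq.1 x (1%:C *: y); rewrite (sublinearZ y sq ltr01); lra.
- by move=> x; have := Ble x 1 ltr01; rewrite scale1r mul1r.
Qed.

(** Shifting [p] at [x0] before minimising forces [g (- x0) <= - p x0], which is the last claim once
    [g] is odd. *)
Lemma hahn_banach_real p x0 : sublinear p -> exists g : X -> R,
  [/\ forall x y, g (x + y) = g x + g y, forall (t : R) x, g (t%:C *: x) = t * g x,
      forall x, g x <= p x & p x0 <= g x0].
Proof.
move=> sp; have [p' [sp' p'p hp']] := sublinear_shift x0 sp.
have [g [sg gp' ming]] := minimal_sublinear sp'.
have gD x y : g (x + y) = g x + g y.
  apply/eqP; rewrite eq_le sg.1 /=.
  have [g' [sg' g'g hg']] := sublinear_shift y sg.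
  by have := ming _ sg' g'g x; have := hg' x; lra.
have gN x : g (- x) = - g x.
  by apply/eqP; rewrite -addr_eq0 -gD addNr sublinear0.
exists g; split=> //.
- move=> t x; have [t0|t0|<-] := ltgtP 0 t.
  + exact: sublinearZ.
  + rewrite -[t in LHS]opprK rmorphN /= scaleNr gN sublinearZ ?oppr_gt0 //; lra.
  + by rewrite scale0r mul0r sublinear0.
- by move=> x; exact: le_trans (gp' x) (p'p x).
have := gp' (- x0); have := hp' (- x0); rewrite addNr (sublinear0 sp) gN; lra.
Qed.

(** Hahn-Banach for the distance to [V], which vanishes on [V] and is positive at [x0]. The real
    functional [g] is complexified as [g x - 'i * g ('i *: x)] and normalised at [x0]. *)
Lemma separating_functional (V : set X) x0 : closed_subspace V -> ~ V x0 ->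
  exists phi : {scalar X}, [/\ exists2 c : R, 0 <= c & forall x, rn (phi x) <= c * rn x,
    forall v, V v -> phi v = 0 & phi x0 = 1].
Proof.
move=> cV nV; have sV := closed_subspace_linsub cV.
pose B x := [set rn (x - v) | v in V].
have hB x : has_inf (B x).
  split; first by exists (rn (x - 0)), 0 => //; exact: linsub0.
  by exists 0 => _ [v _ <-]; exact: rn_ge0.
have Ble x v : V v -> inf (B x) <= rn (x - v).
  by move=> Vv; apply: ge_inf; [case: (hB x) | exists v].
pose p x := inf (B x).
have sp : sublinear p.
  split=> [x y|t x t0]; apply/ler_addgt0Pr => e e0.
    have e2 : 0 < e / 2 by rewrite divr_gt0.
    have [_ [u Vu <-] hu] := inf_adherent e2 (hB x).
    have [_ [v Vv <-] hv] := inf_adherent e2 (hB y).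
    have := Ble (x + y) _ (linsubD sV Vu Vv).
    have := rnD (x - u) (y - v); rewrite (_ : x - u + (y - v) = x + y - (u + v)); last by vec.
    by move: hu hv; rewrite -/(p x) -/(p y) -/(p (x + y)); lra.
  have e2 : 0 < e / t by rewrite divr_gt0.
  have [_ [u Vu <-] hu] := inf_adherent e2 (hB x).
  apply: le_trans (Ble _ _ (linsubZ t%:C sV Vu)) _.
  rewrite -scalerBr rnZ rnC gtr0_norm //.
  by have := ler_wpM2l (ltW t0) (ltW hu); rewrite (mulrDr t _ (e / t)) [t * (e / t)]mulrC divfK ?gt_eqF.
have px0 : 0 < p x0.
  have [v Vv hv] := near_best x0 cV.
  have : rn (x0 - v) / 2 <= p x0.
    by apply: lb_le_inf; [case: (hB x0) | move=> _ [w Vw <-]; have := hv _ Vw; lra].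
  have : 0 < rn (x0 - v) by rewrite rn_gt0 subr_eq0; apply: contra_not_neq nV => ->.
  lra.
have ple x : p x <= rn x by rewrite -{2}(subr0 x); apply: Ble; exact: linsub0.
have pV v : V v -> p v <= 0 by move=> Vv; have := Ble v v Vv; rewrite subrr rn0.
have [g [gD gZ gp gx0]] := hahn_banach_real x0 sp.
have gN x : g (- x) = - g x.
  by have := gZ (-1) x; rewrite rmorphN /= rmorph1 scaleN1r mulN1r.
have gV v : V v -> g v = 0.
  move=> Vv; have := le_trans (gp v) (pV _ Vv).
  by have := le_trans (gp (- v)) (pV _ (linsubN sV Vv)); rewrite gN; lra.
have gn x : `|g x| <= rn x.
  rewrite ler_norml; have := le_trans (gp x) (ple x).
  by have := le_trans (gp (- x)) (ple (- x)); rewrite gN rnN => h1 h2; apply/andP; split; lra.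
pose psi x := g x +i* (- g ('i *: x)).
have psiL (a : R[i]) x y : psi (a *: x + y) = a * psi x + psi y.
  have ga z : g (a *: z) = complex.Re a * g z + complex.Im a * g ('i *: z).
    by rewrite {1}[a]complexE scalerDl gD gZ ['i * _]mulrC -scalerA gZ.
  have gi : g ('i *: ('i *: x)) = - g x.
    by rewrite scalerA -expr2 sqr_i scaleN1r gN.
  rewrite /psi scalerDr !gD scalerA mulrC -scalerA !ga gi.
  by case: a {ga} => a b /=; apply/eqP; rewrite eq_complex /=; apply/andP; split; apply/eqP; ring.
have psi0 : psi x0 != 0.
  by rewrite eq_complex /= negb_and gt_eqF // (lt_le_trans px0 gx0).
pose phi x := (psi x0)^-1 * psi x.
have phiL : linear_for *%R phi.
  by move=> a x y; rewrite /phi psiL mulrDr mulrCA.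
pose isL := GRing.isLinear.Build _ _ _ _ phi phiL.
pose Phi : {scalar X} := HB.pack phi isL.
exists Phi; split.
- exists (rn (psi x0)^-1 * 2); first by rewrite mulr_ge0 ?rn_ge0.
  move=> x; rewrite /= /phi rnM -mulrA ler_wpM2l ?rn_ge0 //.
  apply: le_trans (rn_le_ReIm _) _ => /=; rewrite normrN.
  have := gn x; have := gn ('i *: x); rewrite rnZ.
  have -> : rn ('i : R[i]) = 1.
    by rewrite /rn normc_def /= expr0n add0r expr1n sqrtr1.
  by lra.
- move=> v Vv; rewrite /= /phi /psi (gV _ Vv) (gV _ (linsubZ 'i sV Vv)).
  by rewrite oppr0 (_ : 0 +i* 0 = 0 :> R[i]) ?mulr0.
- by rewrite /= /phi mulVf.
Qed.

End HahnBanach.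

(** * Dimensions of quotients *)

Section QuotientDimension.
Context {R : realType} {X : completeNormedModType R[i]}.
Implicit Types (U V : set X).

(** Dimensions are handled through independent families of given length: these can be perturbed for
    one [m] at a time, and infinite dimension needs no separate treatment. *)
Definition dim_ge U V m := exists b : 'I_m -> X, (forall i, U (b i)) /\ indep_mod V b.

Definition set_sum U V : set X := [set u + v | u in U & v in V].

Lemma dim_ge0 U V : dim_ge U V 0.
Proof. by exists (fun=> 0); split=> [[]|c _ []]. Qed.

Lemma dim_ge_pred U V m : dim_ge U V m.+1 -> dim_ge U V m.
Proof.
move=> [b [Ub ib]]; exists (fun i => b (widen_ord (leqnSn m) i)); split=> // c Vc i.
have [d [dc da]] := ord_recr_fun c 0; rewrite -dc; apply: ib.
by rewrite big_ord_recr /= da scale0r addr0; under eq_bigr do rewrite dc.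
Qed.

Lemma dim_ge_le U V m n : (n <= m)%N -> dim_ge U V m -> dim_ge U V n.
Proof.
move=> /subnK <-; elim: (m - n)%N => // k ih; rewrite addSn => /dim_ge_pred; exact: ih.
Qed.

(** A longer independent family would have a coefficient matrix with more rows than columns; a
    nonzero vector of its left kernel is a relation modulo [V]. *)
Lemma dim_ge_span U V n (b : 'I_n -> X) m : linsub V ->
  (forall x, U x -> plus_span V b x) -> dim_ge U V m -> (m <= n)%N.
Proof.
move=> sV sp [b' [Ub' ib']]; rewrite leqNgt; apply/negP => nm.
have /choice[A hA] : forall i, exists c : 'I_n -> R[i], V (b' i - \sum_j c j *: b j).
  by move=> i; have [c] := sp _ (Ub' i); exists c.
pose M : 'M[R[i]]_(m, n) := \matrix_(i, j) A i j.
have : kermx M != 0.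
  by rewrite -mxrank_eq0 mxrank_ker -lt0n subn_gt0 (leq_ltn_trans (rank_leq_col M)).
move=> /rowV0Pn[u /sub_kermxP uM /eqP]; apply; apply/rowP => i; rewrite mxE.
apply: (ib' (fun i => u 0 i)).
have -> : \sum_i u 0 i *: b' i = \sum_i u 0 i *: (b' i - \sum_j A i j *: b j).
  under [RHS]eq_bigr do rewrite scalerBr.
  rewrite sumrB [X in _ - X](_ : _ = 0) ?subr0 //.
  under eq_bigr do rewrite scaler_sumr.
  rewrite exchange_big /= big1 // => j _.
  under eq_bigr do rewrite scalerA.
  rewrite -scaler_suml.
  have /rowP/(_ j) := uM; rewrite !mxE => uMj.
  have AM k : A k j = M k j by rewrite mxE.
  under eq_bigr do rewrite AM.
  by rewrite uMj scale0r.
by apply: linsub_sum => // k _; exact: linsubZ.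
Qed.

Lemma indep_mod_extend V n (b : 'I_n.+1 -> X) : linsub V ->
  indep_mod V (fun i => b (widen_ord (leqnSn n) i)) ->
  ~ plus_span V (fun i => b (widen_ord (leqnSn n) i)) (b ord_max) -> indep_mod V b.
Proof.
move=> sV ib nb c; rewrite big_ord_recr /= => Vc.
have cm : c ord_max = 0.
  apply: contra_notP nb => /eqP cm.
  exists (fun i => - (c ord_max)^-1 * c (widen_ord (leqnSn n) i)).
  have := linsubZ (c ord_max)^-1 sV Vc.
  under [X in _ -> V (_ - X)]eq_bigr do rewrite -scalerA scaleNr.
  rewrite sumrN opprK -scaler_sumr scalerDr scalerA mulVf // scale1r.
  by rewrite addrC.
move=> i; have [j ->|->//] := unliftP ord_max i.
have -> : lift ord_max j = widen_ord (leqnSn n) j by apply/val_inj; rewrite /= /bump leqNgt ltn_ord.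
by apply: (ib (fun i => c (widen_ord (leqnSn n) i))); move: Vc; rewrite cm scale0r addr0.
Qed.

Lemma dim_ge_basis U V n : linsub U -> linsub V -> dim_ge U V n -> ~ dim_ge U V n.+1 ->
  exists b : 'I_n -> X, [/\ forall i, U (b i), indep_mod V b & forall x, U x -> plus_span V b x].
Proof.
move=> sU sV [b [Ub ib]] nd; exists b; split=> // x Ux; apply: contrapT => nx; apply: nd.
exists (fun i => if unlift ord_max i is Some j then b j else x); split.
  by move=> i; case: (unlift ord_max i).
have e i : unlift ord_max (widen_ord (leqnSn n) i) = Some i.
  have -> : widen_ord (leqnSn n) i = lift ord_max i by apply/val_inj; rewrite /= /bump leqNgt ltn_ord.
  by rewrite liftK.
apply: indep_mod_extend => //=.
  rewrite (_ : (fun i : 'I_n => _) = b) //; apply/funext => i; by rewrite e.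
rewrite unlift_none (_ : (fun i : 'I_n => _) = b) //; apply/funext => i; by rewrite e.
Qed.

Lemma dim_dichotomy U V : linsub U -> linsub V ->
  (forall m, dim_ge U V m) \/ exists n, dim_ge U V n /\ ~ dim_ge U V n.+1.
Proof.
move=> sU sV; have [h|nh] := pselect (forall m, dim_ge U V m); [by left | right].
apply: contra_notP nh => nn; elim=> [|m ih]; first exact: dim_ge0.
by apply: contrapT => h; apply: nn; exists m.
Qed.

Lemma quotient_basisP U V n (b : 'I_n -> X) : linsub U -> linsub V ->
  quotient_basis U V b <->
  [/\ forall i, U (b i), indep_mod V b & forall x, U x -> plus_span V b x].
Proof.
move=> sU sV; split.
  move=> [Ub h]; split=> // [c Vc i|x Ux].
    have [d [_ du]] := h 0 (linsub0 sU).
    have d0 : d = 0.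
      by apply: du; rewrite big1 ?subr0 => [|j _]; [exact: linsub0 | rewrite mxE scale0r].
    have : d = \row_i c i.
      apply: du; under eq_bigr do rewrite mxE.
      by rewrite sub0r; exact: linsubN.
    by rewrite d0 => /rowP/(_ i); rewrite !mxE.
  by have [d [hd _]] := h x Ux; exists (fun i => d 0 i).
move=> [Ub ib sp]; split=> // x /sp[c hc]; exists (\row_i c i); split.
  by under eq_bigr do rewrite mxE.
move=> d hd; apply/rowP => i; rewrite mxE; apply/eqP; rewrite -subr_eq0; apply/eqP.
apply: (ib (fun i => c i - d 0 i)).
under eq_bigr do rewrite scalerBl.
rewrite sumrB (_ : _ - _ = (x - \sum_i d 0 i *: b i) - (x - \sum_i c i *: b i)); last by vec.
exact: linsubB.
Qed.

Lemma quotient_dim_fin U V n : linsub U -> linsub V -> dim_ge U V n -> ~ dim_ge U V n.+1 ->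
  quotient_dim U V = n%:R%:E.
Proof.
move=> sU sV dn ndn; rewrite /quotient_dim.
rewrite (_ : [set _ | _ in _] = [set n%:R%:E]) ?ereal_inf1 //.
apply/seteqP; split=> x.
  move=> [k [b /(quotient_basisP _ sU sV)[Ub ib sp]] <-]; congr (_%:R%:E).
  apply/eqP; rewrite eqn_leq; apply/andP; split.
    rewrite leqNgt; apply/negP => nk; apply: ndn; apply: dim_ge_le nk _; by exists b.
  exact: dim_ge_span sp dn.
move=> ->; exists n => //; have [b hb] := dim_ge_basis sU sV dn ndn; exists b.
exact/quotient_basisP.
Qed.

Lemma quotient_dim_inf U V : linsub U -> linsub V -> (forall m, dim_ge U V m) ->
  quotient_dim U V = +oo%E.
Proof.
move=> sU sV h; rewrite /quotient_dim.
rewrite (_ : [set _ | _ in _] = set0) ?ereal_inf0 //.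
apply/seteqP; split=> x // [k [b /(quotient_basisP _ sU sV)[Ub ib sp]] _].
by have := dim_ge_span sV sp (h k.+1); rewrite ltnn.
Qed.

Lemma quotient_dim_ge U V m : linsub U -> linsub V ->
  dim_ge U V m <-> (m%:R%:E <= quotient_dim U V)%E.
Proof.
move=> sU sV; have [h|[n [dn ndn]]] := dim_dichotomy sU sV.
  by rewrite quotient_dim_inf //; split=> // _; rewrite leey.
rewrite (quotient_dim_fin sU sV dn ndn) lee_fin ler_nat; split=> [dm|mn].
  by rewrite leqNgt; apply/negP => nm; apply: ndn; exact: dim_ge_le dm.
exact: dim_ge_le dn.
Qed.

Lemma quotient_dim_ext U V U' V' : linsub U -> linsub V -> linsub U' -> linsub V' ->
  (forall m, dim_ge U V m <-> dim_ge U' V' m) -> quotient_dim U V = quotient_dim U' V'.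
Proof.
move=> sU sV sU' sV' h; have [h1|[n [dn ndn]]] := dim_dichotomy sU sV.
  by rewrite !quotient_dim_inf // => m; apply/h.
rewrite (quotient_dim_fin sU sV dn ndn) (quotient_dim_fin (n := n) sU' sV') //.
  exact/h.
by move/h.
Qed.

Lemma quotient_dimP U V : linsub U -> linsub V -> (quotient_dim U V < +oo)%E <->
  exists n (b : 'I_n -> X),
    [/\ forall i, U (b i), indep_mod V b & forall x, U x -> plus_span V b x].
Proof.
move=> sU sV; have [h1|[n [dn ndn]]] := dim_dichotomy sU sV.
  rewrite quotient_dim_inf //; split=> // -[n [b [_ _ sp]]].
  by have := dim_ge_span sV sp (h1 n.+1); rewrite ltnn.
rewrite (quotient_dim_fin sU sV dn ndn) ltry; split=> // _; exists n.
exact: dim_ge_basis.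
Qed.

Lemma quotient_dim_nneg U V : (0 <= quotient_dim U V)%E.
Proof. by apply: le_ereal_inf_tmp => _ [n _ <-]; rewrite lee_fin. Qed.

Lemma quotient_dim_eq0 U V : linsub U -> linsub V -> V `<=` U ->
  quotient_dim U V = 0%E <-> U = V.
Proof.
move=> sU sV VU; have nd : ~ dim_ge U V 1 <-> U = V.
  split=> [nd|-> [b [Vb ib]]].
    apply/seteqP; split=> // x Ux; have [b [_ _ sp]] := dim_ge_basis sU sV (dim_ge0 U V) nd.
    by have [c] := sp _ Ux; rewrite big_ord0 subr0.
  suff /eqP : (1 : R[i]) = 0 by rewrite oner_eq0.
  apply: (ib (fun=> 1) _ ord0).
  by apply: linsub_sum => // i _; exact: linsubZ.
rewrite -nd quotient_dim_ge //; split=> [->|h]; first by rewrite lee_fin ler10.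
have nd1 : ~ dim_ge U V 1 by rewrite quotient_dim_ge.
by rewrite (quotient_dim_fin sU sV (dim_ge0 U V) nd1).
Qed.

Lemma linsub_set_sum U V : linsub U -> linsub V -> linsub (set_sum U V).
Proof.
move=> [U0 hU] [V0 hV]; split; first by exists 0 => //; exists 0; rewrite ?addr0.
move=> a _ _ [x1 Ux1 [y1 Vy1 <-]] [x2 Ux2 [y2 Vy2 <-]].
exists (a *: x1 + x2); first exact: hU.
by exists (a *: y1 + y2); [exact: hV | vec].
Qed.

Lemma direct_unique U V u1 v1 u2 v2 : linsub U -> linsub V -> U `&` V = [set 0] ->
  U u1 -> U u2 -> V v1 -> V v2 -> u1 + v1 = u2 + v2 -> u1 = u2 /\ v1 = v2.
Proof.
move=> sU sV UV Uu1 Uu2 Vv1 Vv2 e.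
have e' : u1 - u2 = v2 - v1.
  rewrite (_ : u1 - u2 = (u1 + v1) - u2 - v1); last by vec.
  by rewrite e; vec.
have : (U `&` V) (u1 - u2) by split; [exact: linsubB | rewrite e'; exact: linsubB].
rewrite UV /= => e0; move: (e0); rewrite e' => e1.
by split; apply/eqP; rewrite -subr_eq0 ?e0 // -opprB e1 oppr0.
Qed.

(** Bases of the two quotients are concatenated; if one quotient is infinite-dimensional, its
    independent families stay independent in the sum. *)
Lemma quotient_dim_sum U1 U2 V1 V2 : linsub U1 -> linsub U2 -> linsub V1 -> linsub V2 ->
  V1 `<=` U1 -> V2 `<=` U2 -> U1 `&` U2 = [set 0] ->
  quotient_dim (set_sum U1 U2) (set_sum V1 V2) = (quotient_dim U1 V1 + quotient_dim U2 V2)%E.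
Proof.
move=> sU1 sU2 sV1 sV2 VU1 VU2 U0.
have sU := linsub_set_sum sU1 sU2; have sV := linsub_set_sum sV1 sV2.
have VE u1 u2 : U1 u1 -> U2 u2 -> set_sum V1 V2 (u1 + u2) -> V1 u1 /\ V2 u2.
  move=> Uu1 Uu2 [v1 Vv1 [v2 Vv2 /(direct_unique sU1 sU2 U0 (VU1 _ Vv1) Uu1 (VU2 _ Vv2) Uu2) []]].
  by move=> <- <-.
have l1 m : dim_ge U1 V1 m -> dim_ge (set_sum U1 U2) (set_sum V1 V2) m.
  move=> [b [Ub ib]]; exists b; split.
    by move=> i; exists (b i) => //; exists 0; [exact: linsub0 | rewrite addr0].
  move=> c; rewrite -[\sum_i _]addr0 => /VE[| |h _]; last exact: ib h.
    by apply: linsub_sum => // i _; exact: linsubZ.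
  exact: linsub0.
have l2 m : dim_ge U2 V2 m -> dim_ge (set_sum U1 U2) (set_sum V1 V2) m.
  move=> [b [Ub ib]]; exists b; split.
    by move=> i; exists 0; [exact: linsub0 | exists (b i); rewrite ?add0r].
  move=> c; rewrite -[\sum_i _]add0r => /VE[| |_ h]; last exact: ib h.
    exact: linsub0.
  by apply: linsub_sum => // i _; exact: linsubZ.
have [h1|[n1 [d1 nd1]]] := dim_dichotomy sU1 sV1.
  rewrite (quotient_dim_inf sU1 sV1 h1) addye; last first.
    by rewrite gt_eqF // (lt_le_trans _ (quotient_dim_nneg _ _)).
  by apply: quotient_dim_inf => // m; exact: l1.
have [h2|[n2 [d2 nd2]]] := dim_dichotomy sU2 sV2.
  rewrite (quotient_dim_inf sU2 sV2 h2) addey; last first.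
    by rewrite gt_eqF // (lt_le_trans _ (quotient_dim_nneg _ _)).
  by apply: quotient_dim_inf => // m; exact: l2.
rewrite (quotient_dim_fin sU1 sV1 d1 nd1) (quotient_dim_fin sU2 sV2 d2 nd2).
rewrite -EFinD -natrD.
have [b1 [Ub1 ib1 sp1]] := dim_ge_basis sU1 sV1 d1 nd1.
have [b2 [Ub2 ib2 sp2]] := dim_ge_basis sU2 sV2 d2 nd2.
pose b (i : 'I_(n1 + n2)) := match fintype.split i with inl j => b1 j | inr j => b2 j end.
have bl j : b (lshift n2 j) = b1 j by rewrite /b (unsplitK (inl j)).
have br j : b (rshift n1 j) = b2 j by rewrite /b (unsplitK (inr j)).
have bE (c : 'I_(n1 + n2) -> R[i]) : \sum_i c i *: b i =
    \sum_i c (lshift n2 i) *: b1 i + \sum_i c (rshift n1 i) *: b2 i.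
  rewrite big_split_ord /=; congr (_ + _); apply: eq_bigr => i _; by rewrite ?bl ?br.
have S1 (c : 'I_n1 -> R[i]) : U1 (\sum_i c i *: b1 i).
  by apply: linsub_sum => // i _; exact: linsubZ.
have S2 (c : 'I_n2 -> R[i]) : U2 (\sum_i c i *: b2 i).
  by apply: linsub_sum => // i _; exact: linsubZ.
apply: quotient_dim_fin => //.
  exists b; split.
    move=> i; rewrite /b; case: (fintype.split i) => j.
      by exists (b1 j) => //; exists 0; [exact: linsub0 | rewrite addr0].
    by exists 0; [exact: linsub0 | exists (b2 j); rewrite ?add0r].
  move=> c; rewrite bE => /VE[//|//|/ib1 h1 /ib2 h2] i.
  by case: (split_ordP i) => j ->.
suff sp x : set_sum U1 U2 x -> plus_span (set_sum V1 V2) b x.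
  by move=> /(dim_ge_span sV sp); rewrite ltnn.
move=> [u1 /sp1[c1 h1] [u2 /sp2[c2 h2] <-]].
exists (fun i => match fintype.split i with inl j => c1 j | inr j => c2 j end).
rewrite bE; exists (u1 - \sum_i c1 i *: b1 i) => //; exists (u2 - \sum_i c2 i *: b2 i) => //.
under [in RHS]eq_bigr do rewrite (unsplitK (inl _)).
under [X in _ = _ - (_ + X)]eq_bigr do rewrite (unsplitK (inr _)).
by vec.
Qed.

End QuotientDimension.

(** * Perturbation of Kato operators *)

Section Operators.
Context {R : realType} {X : completeNormedModType R[i]}.
Implicit Types (U V A E : set X) (f : {linear X -> X}).

Fact subscal_linear f (l : R[i]) : linear (subscal f l).
Proof. by move=> a x y; rewrite /subscal linearP; vec. Qed.
HB.instance Definition _ f (l : R[i]) :=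
  GRing.isLinear.Build _ _ _ _ (subscal f l) (@subscal_linear f l).

Fact iter_linear f n : linear (iter n f).
Proof. by move=> a x y; elim: n => //= n ->; rewrite linearP. Qed.
HB.instance Definition _ f n :=
  GRing.isLinear.Build _ _ _ _ (iter n f) (@iter_linear f n).

Lemma bounded_subscal f l : bounded_op f -> bounded_op (subscal f l).
Proof.
move=> [c c0 hc]; exists (c + rn l); first by rewrite addr_ge0 // rn_ge0.
move=> x; apply: le_trans (rnB _ _) _; rewrite rnZ mulrDl lerD2r; exact: hc.
Qed.

Lemma invariant_subscal U f l : linsub U -> invariant_on U f -> invariant_on U (subscal f l).
Proof. by move=> sU fU x Ux; apply: linsubB => //; [exact: fU | exact: linsubZ]. Qed.

Lemma invariant_iter U f n : invariant_on U f -> invariant_on U (iter n f).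
Proof. by move=> fU x Ux; elim: n => //= n; exact: fU. Qed.

Lemma linsub_ran U f : linsub U -> linsub (op_ran U f).
Proof.
move=> [U0 hU]; split; first by exists 0 => //; rewrite linear0.
move=> a _ _ [x Ux <-] [y Uy <-]; exists (a *: x + y); [exact: hU | by rewrite linearP].
Qed.

Lemma linsub_iter_ran U f n : linsub U -> linsub (op_ran U (iter n f)).
Proof. exact: (@linsub_ran U (iter n f)). Qed.

Lemma linsub_ker U f : linsub U -> linsub (op_ker U f).
Proof.
move=> [U0 hU]; split; first by split=> //; rewrite linear0.
move=> a x y [Ux fx] [Uy fy]; split; first exact: hU.
by rewrite linearP fx fy scaler0 addr0.
Qed.

Lemma op_ran_sub U f n : invariant_on U f -> op_ran U (iter n f) `<=` U.
Proof. by move=> fU _ [x Ux <-]; exact: invariant_iter. Qed.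

Lemma op_ranS U f n : op_ran U (iter n.+1 f) = op_ran (op_ran U (iter n f)) f.
Proof.
apply/seteqP; split=> y; first by move=> [x Ux <-]; exists (iter n f x) => //; exists x.
by move=> [_ [x Ux <-] <-]; exists x.
Qed.

Lemma op_ran0 U f : op_ran U (iter 0 f) = U.
Proof. by apply/seteqP; split=> y; [move=> [x Ux <-] | exists y]. Qed.

Lemma op_ran_anti U f n m : invariant_on U f -> (n <= m)%N ->
  op_ran U (iter m f) `<=` op_ran U (iter n f).
Proof.
move=> fU nm _ [x Ux <-]; exists (iter (m - n) f x); first exact: invariant_iter.
by rewrite -iterD subnKC.
Qed.

Lemma bounded_preimage U f : bounded_op f -> closed_subspace U -> closed (op_ran U f) ->
  exists2 C : R, 0 < C & forall y, op_ran U f y -> exists x, [/\ U x, f x = y & rn x <= C * rn y].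
Proof.
move=> bf cU cr.
have e : sum_range f U [set 0] = op_ran U f.
  apply/seteqP; split=> y; last by move=> [x Ux <-]; exists x, 0; rewrite addr0.
  by move=> [x [_ [Ux -> ->]]]; exists x; rewrite ?addr0.
have [|C C0 h] := open_mapping bf cU closed_subspace_set0.
  by rewrite e; apply/closed_linsubP; split=> //; apply/linsub_ran/closed_subspace_linsub.
exists C => // y; rewrite -e => /h[x [v [Ux /= -> ->]]].
by rewrite addr0 => hx _; exists x.
Qed.

(** Converse of [bounded_preimage]: applied to the closure of the range, successive approximation
    turns bounded approximate preimages into an exact one. *)
Lemma closed_rangeP U f (C : R) : bounded_op f -> closed_subspace U -> 0 <= C ->
  (forall y, op_ran U f y -> exists x, [/\ U x, f x = y & rn x <= C * rn y]) ->
  closed_subspace (op_ran U f).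
Proof.
move=> bf cU C0 h; have sU := closed_subspace_linsub cU.
have sr := linsub_ran f sU.
apply/closed_linsubP; split=> //; apply/closed_rn => y hy.
pose Y := [set y | forall e : R, 0 < e -> exists2 u, op_ran U f u & rn (y - u) < e].
(* The point [u] of the range chosen within [rn z / 2] of [z] has norm at most [2 * rn z], which
   doubles the constant. *)
have C20 : 0 <= 2 * C by rewrite mulr_ge0.
have [z Yz|x [v [Ux /= -> -> _ _]]] := approx_preimage (U := U) (V := [set 0]) (Y := Y) bf cU closed_subspace_set0 C20 _ hy; last first.
  by exists x; rewrite ?addr0.
have [->|z0] := eqVneq z 0.
  exists 0, 0; rewrite (linear0 f) addr0 subr0 rn0 !mulr0 mul0r lexx.
  do !split=> //; first exact: linsub0.
  by move=> e e0; exists 0; [exact: linsub0 | rewrite subrr rn0].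
have z2 : 0 < rn z / 2 by rewrite divr_gt0 // rn_gt0.
have [u ru uz] := Yz _ z2.
have [x [Ux fx xu]] := h _ ru.
have rnu : rn u <= 2 * rn z.
  by have := rnB z (z - u); rewrite opprB addrC subrK; move: uz; lra.
exists x, 0; rewrite addr0 fx rn0 mulr_ge0 ?rn_ge0 //; split; first split=> //.
  by apply: le_trans xu _; have := ler_wpM2l C0 rnu; lra.
split; last exact: ltW.
move=> e e0; have [w rw wz] := Yz _ e0; exists (w - u); first exact: linsubB.
by rewrite (_ : _ - _ = z - w) //; vec.
Qed.

(** The preimage of controlled norm found in [U] differs from a point of [A] by a kernel vector,
    hence lies in [A], and the bound passes to [A]. *)
Lemma closed_image A U f : bounded_op f -> closed_subspace U -> closed_subspace A ->
  A `<=` U -> op_ker U f `<=` A -> closed (op_ran U f) -> closed_subspace (op_ran A f).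
Proof.
move=> bf cU cA AU NA cr; have [C C0 h] := bounded_preimage bf cU cr.
apply: (@closed_rangeP A f C) => //; first exact: ltW.
move=> _ [a Aa <-]; have [|x [Ux fx xC]] := h (f a); first by exists a => //; exact: AU.
exists x; split=> //.
have -> : x = a - (a - x) by vec.
have sA := closed_subspace_linsub cA; have sU := closed_subspace_linsub cU.
apply: linsubB => //; apply: NA; split; first by apply: linsubB => //; exact: AU.
by rewrite linearB fx subrr.
Qed.

Lemma Kato_closed_ran U f n : bounded_op f -> closed_subspace U -> invariant_on U f ->
  Kato U f -> closed_subspace (op_ran U (iter n f)).
Proof.
move=> bf cU fU [cr N]; elim: n => [|n ih]; first by rewrite op_ran0.
by rewrite op_ranS; apply: (closed_image (U := U)) => //; [exact: op_ran_sub | exact: N].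
Qed.

(* [E] is the hyperrange of a Kato operator; [f] is onto on [E] and, modulo [E],
   bounded below.  This is what survives small perturbations. *)
Definition kato_core U f E (C : R) := [/\ closed_subspace E /\ E `<=` U, invariant_on E f,
  forall y, E y -> exists x, [/\ E x, f x = y & rn x <= C * rn y],
  op_ker U f `<=` E
  & forall y, op_ran U f y -> exists x, [/\ U x, f x = y & rn x <= C * rn y]].

(** [E] is the intersection of all [R(f^n)]. A preimage of a point of [E] differs from one in
    [R(f^n)] by a kernel vector, and kernel vectors lie in every range, so it belongs to [E]. *)
Lemma Kato_core U f : bounded_op f -> closed_subspace U -> invariant_on U f -> Kato U f ->
  exists E (C : R), 0 < C /\ kato_core U f E C.
Proof.
move=> bf cU fU kf; have sU := closed_subspace_linsub cU.
pose E : set X := [set x | forall n, op_ran U (iter n f) x].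
have EU : E `<=` U by move=> x /(_ 0%N); rewrite op_ran0.
have cE : closed_subspace E.
  apply/closed_linsubP; split.
    apply/closed_rn => x hx n.
    apply: (closed_subspace_lim (Kato_closed_ran n bf cU fU kf)) => e /hx[u Eu xu].
    by exists u.
  split; first by move=> n; apply: (linsub0 (linsub_iter_ran f n sU)).
  by move=> a x y Ex Ey n; apply: (linsub_iter_ran f n sU).2.
have NE : op_ker U f `<=` E by move=> x Nx n; exact: kf.2.
have fE : invariant_on E f.
  move=> x Ex [|n]; first by rewrite op_ran0; apply: fU; exact: EU.
  by rewrite op_ranS; exists x.
have Ef : op_ran E f = E.
  apply/seteqP; split=> y; first by move=> [x Ex <-]; exact: fE.
  move=> Ey; have := Ey 1%N; rewrite op_ranS op_ran0 => -[x Ux fx].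
  exists x => // n; have := Ey n.+1; rewrite op_ranS => -[z rz fz].
  have -> : x = (x - z) + z by vec.
  apply: linsubD => //; first exact: linsub_iter_ran.
  apply: kf.2; split; last by rewrite linearB fx fz subrr.
  apply: linsubB => //; exact: op_ran_sub rz.
have [C1 C10 h1] := bounded_preimage bf cU kf.1.
have [|C2 C20 h2] := @bounded_preimage E f bf cE; first by rewrite Ef; case: cE.
exists E, (C1 + C2); split; first by rewrite addr_gt0.
split=> // y.
  rewrite -{1}Ef => /h2[x [Ex fx xC]]; exists x; split=> //; apply: le_trans xC _.
  by rewrite ler_wpM2r ?rn_ge0 // lerDr ltW.
move=> /h1[x [Ex fx xC]]; exists x; split=> //; apply: le_trans xC _.
by rewrite ler_wpM2r ?rn_ge0 // lerDl ltW.
Qed.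

(** A preimage [x] of [z] under [f] leaves for [f - mu] the residual [mu *: x], still in [E] and of
    norm at most [rn z / 4]; successive approximation removes it. *)
Lemma core_onto U f E (C : R) (mu : R[i]) : bounded_op f -> 0 < C -> kato_core U f E C ->
  rn mu * C <= 1 / 4 ->
  forall y, E y -> exists x, [/\ E x, subscal f mu x = y & rn x <= 2 * C * rn y].
Proof.
move=> bf C0 [[cE EU] fE h _ _] mC y Ey; have sE := closed_subspace_linsub cE.
have [z Ez|x [v [Ex /= -> -> xC _]]] := approx_preimage (f := subscal f mu) (U := E) (V := [set 0]) (Y := E)
    (bounded_subscal mu bf) cE closed_subspace_set0 (ltW C0) _ Ey; last first.
  by exists x; rewrite addr0 in xC *.
have [x [Ex fx xC]] := h _ Ez.
have e : z - subscal f mu x = mu *: x by rewrite /subscal -fx; vec.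
exists x, 0; rewrite addr0 e rnZ rn0; split; first by split=> //; rewrite mulr_ge0 ?rn_ge0 ?ltW.
split; first exact: linsubZ.
have := ler_wpM2l (rn_ge0 mu) xC; have := ler_wpM2r (rn_ge0 z) mC; have := rn_ge0 z; lra.
Qed.

(** The basic estimate modulo [E]. Subtracting from [x] a preimage in [E] of [mu *: e] gives [z], so
    that [f z] differs from the perturbed value at [x] only by [mu *: (x - e)]; a bounded preimage
    of [f z] equals [x] modulo [E]. *)
Lemma core_dist U f E (C : R) (mu : R[i]) (x e : X) : linsub U -> bounded_op f -> 0 < C -> kato_core U f E C ->
  U x -> E e -> (forall w, E w -> rn (x - e) <= 2 * rn (x - w)) ->
  exists z, U z /\ subscal f mu x = f z - mu *: (x - e) /\ rn (x - e) <= 2 * C * rn (f z).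
Proof.
move=> sU bf C0 [[cE EU] fE h N hU] Ux Ee best; have sE := closed_subspace_linsub cE.
have [e1 [Ee1 fe1 _]] := h _ (linsubZ mu sE Ee).
have Uz : U (x - e1) by apply: linsubB => //; exact: EU.
exists (x - e1); split=> //; split; first by rewrite /subscal linearB fe1; vec.
have [|u [Uu fu uC]] := hU (f (x - e1)); first by exists (x - e1).
have Ew : E (x - u).
  have -> : x - u = (x - e1 - u) + e1 by vec.
  apply: linsubD => //; apply: N; split; first exact: linsubB.
  by rewrite linearB fu subrr.
have := best _ Ew; rewrite (_ : x - (x - u) = u); last by vec.
by move: uC; lra.
Qed.

(** The term [mu *: (x - e)] of [core_dist] contributes at most half of [rn (x - e)]; absorbing it
    doubles the constant. *)
Lemma core_near U f E (C : R) (mu : R[i]) x : linsub U -> bounded_op f -> 0 < C -> kato_core U f E C ->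
  rn mu * C <= 1 / 4 -> U x -> exists2 e, E e & rn (x - e) <= 4 * C * rn (subscal f mu x).
Proof.
move=> sU bf C0 core mC Ux; have [[cE _] _ _ _ _] := core.
have [e Ee best] := near_best x cE; exists e => //.
have [z [Uz [gx hz]]] := core_dist mu sU bf C0 core Ux Ee best.
have fz : f z = subscal f mu x + mu *: (x - e) by rewrite gx; vec.
have := rnD (subscal f mu x) (mu *: (x - e)); rewrite -fz rnZ => h.
have := ler_wpM2l (ltW C0) h; have := ler_wpM2r (rn_ge0 (x - e)) mC.
move: hz; lra.
Qed.

(** A kernel vector of [f - mu] is at distance [0] from [E], and [f - mu] maps [E] onto [E], so [E]
    lies in all ranges. A bounded preimage is [x - e] plus a preimage in [E] of the perturbed value
    at [e]. *)
Lemma core_perturb U f E (C : R) (mu : R[i]) : bounded_op f -> closed_subspace U -> invariant_on U f ->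
  0 < C -> kato_core U f E C -> rn mu * C <= 1 / 4 ->
  op_ker U (subscal f mu) `<=` E /\ Kato U (subscal f mu).
Proof.
move=> bf cU fU C0 core mC; have sU := closed_subspace_linsub cU.
have bg := bounded_subscal mu bf; have [K K0 gK] := bg.
have [[cE EU] fE h N hU] := core; have sE := closed_subspace_linsub cE.
have onto := core_onto bf C0 core mC.
have NE : op_ker U (subscal f mu) `<=` E.
  move=> x [Ux gx]; have [e Ee] := core_near sU bf C0 core mC Ux.
  rewrite gx rn0 mulr0 => xe; suff -> : x = e by [].
  by apply/eqP; rewrite -subr_eq0 -rn_eq0 eq_le xe rn_ge0.
split=> //; split.
  pose K' := 4 * C + 2 * C * (1 + K * (4 * C)).
  have K'0 : 0 <= K'.
    by rewrite addr_ge0 ?mulr_ge0 ?(ltW C0) // addr_ge0 // !mulr_ge0 ?(ltW C0).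
  suff [] : closed_subspace (op_ran U (subscal f mu)) by [].
  apply: (closed_rangeP bg cU K'0) => _ [x Ux <-].
  have [e Ee xe] := core_near sU bf C0 core mC Ux.
  have [e2 [Ee2 ge2 e2C]] := onto _ (invariant_subscal mu sE fE Ee).
  exists (x - e + e2); split.
  - by apply: linsubD => //; [apply: linsubB => // |]; exact: EU.
  - by rewrite (linearD (subscal f mu)) (linearB (subscal f mu)) /= ge2; vec.
  have := rnD (x - e) e2.
  have := gK (x - e); rewrite (linearB (subscal f mu)) /= => h1.
  have h2 := ler_wpM2l K0 xe.
  have h3 : rn (subscal f mu e) <= rn (subscal f mu x) + rn (subscal f mu x - subscal f mu e).
    by rewrite -{1}(subKr (subscal f mu x) (subscal f mu e)); exact: rnB.
  have h4 : rn (subscal f mu e) <= (1 + K * (4 * C)) * rn (subscal f mu x) by move: h1 h2 h3; lra.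
  have h5 := ler_wpM2l (ltW C0) h4.
  move: xe e2C h5; rewrite /K'; lra.
move=> n x /NE; elim: n x => [|n ih] x Ex; first by rewrite op_ran0; exact: EU.
by have [y [Ey <- _]] := onto _ Ex; rewrite op_ranS; exists y => //; exact: ih.
Qed.

End Operators.

(** * Semicontinuity of nullity and defect at a Kato operator *)

Section KatoStability.
Context {R : realType} {X : completeNormedModType R[i]}.
Implicit Types (U V A E : set X) (f : {linear X -> X}).

Lemma small_radius (K : R) : 0 <= K -> exists2 d : R, 0 < d & forall t : R, 0 <= t < d -> t * K <= 1 / 4.
Proof.
move=> K0; have K1 : 0 < 4 * (K + 1) by rewrite mulr_gt0 // ltr_wpDl.
exists (1 / (4 * (K + 1))); first by rewrite divr_gt0.
move=> t /andP[t0]; rewrite ltr_pdivlMr //; nra.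
Qed.

Lemma sum_weights_le (n : nat) (a b : 'I_n -> R) (K : R) : (forall i, 0 <= b i) ->
  (forall i, a i <= K) -> \sum_i a i * b i <= K * \sum_i b i.
Proof. by move=> b0 h; rewrite mulr_sumr; apply: ler_sum => i _; rewrite ler_wpM2r. Qed.

Lemma rn_comb_le (n : nat) (c : 'I_n -> R[i]) (b : 'I_n -> X) (K : R) :
  (forall i, rn (c i) <= K) -> rn (\sum_i c i *: b i) <= K * \sum_i rn (b i).
Proof.
move=> h; apply: le_trans (rn_sum _ _ _) _.
under eq_bigr do rewrite rnZ.
by apply: sum_weights_le => // i; exact: rn_ge0.
Qed.

(** Each [b i] in the kernel of [f] is corrected by a small [e i] of [E] so as to be killed by
    [f - mu]; the corrections are too small to create a linear relation. *)
Lemma core_ker_lower U f E (C : R) m : bounded_op f -> closed_subspace U ->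
  0 < C -> kato_core U f E C -> dim_ge (op_ker U f) [set 0] m ->
  exists2 d : R, 0 < d & forall mu : R[i], rn mu < d -> dim_ge (op_ker U (subscal f mu)) [set 0] m.
Proof.
move=> bf cU C0 core [b [Nb ib]]; have sU := closed_subspace_linsub cU.
have [[cE EU] _ _ NE _] := core.
have [K K0 hK] := indep_bound closed_subspace_set0 ib.
pose B := \sum_i rn (b i); have B0 : 0 <= B by apply: sumr_ge0 => i _; exact: rn_ge0.
have [d1 d10 hd1] := small_radius (ltW C0).
have [|d2 d20 hd2] := @small_radius (K * (2 * C) * B).
  by rewrite !mulr_ge0 // ltW.
exists (Num.min d1 d2); first by rewrite lt_min d10.
move=> mu; rewrite lt_min => /andP[m1 m2].
have {}hd1 : rn mu * C <= 1 / 4 by apply: hd1; rewrite rn_ge0.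
have {}hd2 : rn mu * (K * (2 * C) * B) <= 1 / 4 by apply: hd2; rewrite rn_ge0.
have /choice[e he] : forall i, exists e, [/\ E e, subscal f mu e = - (mu *: b i) & rn e <= 2 * C * (rn mu * rn (b i))].
  move=> i; have [|e [Ee ge eC]] := core_onto bf C0 core hd1 (y := - (mu *: b i)).
    by apply: linsubN; [|apply: linsubZ; [|exact: NE]]; exact: closed_subspace_linsub.
  by exists e; split=> //; move: eC; rewrite rnN rnZ.
exists (fun i => b i - e i); split.
  move=> i; have [Ub fb] := Nb i; have [Ee ge _] := he i; split.
    by apply: linsubB => //; exact: EU.
  by rewrite (linearB (subscal f mu)) /= ge /subscal fb; vec.
move=> c /=; under eq_bigr do rewrite scalerBr.
rewrite sumrB => /eqP; rewrite subr_eq0 => /eqP eqc.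
(* A relation among the corrected vectors implies [S <= S / 4], so [S] vanishes and with it every
   coefficient. *)
pose S := \sum_j rn (c j) * rn (b j).
have S0 : 0 <= S by apply: sumr_ge0 => i _; rewrite mulr_ge0 ?rn_ge0.
have cS i : rn (c i) <= K * (2 * C) * rn mu * S.
  have := hK c 0 erefl i; rewrite addr0 eqc => /le_trans; apply.
  rewrite -!mulrA; apply: ler_wpM2l => //; apply: le_trans (rn_sum _ _ _) _.
  rewrite /S mulr_sumr !mulr_sumr; apply: ler_sum => j _; rewrite rnZ.
  have [_ _ eC] := he j; have := ler_wpM2l (rn_ge0 (c j)) eC; lra.
have : S <= K * (2 * C) * rn mu * S * B.
  by apply: sum_weights_le => // i; exact: rn_ge0.
have := ler_wpM2r S0 hd2 => h1 h2.
have SE : S = 0 by apply/eqP; rewrite eq_le S0 andbT; move: h1 h2; lra.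
by move=> i; apply/eqP; rewrite -rn_eq0 eq_le rn_ge0 andbT (le_trans (cS i)) // SE mulr0.
Qed.

(** [phi i] separates [b i] from the span of the others, which is the span of the family with [b i]
    replaced by [0]. *)
Lemma biorthogonal n (b : 'I_n -> X) : indep_mod [set 0] b ->
  exists (phi : 'I_n -> {scalar X}) (F : R), [/\ 0 <= F, forall i x, rn (phi i x) <= F * rn x &
    forall i j, phi i (b j) = (i == j)%:R].
Proof.
move=> ib.
have /choice[phi hphi] : forall i, exists phi : {scalar X},
    (exists2 c : R, 0 <= c & forall x, rn (phi x) <= c * rn x) /\ forall j, phi (b j) = (i == j)%:R.
  move=> i; pose b' j := if j == i then 0 else b j.
  have cb' := closed_plus_span b' closed_subspace_set0.
  have [|phi [bphi phi0 phi1]] := separating_functional (x0 := b i) cb'.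
    move=> [c /= hc].
    suff /eqP : (-1 : R[i]) = 0 by rewrite oppr_eq0 oner_eq0.
    have {1}<- : (if i == i then -1 else c i) = -1 :> R[i] by rewrite eqxx.
    apply: (ib (fun j => if j == i then -1 else c j)) => /=.
    have e : \sum_j c j *: b' j = \sum_(j | j != i) (if j == i then -1 else c j) *: b j.
      rewrite (bigD1 i) //= /b' eqxx scaler0 add0r.
      by apply: eq_bigr => j /negbTE ->.
    rewrite (bigD1 i) //= eqxx scaleN1r -e.
    by move/eqP: hc; rewrite subr_eq0 => /eqP ->; rewrite addNr.
  exists phi; split=> // j; have [<-//|ij] := eqVneq i j.
  apply: phi0; exists (fun k => (k == j)%:R).
  rewrite (bigD1 j) //= eqxx scale1r big1 ?addr0 => [|k /negbTE ->]; last by rewrite scale0r.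
  by rewrite /b' eq_sym (negbTE ij) subrr.
have /choice[F hF] : forall i, exists c : R, 0 <= c /\ forall x, rn (phi i x) <= c * rn x.
  by move=> i; have [[c c0 h] _] := hphi i; exists c.
exists phi, (\sum_i F i); split.
- by apply: sumr_ge0 => i _; case: (hF i).
- move=> i x; apply: le_trans ((hF i).2 x) _; rewrite ler_wpM2r ?rn_ge0 //.
  rewrite (bigD1 i) //= lerDl; apply: sumr_ge0 => j _; by case: (hF j).
- by move=> i; exact: (hphi i).2.
Qed.

(** The common kernel [Z] of functionals biorthogonal to a basis of [N(f)] has codimension at most
    [n]. For small [mu] it meets [N(f - mu)] only in [0], so families independent in [N(f - mu)]
    stay independent modulo [Z]. *)
Lemma core_ker_upper U f E (C : R) m : bounded_op f -> closed_subspace U ->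
  0 < C -> kato_core U f E C -> ~ dim_ge (op_ker U f) [set 0] m ->
  exists2 d : R, 0 < d & forall mu : R[i], rn mu < d -> ~ dim_ge (op_ker U (subscal f mu)) [set 0] m.
Proof.
move=> bf cU C0 core nd; have sU := closed_subspace_linsub cU.
have sN := linsub_ker f sU; have s0 := @linsub_set0 R X.
have [[cE EU] fE hEs NE hU] := core.
have [all|[n [dn ndn]]] := dim_dichotomy sN s0; first by case: (nd (all m)).
have nm : (n < m)%N by rewrite ltnNge; apply/negP => mn; apply: nd; exact: dim_ge_le dn.
have [b [Nb ib sp]] := dim_ge_basis sN s0 dn ndn.
have [phi [F [F0 hF phib]]] := biorthogonal ib.
pose B := \sum_i rn (b i); have B0 : 0 <= B by apply: sumr_ge0 => i _; exact: rn_ge0.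
have [|d d0 hd] := @small_radius ((1 + F * B) * C).
  by rewrite mulr_ge0 ?(ltW C0) // addr_ge0 // mulr_ge0.
exists d => // mu md dg.
have {}hd : rn mu * ((1 + F * B) * C) <= 1 / 4 by apply: hd; rewrite rn_ge0.
pose Z : set X := [set x | forall i, phi i x = 0].
have sZ : linsub Z.
  split; first by move=> i; rewrite linear0.
  by move=> a x y Zx Zy i; rewrite linearP Zx Zy mulr0 addr0.
have phiS i (c : 'I_n -> R[i]) : phi i (\sum_j c j *: b j) = c i.
  rewrite linear_sum (bigD1 i) //= linearZ /= phib eqxx mulr1 big1 ?addr0 // => j ji.
  by rewrite linearZ /= phib eq_sym (negbTE ji) mulr0.
have trivial w : op_ker U (subscal f mu) w -> Z w -> w = 0.
  move=> [Uw gw] Zw.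
  have fw : f w = mu *: w by apply/eqP; rewrite -subr_eq0; apply/eqP.
  have [|u [Uu fu uC]] := hU (f w); first by exists w.
  have /sp[c /= /eqP] : op_ker U f (w - u).
    by split; [exact: linsubB | rewrite linearB fu subrr].
  rewrite subr_eq0 => /eqP wu.
  have cu i : rn (c i) <= F * rn u.
    by rewrite -phiS -wu linearB (Zw i) sub0r rnN.
  have := rn_comb_le b cu; rewrite -wu -/B => h.
  have h2 : rn w <= rn (w - u) + rn u by rewrite -{1}(subrK u w) rnD.
  have h3 : rn u <= C * (rn mu * rn w) by rewrite -rnZ -fw.
  have h4 : rn w <= (1 + F * B) * rn u by move: h h2; lra.
  have h5 : 0 <= 1 + F * B by rewrite addr_ge0 // mulr_ge0.
  have h6 := ler_wpM2l h5 h3.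
  have h7 := ler_wpM2r (rn_ge0 w) hd.
  apply/eqP; rewrite -rn_eq0 eq_le rn_ge0 andbT.
  move: h4 h6 h7; lra.
have spZ x : setT x -> plus_span Z b x.
  by move=> _; exists (fun i => phi i x) => i; rewrite linearB phiS subrr.
suff /(dim_ge_span sZ spZ) : dim_ge setT Z m by rewrite leqNgt nm.
case: dg => b' [Nb' ib']; exists b'; split=> // c Zc; apply: ib'; apply: trivial => //.
apply: linsub_sum; first exact: (@linsub_ker _ _ U (subscal f mu)).
by move=> i _; apply: linsubZ => //; exact: (@linsub_ker _ _ U (subscal f mu)).
Qed.

(** If a combination of the [y i] is a value of [f - mu] at [x], then [mu *: (x - e)] is a
    combination of them modulo [R(f)]; the coefficients are bounded by a multiple of
    [rn mu * rn (x - e)], and [core_dist] forces [x = e]. *)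
Lemma core_ran_lower U f E (C : R) m : bounded_op f -> closed_subspace U -> closed_subspace (op_ran U f) ->
  0 < C -> kato_core U f E C -> dim_ge U (op_ran U f) m ->
  exists2 d : R, 0 < d & forall mu : R[i], rn mu < d -> dim_ge U (op_ran U (subscal f mu)) m.
Proof.
move=> bf cU cr C0 core [y [Uy iy]]; have sU := closed_subspace_linsub cU.
have [[cE EU] fE hE NE hU] := core.
have [K K0 hK] := indep_bound cr iy.
pose B := \sum_i rn (y i); have B0 : 0 <= B by apply: sumr_ge0 => i _; exact: rn_ge0.
have [|d d0 hd] := @small_radius (2 * C * (1 + K * B)).
  by rewrite !mulr_ge0 ?(ltW C0) // addr_ge0 // mulr_ge0.
exists d => // mu md.
have {}hd : rn mu * (2 * C * (1 + K * B)) <= 1 / 4 by apply: hd; rewrite rn_ge0.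
exists y; split=> // c [x Ux gx].
have [e Ee best] := near_best x cE.
have [z [Uz [gz hz]]] := core_dist mu sU bf C0 core Ux Ee best.
have xe : mu *: (x - e) = \sum_i (- c i) *: y i + f z.
  under eq_bigr do rewrite scaleNr.
  by rewrite sumrN -gx gz; vec.
have ck i : rn (c i) <= K * (rn mu * rn (x - e)).
  by rewrite -rnN -rnZ xe; apply: (hK (fun i => - c i)); exists z.
have fz : f z = mu *: (x - e) + \sum_i c i *: y i by rewrite -gx gz; vec.
have h1 := rn_comb_le y ck.
have h2 := rnD (mu *: (x - e)) (\sum_i c i *: y i); rewrite -fz rnZ in h2.
have h3 : rn (f z) <= (1 + K * B) * (rn mu * rn (x - e)) by move: h1 h2; rewrite -/B; lra.
have h4 := ler_wpM2l (ltW C0) h3.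
have h5 := ler_wpM2r (rn_ge0 (x - e)) hd.
have x0 : rn (x - e) = 0.
  by apply/eqP; rewrite eq_le rn_ge0 andbT; move: hz h4 h5; lra.
by move=> i; apply/eqP; rewrite -rn_eq0 eq_le rn_ge0 andbT (le_trans (ck i)) // x0 !mulr0.
Qed.

(** A near-best approximant [w] of [x] in the span over [R(f - mu)] can be improved: decompose
    [x - w] over [R(f)] and replace [f v] by the perturbed value. The new error is [mu *: v], too
    small unless [x = w]. *)
Lemma core_ran_upper U f E (C : R) m : bounded_op f -> closed_subspace U -> invariant_on U f ->
  closed_subspace (op_ran U f) ->
  0 < C -> kato_core U f E C -> ~ dim_ge U (op_ran U f) m ->
  exists2 d : R, 0 < d & forall mu : R[i], rn mu < d -> ~ dim_ge U (op_ran U (subscal f mu)) m.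
Proof.
move=> bf cU fU cr C0 core nd; have sU := closed_subspace_linsub cU.
have sr := closed_subspace_linsub cr.
have [[cE EU] fE hE NE hU] := core.
have [all|[n [dn ndn]]] := dim_dichotomy sU sr; first by case: (nd (all m)).
have nm : (n < m)%N by rewrite ltnNge; apply/negP => mn; apply: nd; exact: dim_ge_le dn.
have [y [Uy iy sp]] := dim_ge_basis sU sr dn ndn.
have [K K0 hK] := indep_bound cr iy.
pose B := \sum_i rn (y i); have B0 : 0 <= B by apply: sumr_ge0 => i _; exact: rn_ge0.
have [|d2 d20 hd2] := @small_radius (C * (1 + K * B)).
  by rewrite !mulr_ge0 ?(ltW C0) // addr_ge0 // mulr_ge0.
have [d1 d10 hd1] := small_radius (ltW C0).
exists (Num.min d1 d2); first by rewrite lt_min d10.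
move=> mu; rewrite lt_min => /andP[m1 m2].
have {}hd1 : rn mu * C <= 1 / 4 by apply: hd1; rewrite rn_ge0.
have {}hd2 : rn mu * (C * (1 + K * B)) <= 1 / 4 by apply: hd2; rewrite rn_ge0.
have [_ [cg _]] := core_perturb bf cU fU C0 core hd1.
have sg := @linsub_ran _ _ U (subscal f mu) sU.
have cW : closed_subspace (plus_span (op_ran U (subscal f mu)) y).
  by apply: closed_plus_span; apply/closed_linsubP.
have sW := closed_subspace_linsub cW.
suff spg x : U x -> plus_span (op_ran U (subscal f mu)) y x.
  by move=> /(dim_ge_span sg spg); rewrite leqNgt nm.
move=> Ux; have [w Ww best] := near_best x cW.
have gU := invariant_subscal mu sU fU.
have WU : plus_span (op_ran U (subscal f mu)) y `<=` U.
  move=> v [c [v' Uv' e]]; rewrite -(subrK (\sum_i c i *: y i) v) -e.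
  apply: linsubD => //; first exact: gU.
  by apply: linsub_sum => // i _; exact: linsubZ.
have Ut : U (x - w) by apply: linsubB => //; exact: WU.
have [c rc] := sp _ Ut.
have ck i : rn (c i) <= K * rn (x - w).
  by have := hK c _ rc i; rewrite addrC subrK.
have [v [Uv fv vC]] := hU _ rc.
have h1 := rn_comb_le y ck; rewrite -/B in h1.
have h2 := rnB (x - w) (\sum_i c i *: y i); rewrite -fv in h2 vC.
have h3 : rn (f v) <= (1 + K * B) * rn (x - w) by move: h1 h2; lra.
have h4 := ler_wpM2l (ltW C0) h3.
have Ww' : plus_span (op_ran U (subscal f mu)) y (w + (subscal f mu v + \sum_i c i *: y i)).
  apply: linsubD => //; exists c; exists v => //; vec.
have := best _ Ww'.
have -> : x - (w + (subscal f mu v + \sum_i c i *: y i)) = mu *: v.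
  by rewrite /subscal fv; vec.
rewrite rnZ => h5.
have h6 := ler_wpM2l (rn_ge0 mu) (le_trans vC h4).
have h7 := ler_wpM2r (rn_ge0 (x - w)) hd2.
suff /eqP : rn (x - w) = 0 by rewrite rn_eq0 subr_eq0 => /eqP ->.
by apply/eqP; rewrite eq_le rn_ge0 andbT; move: h5 h6 h7; lra.
Qed.

End KatoStability.

(** * Constancy of nullity and defect near a Kato operator *)

Section KatoConstancy.
Context {R : realType} {X : completeNormedModType R[i]}.
Implicit Types (U V A E : set X) (f : {linear X -> X}).

(** Connectedness of the unit interval: [P] agrees with [P 0] up to a supremum [c], and local
    constancy at [c] carries this beyond [c] or to [1]. *)
Lemma locally_constant_segment (P : R -> Prop) :
  (forall t, 0 <= t <= 1 -> exists2 d : R, 0 < d & forall s, 0 <= s <= 1 -> `|s - t| < d -> (P s <-> P t)) ->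
  P 0 <-> P 1.
Proof.
move=> loc; pose A := [set t : R | 0 <= t <= 1 /\ forall s, 0 <= s <= t -> (P s <-> P 0)].
have A0 : A 0.
  by split; [rewrite lexx ler01 | move=> s s0; have /eqP-> : s == 0 by rewrite eq_le andbC].
have ubA : ubound A 1 by move=> t [/andP[]].
have sA : has_sup A by split; [exists 0 | exists 1].
pose c := sup A.
have c0 : 0 <= c by apply: ub_le_sup => //; case: sA.
have c1 : c <= 1 by apply: ge_sup => //; exists 0.
have cI : 0 <= c <= 1 by rewrite c0.
have [d d0 hd] := loc c cI.
have [t [tI Pt] ct] := sup_adherent d0 sA; rewrite -/c in ct.
have tc : t <= c by apply: ub_le_sup => //; case: sA.
have Pct : P c <-> P 0.
  rewrite -(Pt t); last by rewrite lexx andbT; case/andP: tI.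
  by symmetry; apply: hd => //; rewrite distrC ger0_norm ?subr_ge0 //; move: ct; lra.
pose u := Num.min 1 (c + d / 2).
have uI : 0 <= u <= 1.
  by rewrite le_min ler01 ge_min lexx andbT /= addr_ge0 // divr_ge0 // ltW.
have uc : u <= c + d / 2 by rewrite ge_min lexx orbT.
have Au : A u.
  split=> // s /andP[s0 su].
  have [st|ts] := leP s t; first by apply: Pt; rewrite s0.
  rewrite -Pct; apply: hd.
    by rewrite s0 (le_trans su) //; case/andP: uI.
  by rewrite ltr_norml; apply/andP; split; move: ct ts su uc d0; lra.
have : u <= c by apply: ub_le_sup => //; case: sA.
rewrite ge_min => /orP[c1'|]; last by move: d0; lra.
have -> : 1 = c by apply/eqP; rewrite eq_le c1' c1.
by symmetry.
Qed.

Lemma subscal_subscal (f : X -> X) (a b : R[i]) : subscal (subscal f a) b = subscal f (a + b).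
Proof. by apply/funext => x; rewrite /subscal; vec. Qed.

Lemma subscal0 (f : X -> X) : subscal f 0 = f.
Proof. by apply/funext => x; rewrite /subscal scale0r subr0. Qed.

(** The radius is allowed to depend on [m], as the estimates use the norms of an independent family
    of length [m] or of a finite basis. *)
Lemma Kato_locally_constant U f m : bounded_op f -> closed_subspace U -> invariant_on U f -> Kato U f ->
  exists2 d : R, 0 < d & forall mu : R[i], rn mu < d ->
    (dim_ge (op_ker U (subscal f mu)) [set 0] m <-> dim_ge (op_ker U f) [set 0] m) /\
    (dim_ge U (op_ran U (subscal f mu)) m <-> dim_ge U (op_ran U f) m).
Proof.
move=> bf cU fU kf; have [E [C [C0 core]]] := Kato_core bf cU fU kf.
have cr := Kato_closed_ran 1 bf cU fU kf; rewrite op_ranS op_ran0 in cr.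
have [d1 d10 h1] : exists2 d : R, 0 < d & forall mu : R[i], rn mu < d ->
    (dim_ge (op_ker U (subscal f mu)) [set 0] m <-> dim_ge (op_ker U f) [set 0] m).
  have [h|h] := pselect (dim_ge (op_ker U f) [set 0] m).
    have [d d0 hd] := core_ker_lower bf cU C0 core h.
    by exists d => // mu /hd.
  have [d d0 hd] := core_ker_upper bf cU C0 core h.
  by exists d => // mu /hd.
have [d2 d20 h2] : exists2 d : R, 0 < d & forall mu : R[i], rn mu < d ->
    (dim_ge U (op_ran U (subscal f mu)) m <-> dim_ge U (op_ran U f) m).
  have [h|h] := pselect (dim_ge U (op_ran U f) m).
    have [d d0 hd] := core_ran_lower bf cU cr C0 core h.
    by exists d => // mu /hd.
  have [d d0 hd] := core_ran_upper bf cU fU cr C0 core h.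
  by exists d => // mu /hd.
exists (Num.min d1 d2); first by rewrite lt_min d10.
by move=> mu; rewrite lt_min => /andP[/h1 ? /h2 ?].
Qed.

(** The radius comes from the constant [C] alone and only guarantees that all [f - t * mu] with [t]
    in the unit interval are Kato; for each [m], local constancy along this segment does the
    rest. *)
Lemma Kato_stable U f : bounded_op f -> closed_subspace U -> invariant_on U f -> Kato U f ->
  exists2 d : R, 0 < d & forall mu : R[i], rn mu < d ->
    [/\ Kato U (subscal f mu), nullity U (subscal f mu) = nullity U f &
        defect U (subscal f mu) = defect U f].
Proof.
move=> bf cU fU kf; have [E [C [C0 core]]] := Kato_core bf cU fU kf.
have sU := closed_subspace_linsub cU.
have [d d0 hd] := small_radius (ltW C0).
exists d => // mu mud.
have kt (t : R) : 0 <= t <= 1 -> Kato U (subscal f (t%:C * mu)).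
  move=> /andP[t0 t1].
  suff h : rn (t%:C * mu) * C <= 1 / 4 by case: (core_perturb bf cU fU C0 core h).
  apply: hd; rewrite rn_ge0 rnM rnC ger0_norm // (le_lt_trans _ mud) //.
  by rewrite ler_piMl ?rn_ge0.
have key m : (dim_ge (op_ker U (subscal f mu)) [set 0] m <-> dim_ge (op_ker U f) [set 0] m) /\
    (dim_ge U (op_ran U (subscal f mu)) m <-> dim_ge U (op_ran U f) m).
  have loc (t : R) : 0 <= t <= 1 -> exists2 d : R, 0 < d & forall s, 0 <= s <= 1 -> `|s - t| < d ->
      (dim_ge (op_ker U (subscal f (s%:C * mu))) [set 0] m <->
       dim_ge (op_ker U (subscal f (t%:C * mu))) [set 0] m) /\
      (dim_ge U (op_ran U (subscal f (s%:C * mu))) m <-> dim_ge U (op_ran U (subscal f (t%:C * mu))) m).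
    move=> tI.
    have [e e0 he] := Kato_locally_constant m (bounded_subscal (t%:C * mu) bf) cU
        (invariant_subscal (t%:C * mu) sU fU) (kt t tI).
    exists (e / (1 + rn mu)); first by rewrite divr_gt0 // ltr_pwDl // rn_ge0.
    move=> s sI; rewrite ltr_pdivlMr ?ltr_pwDl ?rn_ge0 // => st.
    have := he ((s - t)%:C * mu); rewrite /= subscal_subscal -mulrDl -rmorphD /= [t + _]addrC subrK.
    apply; rewrite rnM rnC; apply: le_lt_trans st.
    by rewrite ler_wpM2l // lerDr.
  have := @locally_constant_segment (fun t => dim_ge (op_ker U (subscal f (t%:C * mu))) [set 0] m).
  have := @locally_constant_segment (fun t => dim_ge U (op_ran U (subscal f (t%:C * mu))) m).
  rewrite !mul0r !mul1r subscal0 => hr hk; split; symmetry.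
    by apply: hk => t /loc[e e0 he]; exists e => // s sI /(he s sI)[].
  by apply: hr => t /loc[e e0 he]; exists e => // s sI /(he s sI)[].
have sg := @linsub_ran _ _ U (subscal f mu) sU; have sf := linsub_ran f sU.
have kg := @linsub_ker _ _ U (subscal f mu) sU; have kf' := linsub_ker f sU.
have s0 := @linsub_set0 R X.
split.
- by have := kt 1; rewrite mul1r; apply; rewrite ler01 lexx.
- by apply: quotient_dim_ext => // m; case: (key m).
- by apply: quotient_dim_ext => // m; case: (key m).
Qed.

(** The Kato condition extends to kernels of powers: by induction [f x] lies in all ranges, and a
    preimage of it in [R(f^m)] differs from [x] by a kernel vector. *)
Lemma Kato_ker_iter U f n x : linsub U -> invariant_on U f -> Kato U f ->
  U x -> iter n f x = 0 -> forall m, op_ran U (iter m f) x.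
Proof.
move=> sU fU kf; elim: n x => [|n ih] x Ux /=.
  by move=> -> m; apply: linsub0; exact: linsub_iter_ran.
rewrite -iterS iterSr => e m.
have /(_ m.+1) := ih _ (fU _ Ux) e; rewrite op_ranS => -[z rz fz].
have Uz : U z by exact: op_ran_sub rz.
have -> : x = (x - z) + z by vec.
apply: linsubD => //; first exact: linsub_iter_ran.
by apply: kf.2; split; [exact: linsubB | rewrite linearB fz subrr].
Qed.

Lemma Kato_nullity_ran U f n : Kato U f -> invariant_on U f ->
  nullity (op_ran U (iter n f)) f = nullity U f.
Proof.
move=> kf fU; rewrite /nullity; congr space_dim; apply/seteqP; split=> x [Ux fx]; split=> //.
  exact: op_ran_sub Ux.
exact: kf.2.
Qed.

(** [f^n] induces an isomorphism from [U / R(f)] onto [R(f^n) / R(f^(n+1))]; injectivity is the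
    inclusion of [N(f^n)] in [R(f)]. *)
Lemma Kato_defect_ran U f n : linsub U -> Kato U f -> invariant_on U f ->
  defect (op_ran U (iter n f)) f = defect U f.
Proof.
move=> sU kf fU; rewrite /defect -op_ranS.
have sn := linsub_iter_ran f n sU; have sn1 := linsub_iter_ran f n.+1 sU.
have s1 := linsub_ran f sU.
have iS k (c : 'I_k -> R[i]) b : \sum_i c i *: iter n f (b i) = iter n f (\sum_i c i *: b i).
  rewrite (linear_sum (iter n f)); apply: eq_bigr => i _.
  by rewrite (linearZ_LR (iter n f)).
apply: quotient_dim_ext => // m; split=> -[b [Ub ib]].
  have /choice[b' hb'] : forall i, exists x, U x /\ iter n f x = b i.
    by move=> i; have [x Ux e] := Ub i; exists x.
  exists b'; split; first by move=> i; case: (hb' i).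
  move=> c [x Ux fx]; apply: ib.
  under eq_bigr => i _ do rewrite -(hb' i).2.
  by rewrite iS -fx; exists x => //; rewrite iterSr.
exists (fun i => iter n f (b i)); split; first by move=> i; exists (b i).
move=> c; rewrite iS => -[x Ux e]; apply: ib.
have US : U (\sum_i c i *: b i) by apply: linsub_sum => // i _; exact: linsubZ.
have Ud : U (\sum_i c i *: b i - f x) by apply: linsubB => //; exact: fU.
have /(Kato_ker_iter sU fU kf Ud)/(_ 1%N) : iter n f (\sum_i c i *: b i - f x) = 0.
  by rewrite (linearB (iter n f)) /= -e iterSr subrr.
rewrite op_ranS op_ran0 => h; rewrite -(subrK (f x) (\sum_i _)).
by apply: linsubD => //; exists x.
Qed.

End KatoConstancy.

(** * Kato decomposition of semi-Fredholm operators *)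

Section KatoDecomposition.
Context {R : realType} {X : completeNormedModType R[i]}.
Implicit Types (U V M N : set X) (f : {linear X -> X}).

Lemma op_ran_set_sum U V f : op_ran (set_sum U V) f = set_sum (op_ran U f) (op_ran V f).
Proof.
apply/seteqP; split=> x.
  move=> [_ [u Uu [v Vv <-]] <-]; exists (f u); first by exists u.
  by exists (f v); [exists v | rewrite linearD].
by move=> [_ [u Uu <-] [_ [v Vv <-] <-]]; exists (u + v); [exists u => //; exists v | rewrite linearD].
Qed.

Lemma op_ker_set_sum U V f : linsub U -> linsub V -> U `&` V = [set 0] -> invariant_on U f ->
  invariant_on V f -> op_ker (set_sum U V) f = set_sum (op_ker U f) (op_ker V f).
Proof.
move=> sU sV UV fU fV; apply/seteqP; split=> x.
  move=> [[u Uu [v Vv <-]]]; rewrite linearD => e.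
  have [] := direct_unique sU sV UV (fU _ Uu) (linsub0 sU) (fV _ Vv) (linsub0 sV) (etrans e (esym (addr0 0))).
  by move=> fu fv; exists u => //; exists v.
move=> [u [Uu fu] [v [Vv fv] <-]]; split; last by rewrite linearD fu fv addr0.
by exists u => //; exists v.
Qed.

Lemma set_sum00 : set_sum [set 0] [set 0] = [set (0 : X)].
Proof.
apply/seteqP; split=> x; first by move=> [_ -> [_ -> <-]]; rewrite addr0.
by move=> ->; exists 0 => //; exists 0; rewrite ?addr0.
Qed.

Lemma nullity_set_sum U V f : linsub U -> linsub V -> U `&` V = [set 0] -> invariant_on U f ->
  invariant_on V f -> nullity (set_sum U V) f = (nullity U f + nullity V f)%E.
Proof.
move=> sU sV UV fU fV; rewrite /nullity /space_dim op_ker_set_sum // -{1}set_sum00.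
have kU := linsub_ker f sU; have kV := linsub_ker f sV.
apply: quotient_dim_sum => //; try exact: linsub_set0.
- by move=> _ ->; exact: linsub0.
- by move=> _ ->; exact: linsub0.
apply/seteqP; split=> x; last by move=> ->; split; exact: linsub0.
by move=> [[Ux _] [Vx _]]; rewrite -UV.
Qed.

Lemma defect_set_sum U V f : linsub U -> linsub V -> U `&` V = [set 0] -> invariant_on U f ->
  invariant_on V f -> defect (set_sum U V) f = (defect U f + defect V f)%E.
Proof.
move=> sU sV UV fU fV; rewrite /defect op_ran_set_sum.
apply: quotient_dim_sum => //; try exact: linsub_ran.
- by move=> _ [x Ux <-]; exact: fU.
- by move=> _ [x Ux <-]; exact: fV.
Qed.

Lemma ran_summand U V f : linsub U -> linsub V -> U `&` V = [set 0] -> invariant_on U f ->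
  invariant_on V f -> op_ran U f = op_ran (set_sum U V) f `&` U.
Proof.
move=> sU sV UV fU fV; rewrite op_ran_set_sum; apply/seteqP; split=> x.
  move=> [u Uu <-]; split; last exact: fU.
  by exists (f u); [exists u | exists 0; [exists 0; [exact: linsub0 | rewrite linear0] | rewrite addr0]].
move=> [[_ [u Uu <-] [_ [v Vv <-] <-]]] Uuv.
have [-> _] := direct_unique sU sV UV Uuv (fU _ Uu) (linsub0 sV) (fV _ Vv) (addr0 _).
by exists u.
Qed.

Lemma set_sumC U V : set_sum U V = set_sum V U.
Proof.
by apply/seteqP; split=> x [u Uu [v Vv <-]]; exists v => //; exists u; rewrite // addrC.
Qed.

Lemma set_sumA U V M : set_sum U (set_sum V M) = set_sum (set_sum U V) M.
Proof.
apply/seteqP; split=> x.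
  by move=> [u Uu [_ [v Vv [m Mm <-]] <-]]; exists (u + v); [exists u => //; exists v | exists m; rewrite // addrA].
by move=> [_ [u Uu [v Vv <-]] [m Mm <-]]; exists u => //; exists (v + m); [exists v => //; exists m | rewrite addrA].
Qed.

Lemma set_sum0 U : set_sum U [set 0] = U.
Proof.
apply/seteqP; split=> x; first by move=> [u Uu [_ -> <-]]; rewrite addr0.
by move=> Ux; exists x => //; exists 0; rewrite ?addr0.
Qed.

Lemma invariant_set_sum U V f : invariant_on U f -> invariant_on V f -> invariant_on (set_sum U V) f.
Proof.
move=> fU fV _ [u Uu [v Vv <-]]; exists (f u); first exact: fU.
by exists (f v); [exact: fV | rewrite linearD].
Qed.

Definition span_of n (b : 'I_n -> X) : set X := plus_span [set 0] b.

Lemma set_sum_span U n (b : 'I_n -> X) : set_sum U (span_of b) = plus_span U b.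
Proof.
apply/seteqP; split=> x.
  move=> [u Uu [v [c e] <-]]; move/eqP: (e : _ = 0); rewrite subr_eq0 => /eqP ->.
  by exists c; rewrite addrK.
move=> [c h]; exists (x - \sum_i c i *: b i) => //; exists (\sum_i c i *: b i); last by rewrite subrK.
by exists c; rewrite /= subrr.
Qed.

Lemma quotient_dim1 U V y : linsub U -> linsub V -> U y -> ~ V y ->
  (forall x, U x -> exists a, V (x - a *: y)) -> quotient_dim U V = 1%E.
Proof.
move=> sU sV Uy nVy sp; rewrite (quotient_dim_fin (n := 1%N)) //.
  exists (fun=> y); split=> // c; rewrite big_ord_recl big_ord0 addr0 => Vc i.
  rewrite ord1; apply/eqP; apply: contra_notT nVy => c0.
  by have := linsubZ (c ord0)^-1 sV Vc; rewrite scalerA mulVf // scale1r.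
move=> h; have : (2 <= 1)%N.
  apply: (dim_ge_span (b := fun=> y : X) sV _ h) => x /sp[a Va]; exists (fun=> a).
  by rewrite big_ord_recl big_ord0 addr0.
by [].
Qed.

(** The block is spanned by [y, f y, ..., f^k y], and [M] is where [phi] vanishes on the whole
    orbit. The values [phi (f^(i+j) y)] are [0] for [i + j > k] and [1] for [i + j = k]: a matrix
    triangular along the antidiagonal, hence invertible. *)
Lemma jordan_split U f k y (phi : {scalar X}) (c : R) : bounded_op f -> closed_subspace U ->
  invariant_on U f -> 0 <= c -> (forall x, rn (phi x) <= c * rn x) ->
  (forall x, op_ran U (iter k.+1 f) x -> phi x = 0) -> U y -> phi (iter k f y) = 1 ->
  iter k.+1 f y = 0 ->
  exists M (b : 'I_k.+1 -> X), let N := span_of b in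
    [/\ closed_subspace M, invariant_on M f /\ invariant_on N f, set_sum M N = U & M `&` N = [set 0]] /\
    [/\ forall x, N x -> iter k.+1 f x = 0, nullity N f = 1%E & defect N f = 1%E].
Proof.
move=> [K K0 hK] cU fU c0 hc phi0 Uy phi1 fy0; have sU := closed_subspace_linsub cU.
have phiZ a x : phi (a *: x) = a * phi x by rewrite linearZ.
have phiS (I : finType) (d : I -> R[i]) (v : I -> X) : phi (\sum_i d i *: v i) = \sum_i d i * phi (v i).
  by rewrite (linear_sum phi); apply: eq_bigr => j _; rewrite phiZ.
have itU j x : U x -> U (iter j f x) by move=> Ux; exact: invariant_iter.
have fyk j : (k < j)%N -> iter j f y = 0.
  move=> kj; rewrite -(subnK kj) iterD fy0; elim: (j - k.+1)%N => //= n ->; exact: linear0.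
have phik j x : U x -> (k < j)%N -> phi (iter j f x) = 0.
  move=> Ux kj; apply: phi0; exists (iter (j - k.+1) f x); first exact: itU.
  by rewrite -iterD subnKC.
pose M : set X := [set z | U z /\ forall j, phi (iter j f z) = 0].
pose b (i : 'I_k.+1) := iter i f y.
pose N := span_of b.
have itB j x : rn (iter j f x) <= K ^+ j * rn x.
  elim: j => [|j ih]; first by rewrite expr0 mul1r.
  by apply: le_trans (hK _) _; rewrite exprS -mulrA ler_wpM2l.
have itL j a x z : iter j f (a *: x + z) = a *: iter j f x + iter j f z by exact: (linearP (iter j f)).
have sM : linsub M.
  split; first by split=> [|j]; [exact: linsub0 | rewrite (linear0 (iter j f)) linear0].
  move=> a x z [Ux hx] [Uz hz]; split; first exact: sU.2.
  by move=> j; rewrite itL linearP hx hz mulr0 addr0.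
have cM : closed_subspace M.
  apply/closed_linsubP; split=> //; apply/closed_rn => x hx.
  split; first by apply: (closed_subspace_lim cU) => e /hx[u [Uu _] xu]; exists u.
  move=> j; apply/eqP; rewrite -rn_eq0 eq_le rn_ge0 andbT.
  apply/ler_addgt0Pr => e e0; rewrite add0r.
  have D0 : 0 < c * K ^+ j + 1 by rewrite ltr_wpDl // mulr_ge0 // exprn_ge0.
  have [u [Uu hu] xu] := hx (e / (c * K ^+ j + 1)) (divr_gt0 e0 D0).
  have -> : phi (iter j f x) = phi (iter j f (x - u)).
    by rewrite (linearB (iter j f)) (linearB phi) /= hu subr0.
  apply: le_trans (hc _) _.
  have h1 := ler_wpM2l c0 (itB j (x - u)).
  move: xu; rewrite ltr_pdivlMr // => xu; have := rn_ge0 (x - u); move: h1; lra.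
have cN : closed_subspace N by exact: closed_plus_span closed_subspace_set0.
have sN := closed_subspace_linsub cN.
have Nit j : N (iter j f y).
  have [jk|kj] := leqP j k; last by rewrite fyk //; exact: linsub0.
  exists (fun i : 'I_k.+1 => (i == inord j)%:R) => /=.
  rewrite (bigD1 (inord j)) //= eqxx scale1r big1 ?addr0 => [|i /negbTE ->]; last by rewrite scale0r.
  by rewrite /b inordK // subrr.
have NE x : N x -> exists c : 'I_k.+1 -> R[i], x = \sum_i c i *: iter i f y.
  by move=> [d e]; move/eqP: (e : _ = 0); rewrite subr_eq0 => /eqP ->; exists d.
have NU : N `<=` U.
  by move=> x /NE[d ->]; apply: linsub_sum => // i _; apply: linsubZ => //; exact: itU.
have itS j (d : 'I_k.+1 -> R[i]) :
    iter j f (\sum_i d i *: iter i f y) = \sum_i d i *: iter (j + i) f y.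
  rewrite (linear_sum (iter j f)); apply: eq_bigr => i _.
  by rewrite (linearZ_LR (iter j f)) iterD.
have fN : invariant_on N f.
  move=> x /NE[d ->]; rewrite -[f _]/(iter 1 f _) itS; apply: linsub_sum => // i _.
  exact: (linsubZ _ sN (Nit _)).
have fM : invariant_on M f.
  by move=> x [Ux hx]; split=> [|j]; [exact: fU | rewrite -iterSr hx].
have MN0 : M `&` N = [set 0].
  apply/seteqP; split=> x; last by move=> ->; split; exact: linsub0.
  move=> [[Ux hx] /NE[d xE]]; rewrite xE /= big1 // => i _.
  suff -> : d i = 0 by rewrite scale0r.
  move: i; suff h m (i : 'I_k.+1) : (i < m)%N -> d i = 0 by move=> i; exact: (h i.+1).
  elim: m i => // m ih i; rewrite ltnS leq_eqVlt => /orP[/eqP im|]; last exact: ih.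
  have ik : (i <= k)%N by rewrite -ltnS.
  (* Under [f^(k - i)] followed by [phi], the term of index [i] gives [d i] and later terms vanish;
     earlier coefficients are [0] by induction. *)
  have := hx (k - i)%N; rewrite xE itS phiS (bigD1 i) // subnK // phi1 mulr1.
  rewrite big1; first by rewrite /= addr0.
  move=> j /andP[_ ji].
  have [lji|lij] := ltnP j i; first by rewrite ih ?mul0r // -im.
  rewrite fyk ?linear0 ?mulr0 //.
  have {}lij : (i < j)%N by rewrite ltn_neqAle lij andbT eq_sym.
  by rewrite -{1}(subnK ik) ltn_add2l.
have MNU : set_sum M N = U.
  apply/seteqP; split=> x.
    by move=> [u [Uu _] [v Nv <-]]; apply: linsubD => //; exact: NU.
  (* A multiple of [f^m y] is added to [w] to cancel [phi (f^(k - m) (x - w))]; it does not affect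
     the conditions for larger exponents, which already hold. *)
  move=> Ux; suff h m : (m <= k.+1)%N ->
      exists2 w, N w & forall j, (k.+1 - m <= j)%N -> phi (iter j f (x - w)) = 0.
    have [w Nw hw] := h _ (leqnn _); exists (x - w); last by exists w; rewrite ?subrK.
    split; first by apply: linsubB => //; exact: NU.
    by move=> j; apply: hw; rewrite subnn.
  elim: m => [_|m ih mk].
    exists 0; first exact: linsub0.
    by move=> j; rewrite subn0 subr0 => kj; exact: phik.
  have [w Nw hw] := ih (ltnW mk).
  exists (w + phi (iter (k - m) f (x - w)) *: iter m f y).
    by apply: linsubD => //; exact: linsubZ.
  move=> j; rewrite subSS => kmj; have mk' : (m <= k)%N by [].
  have e z a : x - (w + a *: z) = (- a) *: z + (x - w) by vec.
  rewrite e itL linearP /= -iterD.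
  move: kmj; rewrite leq_eqVlt => /orP[/eqP <-|kmj].
    by rewrite subnK // phi1 mulr1 addNr.
  rewrite fyk ?linear0 ?mulr0 ?add0r; last by rewrite -{1}(subnK mk') ltn_add2r.
  by apply: hw; rewrite subSn.
have nN x : N x -> iter k.+1 f x = 0.
  move=> /NE[d ->]; rewrite itS big1 // => i _; rewrite fyk ?scaler0 //.
  by rewrite ltnS leq_addr.
exists M, b; split; first by split.
split=> //.
- apply: (@quotient_dim1 _ _ (iter k f y)).
  + exact: linsub_ker.
  + exact: linsub_set0.
  + by split; [exact: Nit | rewrite -fy0].
  + by move=> /= e; move: phi1; rewrite e linear0 => /eqP; rewrite eq_sym oner_eq0.
  (* Since [f w = 0], the vector [w - phi w *: f^k y] lies in [M] as well as in [N], hence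
     vanishes. *)
  move=> w [Nw fw]; exists (phi w); rewrite -MN0; split; last first.
    by apply: linsubB => //; exact: linsubZ.
  split; first by apply: linsubB; [| exact: NU | apply: linsubZ; [| exact: itU]].
  case=> [|j] /=; first by rewrite (linearB phi) /= phiZ phi1 mulr1 subrr.
  rewrite -iterS iterSr (linearB f) /= fw sub0r (linearZ_LR f) /= -iterS fy0 scaler0 oppr0.
  by rewrite (linear0 (iter j f)) linear0.
apply: (@quotient_dim1 _ _ y) => //.
- exact: linsub_ran.
- exact: (Nit 0%N).
- move=> [w Nw e]; move: phi1; rewrite -e -iterSr phi0; first by move=> /eqP; rewrite eq_sym oner_eq0.
  by exists w => //; exact: NU.
move=> x /NE[d ->]; exists (d ord0).
rewrite big_ord_recl /= addrC addKr.
exists (\sum_(i < k) d (lift ord0 i) *: iter i f y).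
  by apply: linsub_sum => // i _; exact: (linsubZ _ sN (Nit _)).
by rewrite (linear_sum f); apply: eq_bigr => i _; rewrite (linearZ_LR f).
Qed.

End KatoDecomposition.

(** * Semi-Fredholm operators and the splitting of Jordan blocks *)

Section SemiFredholm.
Context {R : realType} {X : completeNormedModType R[i]}.
Implicit Types (U V M N : set X) (f : {linear X -> X}).

(** All [R(f^n)] are required to be closed, because splitting a block separates a kernel vector from
    some [R(f^(k+1))]. *)
Definition semi_Fredholm U f := (forall n, closed (op_ran U (iter n f))) /\
  ((nullity U f < +oo)%E \/ (defect U f < +oo)%E).

(** [R(f^(m+1))] is also the image of [R(f^m) + N(f)], a finite-dimensional extension of a closed
    subspace that contains the kernel. *)
Lemma upper_semi_Fredholm_semi U f : bounded_op f -> closed_subspace U -> invariant_on U f ->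
  closed (op_ran U f) -> (nullity U f < +oo)%E -> semi_Fredholm U f.
Proof.
move=> bf cU fU cr nu; have sU := closed_subspace_linsub cU; split; last by left.
move: nu => /(quotient_dimP (linsub_ker f sU) (@linsub_set0 R X))[n [b [Nb ib sp]]].
move=> m; suff [] : closed_subspace (op_ran U (iter m f)) by [].
elim: m => [|m ih]; first by rewrite op_ran0.
set A := op_ran U (iter m f) in ih *.
have sA := closed_subspace_linsub ih.
have -> : op_ran U (iter m.+1 f) = op_ran (plus_span A b) f.
  rewrite op_ranS; apply/seteqP; split=> y.
    move=> [x Ax <-]; exists x => //; exists (fun=> 0).
    by rewrite big1 ?subr0 // => i _; rewrite scale0r.
  move=> [x [c Ac] <-]; exists (x - \sum_i c i *: b i) => //.
  rewrite linearB (linear_sum f) big1 ?subr0 // => i _.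
  by rewrite (linearZ_LR f) /= (Nb i).2 scaler0.
apply: (closed_image (U := U)) => //.
- exact: closed_plus_span.
- move=> x [c Ac]; rewrite -(subrK (\sum_i c i *: b i) x); apply: linsubD => //.
    exact: op_ran_sub Ac.
  by apply: linsub_sum => // i _; apply: linsubZ => //; case: (Nb i).
- move=> x /sp[c e]; exists c; move: e => /= ->; exact: linsub0.
Qed.

(** The open mapping theorem is applied to [f] completed by a finite-dimensional complement of its
    range; for [y] in the range the component in the complement is [0], so a bounded preimage
    remains. *)
Lemma closed_ran_defect U f : bounded_op f -> closed_subspace U -> invariant_on U f ->
  (defect U f < +oo)%E -> closed_subspace (op_ran U f).
Proof.
move=> bf cU fU; have sU := closed_subspace_linsub cU.
move=> /(quotient_dimP sU (linsub_ran f sU))[n [b [Ub ib sp]]].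
have cS : closed_subspace (span_of b) by exact: closed_plus_span closed_subspace_set0.
have SE v : span_of b v -> exists c : 'I_n -> R[i], v = \sum_i c i *: b i.
  by move=> [c e]; move/eqP: (e : _ = 0); rewrite subr_eq0 => /eqP ->; exists c.
have e : sum_range f U (span_of b) = U.
  apply/seteqP; split=> y.
    move=> [x [v [Ux /SE[c ->] ->]]]; apply: linsubD => //; first exact: fU.
    by apply: linsub_sum => // i _; exact: linsubZ.
  move=> /sp[c [x Ux e]]; exists x, (\sum_i c i *: b i); split=> //.
    by exists c => /=; rewrite subrr.
  by rewrite e subrK.
have [|C C0 h] := open_mapping bf cU cS; first by rewrite e.
apply: (closed_rangeP bf cU (ltW C0)) => y ry.
have Uy : U y by case: ry => x Ux <-; exact: fU.
have [|x [v [Ux /SE[c vE] yE xC _]]] := h y; first by rewrite e.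
exists x; split=> //.
suff v0 : v = 0 by rewrite yE v0 addr0.
rewrite vE big1 // => i _; rewrite (ib c) ?scale0r //.
rewrite -vE (_ : v = y - f x); last by rewrite yE; vec.
by apply: linsubB => //; [exact: linsub_ran | exists x].
Qed.

(** [f^m] carries a spanning family of [U / R(f)] to one of [R(f^m) / R(f^(m+1))], so every
    successive range has finite codimension in the previous one. *)
Lemma lower_semi_Fredholm_semi U f : bounded_op f -> closed_subspace U -> invariant_on U f ->
  (defect U f < +oo)%E -> semi_Fredholm U f.
Proof.
move=> bf cU fU d; have sU := closed_subspace_linsub cU; split; last by right.
move=> m; suff [] : closed_subspace (op_ran U (iter m f)) by [].
move: d => /(quotient_dimP sU (linsub_ran f sU))[n [b [Ub ib sp]]].
elim: m => [|m ih]; first by rewrite op_ran0.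
have sA := closed_subspace_linsub ih.
rewrite op_ranS; apply: closed_ran_defect => //.
  by move=> _ [x Ux <-]; exists (f x); [exact: fU | rewrite -iterSr].
have sfA := linsub_ran f sA.
have [h|[k [dk ndk]]] := dim_dichotomy sA sfA; last first.
  by rewrite /defect (quotient_dim_fin sA sfA dk ndk) ltry.
have := h n.+1; rewrite -op_ranS => /(@dim_ge_span _ _ _ _ n (fun i => iter m f (b i))) le.
suff : (n.+1 <= n)%N by rewrite ltnn.
apply: le; first exact: linsub_iter_ran.
move=> _ [x /sp[c [z Uz e]] <-]; exists c, z => //.
rewrite iterSr e (linearB (iter m f)) (linear_sum (iter m f)); congr (_ - _).
by apply: eq_bigr => i _; rewrite (linearZ_LR (iter m f)).
Qed.

Lemma direct_sumA M N J : linsub M -> linsub N -> linsub J -> M `&` N = [set 0] ->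
  set_sum M N `&` J = [set 0] -> M `&` set_sum N J = [set 0] /\ N `&` J = [set 0].
Proof.
move=> sM sN sJ MN MNJ; split; apply/seteqP; split=> x.
- move=> [Mx [u Nu [v Jv e]]].
  have : (set_sum M N `&` J) v.
    split=> //; exists x => //; exists (- u); first exact: linsubN.
    by rewrite -e; vec.
  by rewrite MNJ => v0; rewrite -MN; split=> //; rewrite -e v0 addr0.
- by move=> ->; split; [exact: linsub0 | exact: (linsub0 (linsub_set_sum sN sJ))].
- move=> [Nx Jx]; rewrite -MNJ; split=> //; exists 0; first exact: linsub0.
  by exists x; rewrite ?add0r.
- by move=> ->; split; exact: linsub0.
Qed.

Lemma span_of_cat m n (b : 'I_m -> X) (b' : 'I_n -> X) :
  exists b'' : 'I_(m + n) -> X, set_sum (span_of b) (span_of b') = span_of b''.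
Proof.
exists (fun i => match fintype.split i with inl j => b j | inr j => b' j end).
have bE (c : 'I_(m + n) -> R[i]) :
    \sum_i c i *: (match fintype.split i with inl j => b j | inr j => b' j end) =
    \sum_i c (lshift n i) *: b i + \sum_i c (rshift m i) *: b' i.
  rewrite big_split_ord /=; congr (_ + _); apply: eq_bigr => i _.
    by rewrite (unsplitK (inl _)).
  by rewrite (unsplitK (inr _)).
apply/seteqP; split=> x.
  move=> [u [c e] [v [d e'] <-]].
  exists (fun i => match fintype.split i with inl j => c j | inr j => d j end).
  rewrite bE /=.
  under eq_bigr do rewrite (unsplitK (inl _)).
  under [X in _ - (_ + X)]eq_bigr do rewrite (unsplitK (inr _)).
  rewrite (_ : _ - _ = (u - \sum_i c i *: b i) + (v - \sum_i d i *: b' i)); last by vec.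
  by rewrite (e : _ = 0) (e' : _ = 0) addr0.
move=> [c]; rewrite bE /= => e; exists (\sum_i c (lshift n i) *: b i).
  by exists (fun i => c (lshift n i)); rewrite /= subrr.
exists (\sum_i c (rshift m i) *: b' i).
  by exists (fun i => c (rshift m i)); rewrite /= subrr.
by apply/eqP; rewrite eq_sym -subr_eq0 e.
Qed.

(* Each failure of [N(f) <= R(f^n)] splits off one Jordan block, which lowers
   both the nullity and the defect by one. *)
Lemma semi_Fredholm_step U f : bounded_op f -> closed_subspace U -> invariant_on U f ->
  semi_Fredholm U f -> ~ Kato U f ->
  exists M k (b : 'I_k.+1 -> X), let N := span_of b in
    [/\ closed_subspace M, invariant_on M f /\ invariant_on N f, set_sum M N = U & M `&` N = [set 0]] /\
    [/\ semi_Fredholm M f, forall x, N x -> iter k.+1 f x = 0, nullity N f = 1%E & defect N f = 1%E].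
Proof.
move=> bf cU fU [cr fin] nk; have sU := closed_subspace_linsub cU.
have [n0 hn0] : exists n, `[< ~ (op_ker U f `<=` op_ran U (iter n f)) >].
  apply: contrapT => nn; apply: nk; split.
    by have := cr 1%N; rewrite op_ranS op_ran0.
  by move=> n; apply: contrapT => h; apply: nn; exists n; apply/asboolP.
have [n /asboolP hn min] := ex_minnP (ex_intro (fun n => `[< ~ (op_ker U f `<=` op_ran U (iter n f)) >]) _ hn0).
case: n hn min => [|k] hn min.
  by case: hn; rewrite op_ran0 => x [].
have kk : op_ker U f `<=` op_ran U (iter k f).
  by apply: contrapT => h; have := min k; rewrite ltnn => /(_ (asboolT h)).
have [x Nx nx] : exists2 x, op_ker U f x & ~ op_ran U (iter k.+1 f) x.
  by apply: contrapT => h; apply: hn => x Nx; apply: contrapT => nx; apply: h; exists x.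
have [y Uy yx] := kk _ Nx.
have ck : closed_subspace (op_ran U (iter k.+1 f)).
  by apply/closed_linsubP; split=> //; exact: linsub_iter_ran.
have [phi [[c c0 hc] phi0 phix]] := separating_functional ck nx.
have [||M [b]] := jordan_split bf cU fU c0 hc phi0 Uy (k := k).
- by rewrite yx.
- by rewrite iterS yx; case: Nx.
set N := span_of b => /= -[[cM [fM fN] MN MN0] [nN nu de]].
exists M, k, b; do !split=> //.
  have sM := closed_subspace_linsub cM.
  have sN : linsub N by apply: closed_subspace_linsub; apply: closed_plus_span; exact: closed_subspace_set0.
  move=> j; rewrite (@ran_summand _ _ M N (iter j f)) //.
  - by rewrite MN; apply: closedI; [exact: cr | case: cM].
  - exact: invariant_iter.
  - exact: invariant_iter.
have sM := closed_subspace_linsub cM.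
have sN : linsub N by apply: closed_subspace_linsub; apply: closed_plus_span; exact: closed_subspace_set0.
have := fin; rewrite -MN nullity_set_sum // defect_set_sum // nu de.
by case=> h; [left | right]; apply: le_lt_trans h; rewrite leeDl.
Qed.

Lemma span_of0 (b : 'I_0 -> X) : span_of b = [set 0].
Proof.
apply/seteqP; split=> x; first by move=> [c]; rewrite big_ord0 subr0.
by move=> ->; exists (fun=> 0); rewrite big_ord0 subr0.
Qed.

Lemma nullity0 f : nullity [set 0] f = 0%E.
Proof.
rewrite /nullity /space_dim (_ : op_ker _ f = [set 0]).
  by apply/quotient_dim_eq0 => //; exact: linsub_set0.
by apply/seteqP; split=> x; [case | move=> ->; split=> //; rewrite linear0].
Qed.

Lemma defect0 f : defect [set 0] f = 0%E.
Proof.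
rewrite /defect (_ : op_ran _ f = [set 0]).
  by apply/quotient_dim_eq0 => //; exact: linsub_set0.
apply/seteqP; split=> x; first by move=> [_ -> <-]; rewrite /= linear0.
by move=> ->; exists 0; rewrite ?linear0.
Qed.

(** The common value [q] of nullity and defect on the nilpotent part is its number of Jordan
    blocks. *)
Definition Kato_decomposable U f := exists M n (b : 'I_n -> X) (p q : nat), let N := span_of b in
    [/\ closed_subspace M, invariant_on M f /\ invariant_on N f, set_sum M N = U & M `&` N = [set 0]] /\
    [/\ Kato M f, forall x, N x -> iter p f x = 0, nullity N f = q%:R%:E & defect N f = q%:R%:E].

Lemma Kato_decomposable_Kato U f : closed_subspace U -> invariant_on U f -> Kato U f ->
  Kato_decomposable U f.
Proof.
move=> cU fU kf; exists U, 0%N, (fun=> 0), 0%N, 0%N; rewrite /= span_of0 nullity0 defect0.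
split; split=> //.
- by split=> // x /= ->; rewrite linear0.
- exact: set_sum0.
apply/seteqP; split=> x; first by case.
by move=> ->; split=> //; apply: linsub0; exact: closed_subspace_linsub.
Qed.

(** Induction on a finite bound for the nullity or the defect: at [m = 0] no block can be left, so
    the operator is Kato. *)
Lemma semi_Fredholm_decomposable U f : bounded_op f -> closed_subspace U -> invariant_on U f ->
  semi_Fredholm U f -> Kato_decomposable U f.
Proof.
move=> bf cU fU sF.
have [m hm] : exists m : nat, (nullity U f <= m%:R%:E)%E \/ (defect U f <= m%:R%:E)%E.
  have sU := closed_subspace_linsub cU.
  case: sF.2 => [/(quotient_dimP (linsub_ker f sU) (@linsub_set0 R X))|/(quotient_dimP sU (linsub_ran f sU))].
    move=> [n [b hb]]; exists n; left; apply: ge_ereal_inf; exists n%:R%:E => //; exists n => //.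
    by exists b; apply/(quotient_basisP b (linsub_ker f sU) (@linsub_set0 R X)).
  move=> [n [b hb]]; exists n; right; apply: ge_ereal_inf; exists n%:R%:E => //; exists n => //.
  by exists b; apply/(quotient_basisP b sU (linsub_ran f sU)).
elim: m U cU fU sF hm => [|m ih] U cU fU sF hm; have sU := closed_subspace_linsub cU.
all: have [kf|nk] := pselect (Kato U f); first exact: Kato_decomposable_Kato.
all: have [M [k [b [[cM [fM fJ] MJ MJ0] [sFM nJ nu de]]]]] := semi_Fredholm_step bf cU fU sF nk.
all: have sM := closed_subspace_linsub cM.
all: have sJ : linsub (span_of b) by apply/closed_subspace_linsub/closed_plus_span/closed_subspace_set0.
all: move: hm; rewrite -MJ nullity_set_sum // defect_set_sum // nu de.
  have pos (x : \bar R) : (0 <= x)%E -> ~ (x + 1 <= 0%:R%:E)%E.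
    move=> x0 h; have : (1 <= 0 :> \bar R)%E by apply: le_trans h; rewrite leeDr.
    by rewrite lee_fin ler10.
  by case=> /pos h; exfalso; apply: h; exact: quotient_dim_nneg.
have -> : (m.+1%:R%:E = m%:R%:E + 1 :> \bar R)%E by rewrite -EFinD natr1.
rewrite !leeD2rE // => hm.
have [M' [n [b' [p [q [[cM' [fM' fN'] MN' MN0'] [kM' nN' nu' de']]]]]]] := ih M cM fM sFM hm.
have sM' := closed_subspace_linsub cM'.
have sN' : linsub (span_of b') by apply/closed_subspace_linsub/closed_plus_span/closed_subspace_set0.
have [d1 d2] : M' `&` set_sum (span_of b') (span_of b) = [set 0] /\ span_of b' `&` span_of b = [set 0].
  by apply: direct_sumA => //; rewrite MN'.
have [b'' eb] := span_of_cat b' b.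
exists M', (n + k.+1)%N, b'', (p + k.+1)%N, q.+1; rewrite /= -eb; split; split=> //.
- by split=> //; exact: invariant_set_sum.
- by rewrite set_sumA MN'.
- move=> _ [u Nu [v Jv <-]].
  have eu : iter (p + k.+1) f u = 0 by rewrite addnC iterD nN' // (linear0 (iter k.+1 f)).
  have ev : iter (p + k.+1) f v = 0 by rewrite iterD nJ // (linear0 (iter p f)).
  by rewrite (linearD (iter (p + k.+1) f)) /= eu ev addr0.
- by rewrite nullity_set_sum // nu' nu -EFinD natr1.
- by rewrite defect_set_sum // de' de -EFinD natr1.
Qed.

End SemiFredholm.

(** * Poles of the resolvent *)

Section Resolvent.
Context {R : realType} {X : completeNormedModType R[i]}.
Implicit Types (U V M N : set X) (f : {linear X -> X}).

Lemma norm_le_rn (x y : X) (e : R) : (`|x| <= e%:C * `|y|) = (rn x <= e * rn y).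
Proof. by rewrite !rnE -rmorphM lecR. Qed.

Lemma bounded_operator_rn U (f : X -> X) : bounded_operator U f ->
  exists2 c : R, 0 <= c & forall x, U x -> rn (f x) <= c * rn x.
Proof.
move=> [_ _ [c hc]]; exists (rn c); first exact: rn_ge0.
move=> x /hc; rewrite !rnE lecE => /andP[_] /=.
case: c {hc} => a b /=; rewrite mulr0 subr0 => h; apply: le_trans h _.
rewrite ler_wpM2r ?rn_ge0 //; apply: le_trans (ler_norm a) _.
exact: (Re_le_rn (a +i* b)).
Qed.

Lemma bijective_invertible U f : bounded_op f -> closed_subspace U -> invariant_on U f ->
  (forall x, U x -> f x = 0 -> x = 0) -> op_ran U f = U -> invertible U f.
Proof.
move=> bf cU fU inj sur; have sU := closed_subspace_linsub cU.
have [|C C0 hC] := bounded_preimage bf cU; first by rewrite sur; case: cU.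
have /choice[S hS] : forall y, exists x, U y -> [/\ U x, f x = y & rn x <= C * rn y].
  move=> y; have [Uy|nUy] := pselect (U y); last by exists 0.
  by have [|x hx] := hC y; [rewrite sur | exists x].
have uniq x x' : U x -> U x' -> f x = f x' -> x = x'.
  move=> Ux Ux' e; apply/eqP; rewrite -subr_eq0; apply/eqP; apply: inj.
    exact: linsubB.
  by rewrite linearB e subrr.
exists S; split.
  split; first by move=> x /hS[].
    move=> a x y Ux Uy; have Uaxy := sU.2 a _ _ Ux Uy.
    have [USx fSx _] := hS _ Ux; have [USy fSy _] := hS _ Uy; have [USz fSz _] := hS _ Uaxy.
    apply: uniq => //; first exact: sU.2.
    by rewrite fSz linearP fSx fSy.
  by exists C%:C => x /hS[_ _]; rewrite norm_le_rn.
move=> x Ux; have [_ fSx _] := hS _ Ux; have [USf fSf _] := hS _ (fU _ Ux).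
by split=> //; exact: uniq.
Qed.

Lemma invertible_inj U f x : linsub U -> invertible U f -> U x -> f x = 0 -> x = 0.
Proof.
move=> sU [S [[_ linS _] hS]] Ux fx; have [<- _] := hS _ Ux; rewrite fx.
have := linS (-1) 0 0 (linsub0 sU) (linsub0 sU).
by rewrite scaler0 addr0 scaleN1r addNr.
Qed.

Lemma invertible_ran U f : invariant_on U f -> invertible U f -> op_ran U f = U.
Proof.
move=> fU [S [[SU _ _] hS]]; apply/seteqP; split=> x; first by move=> [y Uy <-]; exact: fU.
by move=> Ux; exists (S x); [exact: SU | case: (hS _ Ux)].
Qed.

Lemma real_point_near (l : R[i]) (d : R) : 0 < d -> exists z : R[i], 0 < rn (z - l) < d.
Proof.
move=> d0; exists (l + (d / 2)%:C); rewrite addrC addKr rnC gtr0_norm ?divr_gt0 //.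
by move: d0; lra.
Qed.

(** A nonzero spectral point is a pole, and the punctured disc around it consists of resolvent
    points. The point [0] carries no such information and is first replaced by a nearby nonzero
    point. *)
Lemma meromorphic_dense N f l (d : R) : meromorphic N f -> 0 < d ->
  exists z, rn (z - l) < d /\ invertible N (subscal f z).
Proof.
move=> mer.
have key (l' : R[i]) (e : R) : l' != 0 -> 0 < e -> exists z, rn (z - l') < e /\ invertible N (subscal f z).
  move=> l0 e0; have [inv|ninv] := pselect (invertible N (subscal f l')).
    by exists l'; rewrite subrr rn0.
  have [p [_ [A [_ _ [r r0 hr]]]]] := mer _ ninv l0.
  have [rE rr0] := ltC0 r0.
  have [|z /andP[z0]] := @real_point_near l' (Num.min e (complex.Re r)).
    by rewrite lt_min e0.
  rewrite lt_min => /andP[ze zr]; exists z; split=> //.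
  have [|S hS _] := hr z; last by exists S.
  by rewrite rE rnE !ltcR z0.
have [->|l0] := eqVneq l 0; last exact: key.
move=> d0; have d2 : 0 < d / 2 by rewrite divr_gt0.
have [l1 /andP[l1p l1d]] := @real_point_near 0 (d / 2) d2; rewrite subr0 in l1p l1d.
have [|z [zl inv]] := key l1 (d / 2) _ d2; first by rewrite -rn_gt0.
exists z; split=> //; rewrite subr0.
by have := rnD (z - l1) l1; rewrite subrK; move: zl l1d; lra.
Qed.

(** Identity theorem on a punctured disc. The terms stay bounded by [B] at radius [rho]; once the
    coefficients before [k] vanish, taking [rn w = t * rho] and dividing by [t ^+ k] leaves a bound
    [2 * B * t] on the term [k], and [t] is arbitrary. *)
Lemma power_series_eq0 (e : nat -> X) (r : R) : 0 < r ->
  (forall w : R[i], 0 < rn w < r -> forall d : R, 0 < d -> exists m, forall n, (m <= n)%N ->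
     rn (\sum_(k < n) w ^+ k *: e k) <= d) ->
  forall k, e k = 0.
Proof.
move=> r0 H; pose rho := r / 2.
have rho0 : 0 < rho by rewrite divr_gt0.
have [B B0 hB] : exists2 B : R, 0 <= B & forall n, rho ^+ n * rn (e n) <= B.
  have rnrho : rn (rho%:C) = rho by rewrite rnC gtr0_norm.
  have [|m hm] := H rho%:C _ 1 ltr01; first by rewrite rnrho rho0 /rho; move: r0; lra.
  pose S := \sum_(j < m) rho ^+ j * rn (e j).
  have S0 : 0 <= S by apply: sumr_ge0 => j _; rewrite mulr_ge0 ?rn_ge0 // exprn_ge0 // ltW.
  exists (2 + S); first by rewrite addr_ge0.
  move=> n; have [nm|mn] := ltnP n m.
    rewrite {1}/S (bigD1 (Ordinal nm)) //= addrCA lerDl addr_ge0 // sumr_ge0 // => j _.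
    by rewrite mulr_ge0 ?rn_ge0 // exprn_ge0 // ltW.
  have h1 := hm n mn; have := hm n.+1 (leqW mn); rewrite big_ord_recr /= => h2.
  have := rnB (\sum_(k < n) rho%:C ^+ k *: e k + rho%:C ^+ n *: e n) (\sum_(k < n) rho%:C ^+ k *: e k).
  rewrite addrC addKr rnZ rnX rnrho; move: h1 h2 S0; lra.
move=> k; have [m] := ubnP k; elim: m k => // m ih k; rewrite ltnS => km.
have ek j : (j < k)%N -> e j = 0 by move=> jk; apply: ih; exact: leq_trans jk km.
have key (t : R) : 0 < t <= 1 / 2 -> rho ^+ k * rn (e k) <= 2 * B * t.
  move=> /andP[t0 t2].
  pose w : R[i] := (t * rho)%:C.
  have rw : rn w = t * rho by rewrite rnC gtr0_norm // mulr_gt0.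
  have tk0 : 0 < t ^+ k by rewrite exprn_gt0.
  have tail n : rn (\sum_(i < n) w ^+ (k.+1 + i) *: e (k.+1 + i)%N) <= t ^+ k * (2 * B * t).
    (* Geometric tail, with [1 / (1 - t) <= 2]; the factor [1 - t ^+ n] makes the induction on [n]
       close. *)
    suff : rn (\sum_(i < n) w ^+ (k.+1 + i) *: e (k.+1 + i)%N) <= t ^+ k * (2 * B * t) * (1 - t ^+ n).
      move/le_trans; apply; rewrite ler_piMr //; last by rewrite gerBl exprn_ge0 // ltW.
      by rewrite !mulr_ge0 // ltW.
    elim: n => [|n ihn]; first by rewrite big_ord0 rn0 expr0 subrr mulr0.
    rewrite big_ord_recr /=; apply: le_trans (rnD _ _) _.
    rewrite rnZ rnX rw exprMn -mulrA.
    have := ler_wpM2l (ltW (exprn_gt0 (k.+1 + n) t0)) (hB (k.+1 + n)%N).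
    rewrite exprD exprS (exprS t n).
    have tn0 : 0 < t ^+ n by rewrite exprn_gt0.
    have h3 : 0 <= B * t ^+ k * t * t ^+ n by rewrite !mulr_ge0 // ltW.
    have h4 : B * t ^+ k * t * t ^+ n * t <= B * t ^+ k * t * t ^+ n * (1 / 2) by rewrite ler_wpM2l.
    move: ihn h3 h4; lra.
  rewrite -(ler_pM2l tk0); apply/ler_addgt0Pr => d d0.
  have [|N hN] := H w _ d d0.
    rewrite rw mulr_gt0 //= /rho; have := ler_wpM2r (ltW r0) t2; move: r0; lra.
  have := hN (k.+1 + N)%N (leq_addl _ _).
  rewrite big_split_ord /= big_ord_recr /= big1 ?add0r => [|i _]; last by rewrite ek ?scaler0.
  set s := \sum_(i < N) _ => h.
  have := rnB (w ^+ k *: e k + s) s; rewrite addrK rnZ rnX rw exprMn -mulrA.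
  have := tail N; rewrite -/s; move: h; lra.
apply/eqP; rewrite -rn_eq0 eq_le rn_ge0 andbT.
have rk : 0 < rho ^+ k by rewrite exprn_gt0.
suff : rho ^+ k * rn (e k) <= 0 by rewrite pmulr_rle0.
apply/ler_addgt0Pr => d d0; rewrite add0r.
pose t := Num.min (1 / 2) (d / (2 * B + 1)).
have B1 : 0 < 2 * B + 1 by rewrite ltr_wpDl // mulr_ge0.
have t0 : 0 < t by rewrite lt_min !divr_gt0.
have t2 : t <= 1 / 2 by rewrite ge_min lexx.
have td : t <= d / (2 * B + 1) by rewrite ge_min lexx orbT.
apply: le_trans (key t _) _; first by rewrite t0.
move: td; rewrite ler_pdivlMr //; move: t0; lra.
Qed.

End Resolvent.

Section Poles.
Context {R : realType} {X : completeNormedModType R[i]}.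
Implicit Types (U V M N : set X) (f : {linear X -> X}).

Lemma pole_sumE (w : R[i]) (p n : nat) (A : nat -> X) : w != 0 ->
  \sum_(k < n) w ^ (k%:Z - p%:Z) *: A k = w ^- p *: \sum_(k < n) w ^+ k *: A k.
Proof.
move=> w0; rewrite scaler_sumr; apply: eq_bigr => k _.
by rewrite expfzDr // -exprnP -exprnN mulrC scalerA.
Qed.

(* The coefficients satisfy [D A_k = A_(k-1) + [k = p] I = A_k D] for [D = f - l];
   hence [D^(p+1) A_p = D^p] and [D] is bijective on [R(D^p)]. *)
Lemma pole_drazin N f l : bounded_op f -> closed_subspace N -> invariant_on N f ->
  resolvent_pole N f l -> exists p, let D := subscal f l in
    [/\ closed_subspace (op_ran N (iter p D)), op_ran N (iter p.+1 D) = op_ran N (iter p D) &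
        forall x, op_ran N (iter p D) x -> D x = 0 -> x = 0].
Proof.
move=> bf cN fN [p [p0 [A [bA _ [rC rC0 hr]]]]]; exists p.
have [rE r0] := ltC0 rC0; set r := complex.Re rC in rE r0.
have sN := closed_subspace_linsub cN.
set D := subscal f l.
have DN : invariant_on N D by exact: invariant_subscal.
have [K K0 hK] : bounded_op D by exact: bounded_subscal.
have DB x y : D (x - y) = D x - D y by exact: (linearB (subscal f l)).
have DS n (c : nat -> R[i]) (u : nat -> X) : D (\sum_(k < n) c k *: u k) = \sum_(k < n) c k *: D (u k).
  rewrite /D (linear_sum (subscal f l)); apply: eq_bigr => k _; exact: (linearZ_LR (subscal f l)).
have AN k x : N x -> N (A k x) by case: (bA k) => h _ _; exact: h.
(* [A'] holds the coefficients after multiplication by [w], and [pk] those of the constant series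
   [w ^+ p *: x]. *)
pose A' k x := if k is k'.+1 then A k' x else 0.
pose pk k x := if k == p then x else 0 : X.
(* Multiplying by [w ^+ p] turns the Laurent series into a power series with limit [w ^+ p *: S x];
   the [+ 1] in the tolerance covers [x = 0]. *)
have conv w : 0 < rn w < r -> exists2 S : X -> X, op_inverse N (subscal D w) S &
    forall x, N x -> forall d : R, 0 < d -> exists m, forall n, (m <= n)%N ->
      rn (\sum_(k < n) w ^+ k *: A k x - w ^+ p *: S x) <= d.
  move=> /andP[w0 wr]; have wn0 : w != 0 by rewrite -rn_gt0.
  have [|S hS hm] := hr (l + w); first by rewrite [l + w]addrC addrK rE rnE !ltcR w0.
  exists S; first by rewrite /D subscal_subscal.
  move=> x Nx d d0; have wp : 0 < rn w ^+ p * (rn x + 1).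
    by rewrite mulr_gt0 ?exprn_gt0 // ltr_wpDl // rn_ge0.
  have [|m hm'] := hm (d / (rn w ^+ p * (rn x + 1)))%:C; first by rewrite ltcR divr_gt0.
  exists m => n mn; have := hm' n mn x Nx; rewrite norm_le_rn [l + w]addrC addrK (pole_sumE p n (fun k => A k x) wn0).
  set s := \sum_(k < n) _ => h.
  have -> : s - w ^+ p *: S x = w ^+ p *: (w ^- p *: s - S x).
    by rewrite scalerBr scalerA mulfV ?scale1r // expf_neq0.
  rewrite rnZ rnX.
  have := ler_wpM2l (exprn_ge0 p (ltW w0)) h => /le_trans; apply.
  have x1 : 0 < rn x + 1 by rewrite ltr_wpDl // rn_ge0.
  rewrite (_ : rn w ^+ p * (d / (rn w ^+ p * (rn x + 1)) * rn x) = d * (rn x / (rn x + 1))); last first.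
    by field; rewrite ?gt_eqF ?exprn_gt0.
  rewrite ler_piMr ?(ltW d0) // ler_pdivrMr //; lra.
have shift n w x : \sum_(k < n.+1) w ^+ k *: A' k x = w *: \sum_(k < n) w ^+ k *: A k x.
  rewrite big_ord_recl /= scaler0 add0r scaler_sumr; apply: eq_bigr => k _.
  by rewrite scalerA exprS.
have sumpk n w x : (p < n)%N -> \sum_(k < n) w ^+ k *: pk k x = w ^+ p *: x.
  move=> pn; rewrite (bigD1 (Ordinal pn)) //= /pk eqxx big1 ?addr0 // => k kp.
  rewrite ifN ?scaler0 //; apply: contra kp => /eqP kp; by apply/eqP/val_inj.
(* The power series formed from the differences of the two sides converges to [w ^+ p] times
   [(D - w) (S x) - x], which is [0]. *)
have DA k x : N x -> D (A k x) = A' k x + pk k x.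
  move=> Nx; apply/eqP; rewrite -subr_eq0; apply/eqP; move: k.
  apply: (power_series_eq0 r0) => w wr d d0.
  have [S [[SN _ _] hS] hc] := conv w wr; have [_ DSx] := hS x Nx.
  have /andP[w0 _] := wr.
  have q : 0 < K + rn w by rewrite ltr_wpDl.
  have [m hm] := hc x Nx (d / (K + rn w)) (divr_gt0 d0 q).
  exists (maxn m p).+1 => -[|n] //; rewrite ltnS geq_max => /andP[mn pn].
  under eq_bigr => k _ do rewrite scalerBr (scalerDr _ (A' k x)).
  rewrite sumrB big_split /= shift sumpk // -(DS n.+1 (fun k => w ^+ k) (fun k => A k x)).
  set s := \sum_(k < n.+1) _; set s' := \sum_(k < n) _.
  have -> : D s - (w *: s' + w ^+ p *: x) = D (s - w ^+ p *: S x) - w *: (s' - w ^+ p *: S x).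
    have DZ : D (w ^+ p *: S x) = w ^+ p *: D (S x) by exact: (linearZ_LR (subscal f l)).
    by rewrite DB DZ -{1}DSx /subscal; vec.
  apply: le_trans (rnB _ _) _; rewrite rnZ.
  have h1 := hm n.+1 (leqW mn); have h2 := hm n mn.
  have h3 := ler_wpM2l K0 h1; have h4 := ler_wpM2l (rn_ge0 w) h2.
  have h5 := hK (s - w ^+ p *: S x).
  have e : d = K * (d / (K + rn w)) + rn w * (d / (K + rn w)).
    by rewrite -mulrDl mulrC divfK // gt_eqF.
  rewrite [leRHS]e; move: h3 h4 h5; lra.
have AD k x : N x -> A k (D x) = A' k x + pk k x.
  move=> Nx; apply/eqP; rewrite -subr_eq0; apply/eqP; move: k.
  apply: (power_series_eq0 r0) => w wr d d0.
  have [S [[SN linS _] hS] hc] := conv w wr; have [SDx _] := hS x Nx.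
  have /andP[w0 _] := wr.
  have q : 0 < 1 + rn w by rewrite ltr_wpDr // rn_ge0.
  have [m1 hm1] := hc x Nx (d / (1 + rn w)) (divr_gt0 d0 q).
  have [m2 hm2] := hc _ (DN x Nx) (d / (1 + rn w)) (divr_gt0 d0 q).
  exists (maxn (maxn m1 m2) p).+1 => -[|n] //; rewrite ltnS !geq_max => /andP[/andP[mn1 mn2] pn].
  under eq_bigr => k _ do rewrite scalerBr (scalerDr _ (A' k x)).
  rewrite sumrB big_split /= shift sumpk //.
  set s := \sum_(k < n.+1) _; set s' := \sum_(k < n) _.
  have e1 : S (D x) = w *: S x + x.
    have -> : D x = w *: x + subscal D w x by rewrite /subscal; vec.
    by rewrite linS // ?SDx //; apply: linsubB => //; [exact: DN | exact: linsubZ].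
  have -> : s - (w *: s' + w ^+ p *: x) = (s - w ^+ p *: S (D x)) - w *: (s' - w ^+ p *: S x).
    by rewrite e1; vec.
  apply: le_trans (rnB _ _) _; rewrite rnZ.
  have h1 := hm2 n.+1 (leqW mn2); have h2 := hm1 n mn1.
  have h4 := ler_wpM2l (rn_ge0 w) h2.
  have e : d = d / (1 + rn w) + rn w * (d / (1 + rn w)).
    by rewrite -[X in X + _]mul1r -mulrDl mulrC divfK // gt_eqF.
  rewrite [leRHS]e; move: h1 h4; rewrite -/s; lra.
have ADc k x : N x -> A k (D x) = D (A k x) by move=> Nx; rewrite AD // DA.
have D0 : D 0 = 0 by exact: (linear0 (subscal f l)).
have DjA j x : (j < p)%N -> N x -> iter j.+1 D (A j x) = 0.
  move=> jp Nx; elim: j jp => [|j ih] jp; rewrite iterSr DA // /pk ltn_eqF // addr0 //=.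
  by rewrite -iterS ih // ltnW.
have itL j x y : iter j D (x + y) = iter j D x + iter j D y by exact: (linearD (iter j (subscal f l))).
have itN j x : N x -> N (iter j D x) by move=> Nx; exact: invariant_iter.
have DpA x : N x -> iter p.+1 D (A p x) = iter p D x.
  move=> Nx; rewrite iterSr DA // itL /pk eqxx.
  by move: p0 DjA; case: (p) => // p' _ DjA; rewrite /A' DjA // add0r.
have Aiter k j x : N x -> A k (iter j D x) = iter j D (A k x).
  by move=> Nx; elim: j => //= j ih; rewrite ADc ?ih //; exact: itN.
have sr := @linsub_iter_ran _ _ N (subscal f l) p sN.
have rN : op_ran N (iter p D) `<=` N by exact: op_ran_sub.
have ADid y : op_ran N (iter p D) y -> D (A p y) = y.
  by move=> [x Nx <-]; rewrite Aiter // -iterS DpA.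
split.
- apply/closed_linsubP; split=> //.
  (* [A p] inverts [D] on the range; by continuity it still does on the closure [Y], which it
     preserves, so applying it [p] times shows that [Y] is contained in the range. *)
  pose Y := [set y | forall e : R, 0 < e -> exists2 u, op_ran N (iter p D) u & rn (y - u) < e].
  have YN y : Y y -> N y.
    by move=> hy; apply: (closed_subspace_lim cN) => e /hy[u /rN Nu yu]; exists u.
  have [C C0 hC] := bounded_operator_rn (bA p).
  have AL x y : N x -> N y -> A p (x - y) = A p x - A p y.
    have [_ linA _] := bA p => Nx Ny.
    by rewrite -scaleN1r addrC linA // scaleN1r addrC.
  have YA y : Y y -> Y (A p y).
    move=> hy e e0; have C1 : 0 < C + 1 by rewrite ltr_wpDl.
    have [u ru yu] := hy _ (divr_gt0 e0 C1); exists (A p u).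
      by case: ru => x Nx <-; rewrite Aiter //; exists (A p x) => //; exact: AN.
    rewrite -AL; [|exact: YN|exact: rN].
    have := hC _ (linsubB sN (YN _ hy) (rN _ ru)).
    move: yu; rewrite ltr_pdivlMr //; have := rn_ge0 (y - u); lra.
  have YD y : Y y -> D (A p y) = y.
    move=> hy; apply/eqP; rewrite -subr_eq0 -rn_eq0 eq_le rn_ge0 andbT.
    apply/ler_addgt0Pr => e e0; rewrite add0r.
    have C1 : 0 < K * C + 1 by rewrite ltr_wpDl // mulr_ge0.
    have [u ru yu] := hy _ (divr_gt0 e0 C1).
    have -> : D (A p y) - y = D (A p (y - u)) - (y - u).
      by rewrite AL; [rewrite DB (ADid u ru); vec | exact: YN | exact: rN].
    have h1 := hC _ (linsubB sN (YN _ hy) (rN _ ru)).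
    have h2 := ler_wpM2l K0 h1; have h3 := hK (A p (y - u)).
    apply: le_trans (rnB _ _) _.
    move: yu; rewrite ltr_pdivlMr //; move: h2 h3; lra.
  apply/closed_rn => y hy.
  have {}hy : Y y by [].
  suff [u Yu <-] : exists2 u, Y u & iter p D u = y by exists u => //; exact: YN.
  elim: (p) => [|j [u Yu e]]; first by exists y.
  by exists (A p u); [exact: YA | rewrite iterSr YD].
- apply/seteqP; split; first exact: (@op_ran_anti _ _ N (subscal f l) p p.+1 DN (leqnSn p)).
  by move=> _ [x Nx <-]; exists (A p x); [exact: AN | exact: DpA].
move=> y ry Dy; rewrite -(ADid y ry) -ADc; last exact: rN.
rewrite Dy; have [_ linA _] := bA p.
have := linA (-1) 0 0 (linsub0 sN) (linsub0 sN).
by rewrite scaler0 addr0 scaleN1r addNr.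
Qed.

End Poles.

(** * Adding a nilpotent summand to a meromorphic operator *)

Section NilpotentSummand.
Context {R : realType} {X : completeNormedModType R[i]}.
Implicit Types (U V M N J : set X) (f : {linear X -> X}).

(** The open mapping theorem for the addition map from the product of [J] and [N] onto their closed
    sum. *)
Lemma bounded_projections J N : closed_subspace J -> closed_subspace N ->
  closed_subspace (set_sum J N) ->
  exists (P Q : X -> X) (C : R), 0 < C /\ forall x, set_sum J N x ->
    [/\ J (P x), N (Q x), x = P x + Q x, rn (P x) <= C * rn x & rn (Q x) <= C * rn x].
Proof.
move=> cJ cN cK.
have e : sum_range idfun J N = set_sum J N.
  apply/seteqP; split=> y; first by move=> [x [v [Jx Nv ->]]]; exists x => //; exists v.
  by move=> [x Jx [v Nv <-]]; exists x, v.
have b1 : bounded_op (@idfun X) by exists 1 => // x; rewrite mul1r.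
have [|C C0 h] := @open_mapping R X idfun J N b1 cJ cN; first by rewrite e.
have /choice[PQ hPQ] : forall x, exists pq : X * X, set_sum J N x ->
    [/\ J pq.1, N pq.2, x = pq.1 + pq.2, rn pq.1 <= C * rn x & rn pq.2 <= C * rn x].
  move=> x; have [Kx|nKx] := pselect (set_sum J N x); last by exists (0, 0).
  have [|u [v huv]] := h x; first by rewrite e.
  by exists (u, v).
by exists (fun x => (PQ x).1), (fun x => (PQ x).2), C.
Qed.

(** The projections are bounded, so the two components of an approximant approximate the two
    components of the limit. *)
Lemma closed_set_sum M N U V : closed_subspace M -> closed_subspace N -> closed_subspace (set_sum M N) ->
  M `&` N = [set 0] -> closed_subspace U -> closed_subspace V -> U `<=` M -> V `<=` N ->
  closed_subspace (set_sum U V).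
Proof.
move=> cM cN cMN MN0 cU cV UM VN; have sM := closed_subspace_linsub cM.
have sN := closed_subspace_linsub cN; have sMN := closed_subspace_linsub cMN.
have [P [Q [C [C0 hPQ]]]] := bounded_projections cM cN cMN.
have UVMN x : set_sum U V x -> set_sum M N x.
  by move=> [u Uu [v Vv <-]]; exists u; [exact: UM | exists v => //; exact: VN].
apply/closed_linsubP; split; last by apply: linsub_set_sum; exact: closed_subspace_linsub.
apply/closed_rn => x hx.
have Kx : set_sum M N x.
  by apply: (closed_subspace_lim cMN) => e /hx[w /UVMN ? xw]; exists w.
have [MPx NQx xE _ _] := hPQ _ Kx.
have key (d : R) : 0 < d -> exists u v, [/\ U u, V v, rn (P x - u) < d & rn (Q x - v) < d].
  move=> e0; have [w [u Uu [v Vv wE]] xw] := hx _ (divr_gt0 e0 C0).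
  have Kw : set_sum M N (x - w) by apply: linsubB => //; rewrite -wE; apply: UVMN; exists u => //; exists v.
  have [MP NQ dE hP hQ] := hPQ _ Kw.
  have Mu : M (P x - u) by apply: linsubB => //; exact: UM.
  have Nv : N (Q x - v) by apply: linsubB => //; exact: VN.
  have e : P x - u + (Q x - v) = P (x - w) + Q (x - w) by rewrite -dE -wE [in RHS]xE; vec.
  have [e1 e2] := direct_unique sM sN MN0 Mu MP Nv NQ e.
  exists u, v; rewrite e1 e2; split=> //.
    by apply: le_lt_trans hP _; rewrite mulrC -ltr_pdivlMr.
  by apply: le_lt_trans hQ _; rewrite mulrC -ltr_pdivlMr.
rewrite xE; exists (P x).
  by apply: (closed_subspace_lim cU) => e /key[u [v [Uu _ pu _]]]; exists u.
exists (Q x) => //.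
by apply: (closed_subspace_lim cV) => e /key[u [v [_ Vv _ qv]]]; exists v.
Qed.

(** If [f x] is the value of [f - l] at [v], then [x] is its value at [l^-1 *: (v - x)]; this lowers
    the nilpotency order by one. *)
Lemma nilpotent_ran J f p l x : linsub J -> invariant_on J f -> l != 0 -> J x -> iter p f x = 0 ->
  op_ran J (subscal f l) x.
Proof.
move=> sJ fJ l0; elim: p x => [|p ih] x Jx.
  by move=> /= ->; exists 0; [exact: linsub0 | rewrite (linear0 (subscal f l))].
rewrite iterSr => /(ih _ (fJ _ Jx))[v Jv fv].
exists (l^-1 *: (v - x)); first by apply: linsubZ => //; exact: linsubB.
rewrite /subscal (linearZ_LR f) linearB /= -fv /subscal.
vec_with ltac:(by field).
Qed.

Lemma nilpotent_invertible J f p l : bounded_op f -> closed_subspace J -> invariant_on J f ->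
  (forall x, J x -> iter p f x = 0) -> l != 0 -> invertible J (subscal f l).
Proof.
move=> bf cJ fJ nil l0; have sJ := closed_subspace_linsub cJ.
have gJ := invariant_subscal l sJ fJ.
apply: (bijective_invertible (bounded_subscal l bf)) => //.
  move=> x Jx /eqP; rewrite /subscal subr_eq0 => /eqP fx.
  have : iter p f x = l ^+ p *: x.
    elim: (p) => [|j ih]; first by rewrite scale1r.
    by rewrite iterS ih (linearZ_LR f) /= fx scalerA exprSr.
  by rewrite nil // => /esym/eqP; rewrite scaler_eq0 expf_eq0 (negbTE l0) andbF /= => /eqP.
apply/seteqP; split=> [x [y Jy <-]|x Jx]; first exact: gJ.
by apply: (nilpotent_ran (p := p)) => //; exact: nil.
Qed.

Lemma invertible_set_sum J N f : bounded_op f -> closed_subspace (set_sum J N) ->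
  linsub J -> linsub N -> J `&` N = [set 0] ->
  invariant_on J f -> invariant_on N f -> invertible J f -> invertible N f ->
  invertible (set_sum J N) f.
Proof.
move=> bf cK sJ sN JN fJ fN iJ iN; apply: bijective_invertible => //.
- exact: invariant_set_sum.
- move=> _ [u Ju [v Nv <-]]; rewrite linearD => e.
  have [] := direct_unique sJ sN JN (fJ _ Ju) (linsub0 sJ) (fN _ Nv) (linsub0 sN) (etrans e (esym (addr0 0))).
  by move=> /(invertible_inj sJ iJ Ju) -> /(invertible_inj sN iN Nv) ->; rewrite addr0.
- by rewrite op_ran_set_sum !invertible_ran.
Qed.

(* On the nilpotent summand [J] the resolvent is analytic at [l != 0], with
   Neumann series [\sum_k (z - l)^k (f - l)^-(k+1)]; it is added to the Laurent
   series of the resolvent on [N]. *)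
Lemma meromorphic_nilpotent_sum J N f p : bounded_op f -> closed_subspace J -> closed_subspace N ->
  closed_subspace (set_sum J N) -> J `&` N = [set 0] -> invariant_on J f -> invariant_on N f ->
  (forall x, J x -> iter p f x = 0) -> meromorphic N f -> meromorphic (set_sum J N) f.
Proof.
move=> bf cJ cN cK JN fJ fN nil mer l lspec l0.
have sJ := closed_subspace_linsub cJ; have sN := closed_subspace_linsub cN.
have sK := closed_subspace_linsub cK.
have invJ z : z != 0 -> invertible J (subscal f z) by exact: nilpotent_invertible nil.
have gJ z := invariant_subscal z sJ fJ; have gN z := invariant_subscal z sN fN.
have bg z := bounded_subscal z bf.
have lN : spectrum N f l.
  move=> iN; apply: lspec.
  exact: (@invertible_set_sum J N (subscal f l) (bg l) cK sJ sN JN (gJ l) (gN l) (invJ l l0) iN).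
have [q [q0 [A [bA [x0 Nx0 A0x0] [rC rC0 hr]]]]] := mer l lN l0.
have [rE r0] := ltC0 rC0; set r := complex.Re rC in rE r0.
have [B [bB hB]] := invJ l l0.
have [b b0 hb] := bounded_operator_rn bB; have [BJ linB _] := bB.
have [P [Q [C [C0 hPQ]]]] := bounded_projections cJ cN cK.
have PJ x : set_sum J N x -> J (P x) by case/hPQ.
have QN x : set_sum J N x -> N (Q x) by case/hPQ.
have uniq x u v : set_sum J N x -> J u -> N v -> x = u + v -> P x = u /\ Q x = v.
  move=> Kx Ju Nv e; have [JP NQ e' _ _] := hPQ _ Kx.
  by apply: (direct_unique sJ sN JN) => //; rewrite -e' e.
have PQlin a x y : set_sum J N x -> set_sum J N y ->
    P (a *: x + y) = a *: P x + P y /\ Q (a *: x + y) = a *: Q x + Q y.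
  move=> Kx Ky; have [JPx NQx ex _ _] := hPQ _ Kx; have [JPy NQy ey _ _] := hPQ _ Ky.
  apply: uniq; first exact: sK.2.
  - exact: sJ.2.
  - exact: sN.2.
  by rewrite {1}ex {1}ey; vec.
have BiJ k x : J x -> J (iter k B x) by move=> Jx; elim: k => //= k; exact: BJ.
have Bilin k a x y : J x -> J y -> iter k B (a *: x + y) = a *: iter k B x + iter k B y.
  by move=> Jx Jy; elim: k => //= k ->; apply: linB; exact: BiJ.
have Bib k x : J x -> rn (iter k B x) <= b ^+ k * rn x.
  move=> Jx; elim: k => [|k ih]; first by rewrite mul1r.
  by apply: le_trans (hb _ (BiJ k x Jx)) _; rewrite exprS -mulrA ler_wpM2l.
(* With a pole of order [q] the exponent at index [k] is [k - q], so the Neumann coefficient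
   [B^(k - q + 1)] enters only from [k = q] on. *)
pose Bq k x := if (q <= k)%N then iter (k - q).+1 B (P x) else 0.
pose A' k x := A k (Q x) + Bq k x.
have KJ x : J x -> set_sum J N x by move=> Jx; exists x => //; exists 0; [exact: linsub0 | rewrite addr0].
have KN x : N x -> set_sum J N x by move=> Nx; exists 0; [exact: linsub0 | exists x; rewrite ?add0r].
exists q; split=> //; exists A'; split.
- move=> k; have [AN linA _] := bA k; have [a a0 ha] := bounded_operator_rn (bA k); split.
  + move=> x Kx; rewrite /A' /Bq; apply: linsubD => //; first by apply/KN/AN/QN.
    by case: ifP => _; [apply/KJ/BiJ/PJ | exact: linsub0].
  + move=> c x y Kx Ky; have [Pe Qe] := PQlin c _ _ Kx Ky.
    rewrite /A' Qe linA; [|exact: QN|exact: QN].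
    rewrite /Bq Pe; case: ifP => _; last by vec.
    by rewrite Bilin; [vec | exact: PJ | exact: PJ].
  exists (a * C + b ^+ (k - q).+1 * C)%:C => x Kx; rewrite norm_le_rn mulrDl.
  have [JPx NQx _ hP hQ] := hPQ _ Kx.
  apply: le_trans (rnD _ _) (lerD _ _).
    by apply: le_trans (ha _ NQx) _; rewrite -mulrA ler_wpM2l.
  rewrite /Bq; case: ifP => _.
    by apply: le_trans (Bib _ _ JPx) _; rewrite -mulrA ler_wpM2l // exprn_ge0.
  by rewrite rn0 !mulr_ge0 ?rn_ge0 ?exprn_ge0 // ltW.
- exists x0; first exact: KN.
  have [_ Qx0] : P x0 = 0 /\ Q x0 = x0.
    by apply: uniq; rewrite ?add0r //; [exact: KN | exact: linsub0].
  by rewrite /A' /Bq Qx0 leqNgt q0 addr0.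
have ln0 : 0 < rn l by rewrite rn_gt0.
have b1 : 0 < 2 * (b + 1) by rewrite mulr_gt0 // ltr_wpDl.
(* The three bounds give convergence on [N], a Neumann ratio at most [1 / 2] on [J], and
   [z != 0]. *)
pose r' := Num.min r (Num.min (1 / (2 * (b + 1))) (rn l)).
have r'0 : 0 < r' by rewrite !lt_min r0 divr_gt0.
exists r'%:C; first by rewrite ltcR.
move=> z; rewrite rnE !ltcR => /andP[zl0]; rewrite !lt_min => /and3P[zr zb zl].
have z0 : z != 0 by apply: contraTneq zl => ->; rewrite sub0r rnN ltxx.
have [|S hS hconv] := hr z; first by rewrite rE rnE !ltcR zl0.
have iK : invertible (set_sum J N) (subscal f z).
  apply: (@invertible_set_sum J N (subscal f z) (bg z) cK sJ sN JN (gJ z) (gN z) (invJ z z0)).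
  by exists S.
have [S' hS'] := iK; exists S' => //.
have [SJ [bSJ hSJ]] := invJ z z0.
have [s s0 hs] := bounded_operator_rn bSJ; have [SJJ linSJ _] := bSJ.
have [[SN _ _] hSN] := hS.
have S'E x : set_sum J N x -> S' x = S (Q x) + SJ (P x).
  move=> Kx; have [JPx NQx e _ _] := hPQ _ Kx.
  have [bS' hS''] := hS'; have [KS' _ _] := bS'.
  apply/eqP; rewrite -subr_eq0; apply/eqP; apply: (invertible_inj sK iK).
    apply: linsubB => //; first exact: KS'.
    by apply: linsubD => //; [apply/KN/SN | apply/KJ/SJJ].
  rewrite (linearB (subscal f z)) (linearD (subscal f z)) /=.
  rewrite (hS'' _ Kx).2 (hSN _ NQx).2 (hSJ _ JPx).2 {1}e; vec.
set w := z - l in zl0 zr zb zl hconv *.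
have wn0 : w != 0 by rewrite -rn_gt0.
have rwb : rn w * b <= 1 / 2.
  move: zb; rewrite ltr_pdivlMr // (_ : rn w * (2 * (b + 1)) = 2 * (rn w * b) + 2 * rn w); last by ring.
  by move: zl0; clear; lra.
(* Truncated Neumann series with its exact remainder, which makes the convergence estimate
   explicit. *)
have neumann u n : J u -> \sum_(j < n) w ^+ j *: iter j.+1 B u = SJ u - SJ (w ^+ n *: iter n B u).
  move=> Ju.
  have JwB k : J (w ^+ k *: iter k B u) by apply: linsubZ => //; exact: BiJ.
  have JS : J (\sum_(j < n) w ^+ j *: iter j.+1 B u).
    by apply: linsub_sum => // i _; apply: linsubZ => //; exact: (BiJ i.+1).
  have e : SJ u - SJ (w ^+ n *: iter n B u) = SJ (u - w ^+ n *: iter n B u).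
    rewrite (_ : u - _ = (-1) *: (w ^+ n *: iter n B u) + u); last by vec.
    by rewrite linSJ //; vec.
  have gz y : J y -> subscal f z (w ^+ 0 *: B y) = y - w *: B y.
    move=> Jy; have [_] := hB _ Jy; rewrite /subscal scale1r; move: (B y) => v <-.
    by rewrite /w; vec.
  rewrite e -[LHS](hSJ _ JS).1; congr (SJ _).
  rewrite (linear_sum (subscal f z)) /=.
  elim: n {JS e} => [|n ih]; first by rewrite big_ord0 scale1r subrr.
  rewrite big_ord_recr /= ih (linearZ_LR (subscal f z)) /=.
  have := gz _ (BiJ n u Ju); rewrite scale1r => ->; rewrite exprSr; vec.
move=> eC /ltC0[eE]; set e := complex.Re eC in eE *; move=> e0.
have [|m1 hm1] := hconv (e / (2 * C))%:C; first by rewrite ltcR divr_gt0 // mulr_gt0.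
have [m2 hm2] := half_pow_small (s * C) (divr_gt0 e0 (ltr0Sn _ 1)).
exists (maxn m1 (q + m2)) => n; rewrite geq_max => /andP[n1 n2] x Kx.
have [JPx NQx _ hP hQ] := hPQ _ Kx.
rewrite eE norm_le_rn S'E //.
under eq_bigr do rewrite scalerDr.
rewrite big_split /=.
have nE : n = (q + (n - q))%N by rewrite subnKC // (leq_trans (leq_addr _ _) n2).
have m2n : (m2 <= n - q)%N by rewrite leq_subRL // (leq_trans (leq_addr _ _) n2).
have -> : \sum_(k < n) w ^ (k%:Z - q%:Z) *: Bq k x =
    SJ (P x) - SJ (w ^+ (n - q) *: iter (n - q) B (P x)).
  rewrite -neumann // [in LHS]nE big_split_ord /= big1 ?add0r => [|k _].
    apply: eq_bigr => k _; rewrite /Bq leq_addr addKn; congr (_ *: _).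
    by rewrite PoszD addrAC subrr add0r.
  by rewrite /Bq leqNgt ltn_ord scaler0.
have := hm1 n n1 _ NQx; rewrite norm_le_rn.
set t := \sum_(k < n) _ => h1.
have -> : t + (SJ (P x) - SJ (w ^+ (n - q) *: iter (n - q) B (P x))) - (S (Q x) + SJ (P x)) =
   (t - S (Q x)) - SJ (w ^+ (n - q) *: iter (n - q) B (P x)) by vec.
have JwB : J (w ^+ (n - q) *: iter (n - q) B (P x)) by apply: linsubZ => //; exact: BiJ.
have h2 := hs _ JwB; rewrite rnZ rnX in h2.
have h3 : rn w ^+ (n - q) * rn (iter (n - q) B (P x)) <= (1 / 2) ^+ m2 * (C * rn x).
  apply: le_trans (ler_wpM2l (exprn_ge0 _ (rn_ge0 w)) (Bib _ _ JPx)) _.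
  rewrite mulrA -exprMn; apply: ler_pM => //; rewrite ?rn_ge0 ?exprn_ge0 ?mulr_ge0 ?rn_ge0 //.
  apply: le_trans (_ : _ <= (1 / 2) ^+ (n - q)) _.
    by rewrite lerXn2r // nnegrE ?mulr_ge0 ?rn_ge0.
  by rewrite ler_wiXn2l // ?divr_ge0 //; lra.
have h4 := le_trans h2 (ler_wpM2l s0 h3).
have h5 : rn (t - S (Q x)) <= e / 2 * rn x.
  apply: le_trans h1 _; have eC0 : 0 <= e / (2 * C) by rewrite divr_ge0 ?(ltW e0) // mulr_ge0 // ltW.
  apply: le_trans (ler_wpM2l eC0 hQ) _.
  by rewrite mulrA (_ : e / (2 * C) * C = e / 2) //; field; rewrite gt_eqF.
have h6 : s * ((1 / 2) ^+ m2 * (C * rn x)) <= e / 2 * rn x.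
  have := ler_wpM2r (rn_ge0 x) (ltW hm2).
  by rewrite expr_div_n expr1n div1r; lra.
by apply: le_trans (rnB _ _) _; move: h4 h5 h6; lra.
Qed.

End NilpotentSummand.

(** * The classes R_i *)

Section Classes.
Context {R : realType} {X : completeNormedModType R[i]}.
Implicit Types (U V M N : set X) (f T : {linear X -> X}).

(** The numerical content of each class, separated from closedness of the range so that it can be
    transported by equalities of nullity and defect. *)
Definition index_class (i : nat) (nu d : \bar R) : Prop :=
  match i with
  | 1%N => nu = 0%E
  | 2%N => d = 0%E
  | 3%N => nu = 0%E /\ d = 0%E
  | 4%N => (nu < +oo)%E
  | 5%N => (d < +oo)%E
  | 6%N => (nu < +oo)%E /\ (d < +oo)%E
  | 7%N => (nu < +oo)%E /\ (nu - d <= 0)%E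
  | 8%N => (d < +oo)%E /\ (0 <= nu - d)%E
  | 9%N => ((nu < +oo)%E /\ (d < +oo)%E) /\ (nu - d)%E = 0%E
  | _ => False
  end.

Lemma index_class_fin i nu d : index_class i nu d -> (nu < +oo)%E \/ (d < +oo)%E.
Proof.
by move: i; do 10?[case=> //=]; do ?[by left | by right | by move=> [] ; left | by move=> []; right
  | by move=> ->; left | by move=> ->; right | by move=> [-> _]; left | by move=> [[]]; left].
Qed.

(** For [i <= 3] a sum of nonnegative terms that vanishes has vanishing terms; in the other classes
    a finite [q] affects neither finiteness nor the difference. *)
Lemma index_class_cancel i nu d (q : nat) : (0 <= nu)%E -> (0 <= d)%E ->
  index_class i (nu + q%:R%:E) (d + q%:R%:E) -> index_class i nu d.
Proof.
move=> nu0 d0.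
have q0 : (0 <= q%:R%:E :> \bar R)%E by rewrite lee_fin.
have z (x : \bar R) : (0 <= x)%E -> (x + q%:R%:E)%E = 0%E -> x = 0%E.
  by move=> x0 /eqP; rewrite padde_eq0 // => /andP[/eqP].
have l (x : \bar R) : (0 <= x)%E -> (x + q%:R%:E < +oo)%E -> (x < +oo)%E.
  by move=> x0; apply: le_lt_trans; rewrite leeDl.
have s : (nu < +oo)%E \/ (d < +oo)%E -> ((nu + q%:R%:E) - (d + q%:R%:E) = nu - d)%E.
  case: nu nu0 => [a| |] //; case: d d0 => [b| |] //= _ _ _; try by rewrite ?ltxx => -[].
  by move=> *; congr (_%:E); ring.
move: i; do 10?[case=> //=].
- exact: z.
- exact: z.
- by move=> [/(z _ nu0) -> /(z _ d0) ->].
- exact: l.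
- exact: l.
- by move=> [/(l _ nu0) h1 /(l _ d0) h2].
- by move=> [/(l _ nu0) h]; rewrite s //; left.
- by move=> [/(l _ d0) h]; rewrite s //; right.
- by move=> [[/(l _ nu0) h1 /(l _ d0) h2]]; rewrite s //; left.
Qed.

Lemma nullity_eq0 U f : linsub U -> nullity U f = 0%E <-> forall x, U x -> f x = 0 -> x = 0.
Proof.
move=> sU; have sk := linsub_ker f sU.
have -> : nullity U f = 0%E <-> op_ker U f = [set 0].
  apply: quotient_dim_eq0 => //; first exact: linsub_set0.
  by move=> _ ->; exact: linsub0.
split=> [e x Ux fx|h]; first by have : op_ker U f x by []; rewrite e.
apply/seteqP; split=> x; first by case; exact: h.
by move=> ->; exact: linsub0.
Qed.

Lemma defect_eq0 U f : linsub U -> invariant_on U f -> defect U f = 0%E <-> op_ran U f = U.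
Proof.
move=> sU fU; have sub : op_ran U f `<=` U by move=> _ [x Ux <-]; exact: fU.
have h := quotient_dim_eq0 sU (linsub_ran f sU) sub.
by split=> [/h /esym|/esym /h].
Qed.

(** Closedness of the range is explicit in some classes; elsewhere it follows from finite defect,
    from surjectivity, or from the lower bound. *)
Lemma classR_index i U f : bounded_op f -> closed_subspace U -> invariant_on U f ->
  classR i U f <-> closed (op_ran U f) /\ index_class i (nullity U f) (defect U f).
Proof.
move=> bf cU fU; have sU := closed_subspace_linsub cU.
have cran : (defect U f < +oo)%E -> closed (op_ran U f).
  by move=> /(closed_ran_defect bf cU fU)[].
have cU' : closed U by case: cU.
move: i; do 10?[case=> //=]; try by (split=> // -[]).
- split=> [[c c0 hc]|[cr /(nullity_eq0 f sU) inj]].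
    have [cE c'0] := ltC0 c0; have hc' x : U x -> complex.Re c * rn x <= rn (f x).
      by move=> /hc; rewrite cE !rnE -rmorphM lecR.
    split.
      have [||//] := @closed_rangeP _ _ U f (complex.Re c)^-1 bf cU.
        by rewrite invr_ge0 ltW.
      by move=> _ [x Ux <-]; exists x; split=> //; rewrite ler_pdivlMl // hc'.
    apply/(nullity_eq0 f sU) => x Ux fx; have := hc' x Ux; rewrite fx rn0.
    by rewrite pmulr_rle0 // => h; apply/eqP; rewrite -rn_eq0 eq_le h rn_ge0.
  have [C C0 hC] := bounded_preimage bf cU cr.
  exists (C^-1)%:C; first by rewrite ltcR invr_gt0.
  move=> x Ux; rewrite !rnE -rmorphM lecR ler_pdivrMl //.
  have [|x' [Ux' fx' xC]] := hC (f x); first by exists x.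
  suff -> : x = x' by rewrite fx'.
  apply/eqP; rewrite -subr_eq0; apply/eqP; apply: inj; first exact: linsubB.
  by rewrite linearB fx' subrr.
- split=> [e|[_ /(defect_eq0 sU fU)]//].
  by split; [rewrite e | apply/(defect_eq0 sU fU)].
- split=> [inv|[_ [/(nullity_eq0 f sU) inj /(defect_eq0 sU fU) e]]].
    have e := invertible_ran fU inv; split; first by rewrite e.
    split; last exact/(defect_eq0 sU fU).
    by apply/(nullity_eq0 f sU) => x Ux; exact: (invertible_inj sU inv Ux).
  exact: bijective_invertible.
all: rewrite /Weyl /upper_semi_Weyl /lower_semi_Weyl /Fredholm /upper_semi_Fredholm /lower_semi_Fredholm /op_index; tauto.
Qed.

Lemma semi_FredholmI U f : bounded_op f -> closed_subspace U -> invariant_on U f ->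
  closed (op_ran U f) -> (nullity U f < +oo)%E \/ (defect U f < +oo)%E -> semi_Fredholm U f.
Proof.
move=> bf cU fU cr [h|h]; first exact: upper_semi_Fredholm_semi.
exact: lower_semi_Fredholm_semi.
Qed.

(** The Kato part has the nullity and defect of a nearby bijective [f - mu], so both are [0]; only
    the nilpotent part contributes, by [q] to each. *)
Lemma index0_of_resolvent U f : bounded_op f -> closed_subspace U -> invariant_on U f ->
  semi_Fredholm U f ->
  (forall d : R, 0 < d -> exists mu, [/\ rn mu < d, forall x, U x -> subscal f mu x = 0 -> x = 0 &
     op_ran U (subscal f mu) = U]) ->
  exists q : nat, nullity U f = q%:R%:E /\ defect U f = q%:R%:E.
Proof.
move=> bf cU fU sF dense; have sU := closed_subspace_linsub cU.
have [M [n [b [p [q [[cM [fM fN] MN MN0] [kM nN nu de]]]]]]] := semi_Fredholm_decomposable bf cU fU sF.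
have sM := closed_subspace_linsub cM.
have sN : linsub (span_of b) by apply/closed_subspace_linsub/closed_plus_span/closed_subspace_set0.
have [d d0 hd] := Kato_stable bf cM fM kM.
have [mu [mud inj sur]] := dense d d0; have [_ nuM deM] := hd mu mud.
have gM := invariant_subscal mu sM fM.
have gN := invariant_subscal mu sN fN.
have MU : M `<=` U by move=> x Mx; rewrite -MN; exists x => //; exists 0; [exact: linsub0 | rewrite addr0].
have nM0 : nullity M f = 0%E.
  by rewrite -nuM; apply/(nullity_eq0 (subscal f mu) sM) => x /MU; exact: inj.
have dM0 : defect M f = 0%E.
  rewrite -deM; apply/(@defect_eq0 M (subscal f mu) sM gM).
  rewrite (@ran_summand _ _ M (span_of b) (subscal f mu)) // MN sur.
  by apply/seteqP; split=> x; [case | move=> Mx; split=> //; exact: MU].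
exists q; rewrite -MN nullity_set_sum // defect_set_sum //.
by rewrite nM0 dM0 nu de !add0e.
Qed.

Lemma continuous_bounded_op T : continuous T -> bounded_op T.
Proof.
move=> cT; have /linear_boundedP := @continuous_linear_bounded _ _ _ 0 T (cT 0).
move=> [M [Mr hM]].
have M1 : M < (`|complex.Re M| + 1)%:C.
  have [x Mx] := complex_realP _ Mr.
  by rewrite Mx ltcR /=; have := ler_norm x; lra.
exists (`|complex.Re M| + 1); first by rewrite addr_ge0.
by move=> x; have := hM _ M1 x; rewrite norm_le_rn.
Qed.

Lemma RedP T M N : Red T M N ->
  [/\ closed_subspace M /\ closed_subspace N, invariant_on M T /\ invariant_on N T,
      set_sum M N = setT & M `&` N = [set 0]].
Proof. by []. Qed.

Lemma GDM_class_Kato i T : bounded_op T -> GDM_class i T ->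
  exists M N, [/\ Red T M N, Kato M T, index_class i (nullity M T) (defect M T) & meromorphic N T].
Proof.
move=> bT [M [N [/RedP[[cM cN] [TM TN] MN MN0] /(classR_index i bT cM TM)[cr ic] mer]]].
have sM := closed_subspace_linsub cM; have sN := closed_subspace_linsub cN.
have sF := semi_FredholmI bT cM TM cr (index_class_fin ic).
have [K [n [b [p [q [[cK [TK TJ] KJ KJ0] [kK nJ nu de]]]]]]] := semi_Fredholm_decomposable bT cM TM sF.
have cJ : closed_subspace (span_of b) by exact/closed_plus_span/closed_subspace_set0.
have sK := closed_subspace_linsub cK; have sJ := closed_subspace_linsub cJ.
have [d1 d2] : K `&` set_sum (span_of b) N = [set 0] /\ span_of b `&` N = [set 0].
  by apply: direct_sumA => //; rewrite KJ.
have cJN : closed_subspace (set_sum (span_of b) N).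
  by rewrite set_sumC set_sum_span; exact: closed_plus_span.
exists K, (set_sum (span_of b) N); split=> //.
- split=> //; first by split=> //; exact: invariant_set_sum.
  by rewrite -/(set_sum _ _) set_sumA KJ.
- apply: (@index_class_cancel _ _ _ q); rewrite ?quotient_dim_nneg //.
  by move: ic; rewrite -KJ nullity_set_sum // defect_set_sum // nu de.
- exact: (meromorphic_nilpotent_sum bT cJ cN cJN d2 TJ TN nJ mer).
Qed.

Lemma iter_commute f n (mu : R[i]) x : iter n f (subscal f mu x) = subscal f mu (iter n f x).
Proof. by rewrite /subscal (linearB (iter n f)) (linearZ_LR (iter n f)) /= -iterSr. Qed.

End Classes.

(** * The implications between the four conditions *)

Section Implications.
Context {R : realType} {X : completeNormedModType R[i]}.
Implicit Types (U V M N : set X) (f T : {linear X -> X}).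

Lemma nbhs0_rn (A : set R[i]^o) :
  nbhs (0 : R[i]^o) A <-> exists2 d : R, 0 < d & forall z : R[i], rn z < d -> A z.
Proof.
split=> [/nbhs_ballP[e /= e0 eA]|[d d0 dA]].
  have [eE e'0] := ltC0 e0; exists (complex.Re e) => // z zd; apply: eA.
  by rewrite -ball_normE /= sub0r normrN eE rnE ltcR.
apply/nbhs_ballP; exists d%:C; first by rewrite /= ltcR.
by move=> z; rewrite -ball_normE /= sub0r normrN rnE ltcR => /dA.
Qed.

Lemma op_ranT T M N f n : set_sum M N = setT ->
  op_ran setT (iter n f) = set_sum (op_ran M (iter n f)) (op_ran N (iter n f)).
Proof. by move=> <-; exact: (@op_ran_set_sum _ _ M N (iter n f)). Qed.

Section Decomposed.
Context (T : {linear X -> X}) (M N : set X) (i : nat).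
Context (bT : bounded_op T) (red : Red T M N) (kM : Kato M T).

Let cM : closed_subspace M. Proof. by case: red => -[]. Qed.
Let cN : closed_subspace N. Proof. by case: red => -[]. Qed.
Let sM : linsub M. Proof. exact: closed_subspace_linsub. Qed.
Let sN : linsub N. Proof. exact: closed_subspace_linsub. Qed.
Let MN : set_sum M N = setT. Proof. by case: red. Qed.
Let MN0 : M `&` N = [set 0]. Proof. by case: red. Qed.
Let TM : invariant_on M T. Proof. by case: red => _ []. Qed.
Let TN : invariant_on N T. Proof. by case: red => _ []. Qed.

(** The range of a power splits along [M] and [N], and the Kato summand keeps its nullity and
    defect. The last two identities let closedness pass from the whole range to its part in [N]. *)
Let restricted_index (l : R[i]) n : Kato M (subscal T l) ->
  let D := subscal T l in let Y := op_ran setT (iter n D) in let YN := op_ran N (iter n D) in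
  [/\ linsub Y /\ invariant_on Y D, linsub YN /\ invariant_on YN D,
      nullity Y D = (nullity M D + nullity YN D)%E,
      defect Y D = (defect M D + defect YN D)%E &
      YN = Y `&` N /\ op_ran YN D = op_ran Y D `&` YN].
Proof.
move=> kD D Y YN.
have DM : invariant_on M D by exact: invariant_subscal.
have DN : invariant_on N D by exact: invariant_subscal.
have inv V : invariant_on V D -> invariant_on (op_ran V (iter n D)) D.
  by move=> DV _ [x Vx <-]; exists (D x); [exact: DV | rewrite -iterSr].
have YE : Y = set_sum (op_ran M (iter n D)) YN by exact: (@op_ranT T M N (subscal T l) n MN).
have sYM := @linsub_iter_ran _ _ M (subscal T l) n sM.
have sYN : linsub YN := @linsub_iter_ran _ _ N (subscal T l) n sN.
have Y0 : op_ran M (iter n D) `&` YN = [set 0].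
  apply/seteqP; split=> x; last by move=> ->; split; exact: linsub0.
  move=> [xM xN]; rewrite -MN0; split.
    exact: (@op_ran_sub _ _ M (subscal T l) n DM).
  exact: (@op_ran_sub _ _ N (subscal T l) n DN).
have DYM := inv M DM; have DYN := inv N DN.
split.
- split; first exact: (@linsub_iter_ran _ _ setT (subscal T l) n (@linsubT R X)).
  exact: inv.
- by [].
- rewrite YE (@nullity_set_sum _ _ _ _ (subscal T l)) //.
  by rewrite (@Kato_nullity_ran _ _ M (subscal T l)).
- rewrite YE (@defect_set_sum _ _ _ _ (subscal T l)) //.
  by rewrite (@Kato_defect_ran _ _ M (subscal T l)).
split.
  rewrite /Y -MN set_sumC; apply: (@ran_summand _ _ N M (iter n (subscal T l))) => //.
  - by rewrite setIC.
  - exact: (@invariant_iter _ _ N (subscal T l)).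
  - exact: (@invariant_iter _ _ M (subscal T l)).
rewrite YE set_sumC; apply: (@ran_summand _ _ YN (op_ran M (iter n D)) (subscal T l)) => //.
by rewrite setIC.
Qed.

Let YM_closed (l : R[i]) n : Kato M (subscal T l) -> closed_subspace (op_ran M (iter n (subscal T l))).
Proof.
move=> kD; apply: (@Kato_closed_ran _ _ M (subscal T l)) => //; first exact: bounded_subscal.
exact: invariant_subscal.
Qed.

(** Serves resolvent points of [T_N], with [n = 0], and its poles, with [n] the order: in both cases
    the part in [N] is bijective and adds [0] to nullity and defect. *)
Lemma classR_of_summand (l : R[i]) n : Kato M (subscal T l) ->
  index_class i (nullity M (subscal T l)) (defect M (subscal T l)) ->
  closed_subspace (op_ran N (iter n (subscal T l))) ->
  op_ran N (iter n.+1 (subscal T l)) = op_ran N (iter n (subscal T l)) ->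
  (forall x, op_ran N (iter n (subscal T l)) x -> subscal T l x = 0 -> x = 0) ->
  closed (op_ran setT (iter n (subscal T l))) /\
  classR i (op_ran setT (iter n (subscal T l))) (subscal T l).
Proof.
move=> kD ic cYN rYN injYN; have bD := bounded_subscal l bT.
have [[sY DY] [sYN DYN] nuY deY _] := restricted_index n kD.
have cS m : closed_subspace (op_ran N (iter m (subscal T l))) ->
    closed_subspace (op_ran setT (iter m (subscal T l))).
  move=> c; rewrite (@op_ranT T M N (subscal T l) m MN).
  apply: (closed_set_sum cM cN _ MN0 (YM_closed m kD) c).
  - by rewrite MN; exact: closed_subspaceT.
  - exact: (@op_ran_sub _ _ M (subscal T l) m (invariant_subscal l sM TM)).
  - exact: (@op_ran_sub _ _ N (subscal T l) m (invariant_subscal l sN TN)).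
have cY := cS n cYN; split; first by case: cY.
apply/(@classR_index _ _ i _ (subscal T l) bD cY DY); split.
  have [] : closed_subspace (op_ran setT (iter n.+1 (subscal T l))) by apply: cS; rewrite rYN.
  by rewrite op_ranS.
rewrite nuY deY.
rewrite (_ : nullity (op_ran N _) _ = 0%E); last exact/(@nullity_eq0 _ _ _ (subscal T l) sYN).
rewrite (_ : defect (op_ran N _) _ = 0%E); last first.
  by apply/(@defect_eq0 _ _ _ (subscal T l) sYN DYN); rewrite -op_ranS rYN.
by rewrite !adde0.
Qed.

Lemma not_interior_sigmaR : index_class i (nullity M T) (defect M T) -> meromorphic N T ->
  ~ interior (sigmaR i [set: X] T) (0 : R[i]^o).
Proof.
move=> ic mer /nbhs0_rn[e e0 he].
have [d d0 hd] := Kato_stable bT cM TM kM.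
have [|z [zd inv]] := @meromorphic_dense _ _ N T 0 (Num.min e d) mer.
  by rewrite lt_min e0.
move: zd; rewrite subr0 lt_min => /andP[ze zd].
have [kz nz dz] := hd z zd; apply: (he z ze).
have [|||||_] := @classR_of_summand z 0%N; rewrite ?op_ran0 ?nz ?dz //.
- by rewrite op_ranS op_ran0; apply: invertible_ran => //; exact: invariant_subscal.
- by move=> x; exact: invertible_inj.
Qed.

Lemma not_limit_sigmaBR : index_class i (nullity M T) (defect M T) -> meromorphic N T ->
  ~ limit_point (sigmaBR i [set: X] T) (0 : R[i]^o).
Proof.
move=> ic mer lim.
have [d d0 hd] := Kato_stable bT cM TM kM.
have [|y [y0 sy yd]] := lim [set z | rn (z : R[i]) < d].
  by apply/nbhs0_rn; exists d.
have [ky ny dy] := hd y yd; apply: sy.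
have gN := invariant_subscal y sN TN.
have [inv|ninv] := pselect (invertible N (subscal T y)).
  exists 0%N; apply: classR_of_summand; rewrite ?op_ran0 ?ny ?dy //.
  - by rewrite op_ranS op_ran0; apply: invertible_ran.
  - by move=> x; exact: invertible_inj.
have [p [c r inj]] := pole_drazin bT cN TN (mer y ninv y0).
by exists p; apply: classR_of_summand; rewrite ?ny ?dy.
Qed.

Lemma index_of_not_interior : meromorphic N T -> ~ interior (sigmaBR i [set: X] T) (0 : R[i]^o) ->
  GDM_class i T.
Proof.
move=> mer nint; exists M, N; split=> //.
have [d d0 hd] := Kato_stable bT cM TM kM.
have [z zd [n [cY cRY]]] : exists2 z, rn z < d & classBR i setT (subscal T z).
  apply: contrapT => nz; apply: nint; apply/nbhs0_rn; exists d => // z zd cz.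
  by apply: nz; exists z.
have [kz nz dz] := hd z zd; have bD := bounded_subscal z bT.
have [[sY DY] [sYN DYN] nuY deY [YNE ranYN]] := restricted_index n kz.
have csY : closed_subspace (op_ran setT (iter n (subscal T z))) by apply/closed_linsubP.
have [cr ic] := (@classR_index _ _ i _ (subscal T z) bD csY DY).1 cRY.
have csYN : closed_subspace (op_ran N (iter n (subscal T z))).
  by rewrite YNE; exact: closed_subspaceI.
have sF : semi_Fredholm (op_ran N (iter n (subscal T z))) (subscal T z).
  apply: (@semi_FredholmI _ _ _ (subscal T z) bD csYN DYN).
    by rewrite ranYN; apply: closedI => //; case: csYN.
  have := index_class_fin ic; rewrite nuY deY => -[h|h]; [left | right]; apply: le_lt_trans h;
    by rewrite leeDr // quotient_dim_nneg.
have [|q [nuq deq]] := @index0_of_resolvent _ _ _ (subscal T z) bD csYN DYN sF.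
  (* A resolvent point [w] of [T_N] near [z] is still one on the range of the power, since [T - w]
     commutes with [T - z]. *)
  move=> e e0; have [w [wz inv]] := meromorphic_dense z mer e0.
  exists (w - z); split=> //.
    move=> x /(@op_ran_sub _ _ N (subscal T z) n (invariant_subscal z sN TN)) Nx.
    by rewrite subscal_subscal addrC subrK; exact: (invertible_inj sN inv Nx).
  apply/seteqP; split=> x.
    move=> [_ [y Ny <-] <-]; exists (subscal (subscal T z) (w - z) y).
      by rewrite subscal_subscal; exact: invariant_subscal.
    exact: (@iter_commute _ _ (subscal T z)).
  move=> [y Ny <-].
  have : op_ran N (subscal T w) y by rewrite (invertible_ran (invariant_subscal w sN TN) inv).
  move=> [y' Ny' <-]; exists (iter n (subscal T z) y'); first by exists y'.
  rewrite -(@iter_commute _ _ (subscal T z)); congr (iter n _ _).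
  by rewrite subscal_subscal addrC subrK.
apply/(classR_index i bT cM TM); split; first by case: kM.
rewrite -nz -dz; apply: (@index_class_cancel _ _ _ _ q); rewrite ?quotient_dim_nneg //.
by move: ic; rewrite nuY deY nuq deq.
Qed.

End Decomposed.

Lemma sigmaBR_sub i T : sigmaBR i [set: X] T `<=` sigmaR i [set: X] T.
Proof.
move=> z h cz; apply: h; exists 0%N; rewrite op_ran0; split=> //; exact: closedT.
Qed.

Lemma interior_limit_point (A : set R[i]^o) : interior A 0 -> limit_point A 0.
Proof.
move=> /nbhs0_rn[d d0 dA] V /nbhs0_rn[e e0 eV].
have [|z] := @real_point_near R 0 (Num.min d e); first by rewrite lt_min d0.
rewrite subr0 lt_min => /andP[z0 /andP[zd ze]].
by exists z; split; [rewrite -rn_gt0 | exact: dA | exact: eV].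
Qed.

End Implications.

Theorem theorem2p1 (R : realType) (X : completeNormedModType R[i])
    (hX : space_dim [set: X] = +oo%E)
    (T : {linear X -> X}) (hT : continuous T)
    (i : nat) (hi : (1 <= i <= 9)%N) :
  [<-> GDM_class i T;
       GK_meromorphic_decomposition T /\
         ~ interior (sigmaR i [set: X] T) (0 : R[i]^o);
       GK_meromorphic_decomposition T /\
         ~ limit_point (sigmaBR i [set: X] T) (0 : R[i]^o);
       GK_meromorphic_decomposition T /\
         ~ interior (sigmaBR i [set: X] T) (0 : R[i]^o)].
Proof.
have bT := continuous_bounded_op hT.
(* The last implication comes first: the decomposition given in the second condition says nothing
   about the class of [T_M], so the third is reached through the first, using that [sigmaBR] is
   contained in [sigmaR]. *)
have back : GK_meromorphic_decomposition T /\ ~ interior (sigmaBR i [set: X] T) (0 : R[i]^o) ->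
    GDM_class i T.
  by move=> [[M [N [red kM mer]]]]; exact: (index_of_not_interior bT red kM mer).
tfae.
- move=> /(GDM_class_Kato bT)[M [N [red kM ic mer]]]; split; first by exists M, N.
  exact: not_interior_sigmaR bT red kM ic mer.
- move=> [gk nint].
  have /(GDM_class_Kato bT)[M [N [red kM ic mer]]] : GDM_class i T.
    apply: back; split=> // h; apply: nint; exact: interiorS (@sigmaBR_sub _ _ i T) _ h.
  by split=> //; exact: not_limit_sigmaBR bT red kM ic mer.
- by move=> [gk nlim]; split=> // h; apply: nlim; exact: interior_limit_point.
- exact: back.
Qed.
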